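(* Up to affine transformations of $x$ and re-scaling of $t$ by a positive factor, the following list consists of exactly the non-trivial free Meixner systems. In each case $\{P_n(x,t)\}_{n\ge 0}$ (with $P_0=1$, $P_{-1}=0$) is the system of monic orthogonal polynomials of the free convolution semigroup $\{\mu_t\}$, and there is a formal power series $u\in\mathcal P_{0,1}$ with \[ \sum_{n=0}^\infty P_n(x,t) z^n=\frac{1}{u(z)\,(K_t(u(z))-x)}=\frac{1}{1+t\,u(z)R_\mu(u(z))-u(z)x}. \] The cases are: \begin{itemize} \item (Semicircular / Chebyshev) $P_{n+1}(x,t)=xP_n(x,t)-tP_{n-1}(x,t)$ for $n\ge0$; $P_n(x,t)=U_n(x,t)$; $\mu_t=\sigma_t=\sigma_{0,t}$; $u(z)=z$, $R_\mu(z)=z$. \item (Free Poisson / Charlier) $P_1(x,t)=x-t$ and $P_{n+1}(x,t)=(x-(t+1))P_n(x,t)-tP_{n-1}(x,t)$ for $n\ge1$; $P_n(x,t)=Q_n(x,t)+Q_{n-1}(x,t)$ for $n\ge1$, where $Q_n(x,t)=U_n(x-(t+1),t)$; $\mu_t(dx)=\frac{t}{x}\sigma_{1+t,t}(dx)+\max(1-t,0)\delta_0$; $u(z)=\frac{z}{1+z}$, $R_\mu(z)=\frac{1}{1-z}$. \item In the remaining three cases there is a parameter $a\ge0$, and with $\alpha(t)=a(t+2)$, $\beta(t)=t+1$: $P_1(x,t)=x-at$, $P_2(x,t)=(x-a(t+2))P_1(x,t)-tP_0(x,t)$, and $P_{n+1}(x,t)=(x-a(t+2))P_n(x,t)-(t+1)P_{n-1}(x,t)$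 for $n\ge2$. Moreover $P_1=Q_1+2aQ_0$ and $P_n=Q_n+2aQ_{n-1}+Q_{n-2}$ for $n\ge2$, where $Q_n(x,t)=U_n(x-\alpha(t),\beta(t))$; $u(z)=\frac{z}{1+2az+z^2}$ and $R_\mu(z)=\frac{z^{-1}-\sqrt{(2a-z^{-1})^2-4}}{2}$. The semigroups are: \begin{itemize} \item (Continuous binomial / Meixner–Pollaczek) $0\le a<1$: $\mu_t(dx)=\frac{t\beta(t)}{x^2+t^2(1-a^2)}\sigma_{\alpha(t),\beta(t)}(dx)$. \item (Gamma / Laguerre) $a=1$: $\mu_t(dx)=\frac{t(1+t)}{x^2}\sigma_{2+t,1+t}(dx)$. \item (Negative binomial / Meixner) $a>1$: $\mu_t(dx)=\frac{t\beta(t)}{x^2-t^2(a^2-1)}\sigma_{\alpha(t),\beta(t)}(dx)+\max\Bigl(1-t\frac{a-\sqrt{a^2-1}}{2\sqrt{a^2-1}},0\Bigr)\delta_{t\sqrt{a^2-1}}$. \end{itemize} \end{itemize}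
   Context: Free probability setup. For a linear functional $\nu$ on $\mathbb C[x]$ with $\langle\nu,1\rangle=1$, $G_\nu(z)=\sum_{n\ge0}\langle\nu,x^n\rangle z^{-(n+1)}$ is its Cauchy transform (a formal series in $z^{-1}$, or an analytic function off $\mathbb R$ for measures), $K_\nu$ its compositional inverse, of the form $K_\nu(z)=\frac1z+\sum_{n\ge1}r_n(\nu)z^{n-1}$ ($r_n$ = free cumulants), and $R_\nu(z)=K_\nu(z)-\frac1z$ its $R$-transform; free convolution $\boxplus$ is characterized by $R_{\mu\boxplus\nu}=R_\mu+R_\nu$. A freely infinitely divisible probability measure $\mu$ with finite moments of all orders gives a free convolution semigroup $\{\mu_t\}_{t\ge0}$ of probability measures with $\mu_0=\delta_0$, $\mu_1=\mu$, $R_{\mu_t}=tR_\mu$; write $K_t=K_{\mu_t}=\frac1z+tR_\mu(z)$. $\mathcal P_{0,1}$ denotes formal power series $u(z)$ with $u(0)=0$, $u'(0)=1$. For $u,v\in\mathcal P_{0,1}$, the polynomials $Q_n(x,t)$ defined by $\frac{1}{u(z)(K_t(v(z))-x)}=\sum_{n\ge0}Q_n(x,t)z^n$ form a generalized free Sheffer system for $\{\mu_t\}$. A free Meixner system is a family $\{P_n(x,t)\}$ such that for each $t$, $\{P_n(\cdot,t)\}$ are the monic orthogonal polynomials of $\mu_t$, and which is a generalized free Sheffer system for $\{\mu_t\}$; non-trivial means $\mu_1$ has nonzero variance. Semicircular distribution with mean $\alpha$ and variance $\beta$: $\sigma_{\alpha,\beta}(dx)=\frac{1}{2\pi\beta}\sqrt{4\beta-(x-\alpha)^2}\,\mathbf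 1_{[\alpha-2\sqrt\beta,\alpha+2\sqrt\beta]}(x)\,dx$, $\sigma_t=\sigma_{0,t}$. Chebyshev polynomials of the second kind: $U_n(2\cos\theta)=\frac{\sin(n+1)\theta}{\sin\theta}$, $U_n(x,t)=t^{n/2}U_n(x/\sqrt t)$, and $U_n(x-\alpha,\beta)$ means $U_n(\cdot,\beta)$ evaluated at $x-\alpha$. *)

(* Defs.v *)
From HB Require Import structures.
From mathcomp Require Import all_boot all_order all_algebra.
From mathcomp Require Import all_classical all_reals all_analysis.

Set Implicit Arguments.
Unset Strict Implicit.
Unset Printing Implicit Defensive.

Import Order.TTheory GRing.Theory Num.Theory.
Local Open Scope ring_scope.
Local Open Scope classical_set_scope.

Section FreeMeixner.
Variable R : realType.

Definition series := nat -> R.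

Definition sconst (c : R) : series := fun n => if n == 0%N then c else 0.
Definition sX : series := fun n => if n == 1%N then 1 else 0.
Definition spoly (p : {poly R}) : series := fun n => p`_n.
Definition sadd (f g : series) : series := fun n => f n + g n.
Definition sopp (f : series) : series := fun n => - f n.
Definition sscale (c : R) (f : series) : series := fun n => c * f n.
Definition smul (f g : series) : series :=
  fun n => \sum_(k < n.+1) f k * g (n - k)%N.
Definition spow (f : series) (k : nat) : series := iter k (smul f) (sconst 1).
(* composition f(g(z)), meaningful when g 0 = 0 *)
Definition scomp (f g : series) : series :=
  fun n => \sum_(k < n.+1) f k * spow g k n.
(* f(z)/z, meaningful when f 0 = 0 *)
Definition sdivX (f : series) : series := fun n => f n.+1.

Fixpoint srec_seq (step : seq R -> R) (n : nat) : seq R :=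
  match n with
  | 0 => [::]
  | n'.+1 => let s := srec_seq step n' in rcons s (step s)
  end.
Definition srec (step : seq R -> R) : series := fun n => step (srec_seq step n).

(* multiplicative inverse 1/f(z) of a series with f 0 <> 0 *)
Definition sinv (f : series) : series :=
  srec (fun s => let n := size s in
          if n == 0%N then (f 0%N)^-1
          else - (f 0%N)^-1 * \sum_(k < n) f (n - k)%N * nth 0 s k).

(* the square root with constant term 1 of a series q with q 0 = 1 *)
Definition fsqrt (q : series) : series :=
  srec (fun s => let n := size s in
          if n == 0%N then 1
          else (q n - \sum_(1 <= k < n) nth 0 s k * nth 0 s (n - k)%N) / 2).

Definition P01 (u : series) : Prop := u 0%N = 0 /\ u 1%N = 1.

Definition moment (mu : probability R R) (n : nat) : R :=
  fine (\int[mu]_x (x ^+ n)%:E)%E.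

(* G_mu(z) = sum_n m_n z^{-(n+1)}, written as a formal power series in
   w = z^{-1}: coefficient of w^(n+1) is m_n. *)
Definition cauchy_ser (mu : probability R R) : series :=
  fun n => if n == 0%N then 0 else moment mu n.-1.

(* Rs is the R-transform of mu: with K(z) = 1/z + Rs(z) we have
   1/K(z) = h(z) := z / (1 + z Rs(z)) and G(K(z)) = sum_n m_n h(z)^(n+1),
   and K is the compositional inverse of G, i.e. G(K(z)) = z. *)
Definition is_Rtransform (mu : probability R R) (Rs : series) : Prop :=
  let h := smul sX (sinv (sadd (sconst 1) (smul sX Rs))) in
  scomp (cauchy_ser mu) h = sX.

Definition free_semigroup (mu : R -> probability R R) (Rmu : series) : Prop :=
  [/\ (forall t, 0 <= t -> forall n : nat,
          (mu t).-integrable setT (fun x : R => (x ^+ n)%:E)),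
      (forall A, measurable A -> mu 0 A = \d_(0 : R) A) &
      (forall t, 0 <= t -> is_Rtransform (mu t) (sscale t Rmu))].

Definition nontrivial (mu : R -> probability R R) : Prop :=
  moment (mu 1) 2 - moment (mu 1) 1 ^+ 2 != 0.

(* u(z) (K_t(v(z)) - x) = u(z)/v(z) + t u(z) R_mu(v(z)) - x u(z),
   with u(z)/v(z) = (u(z)/z) * (v(z)/z)^{-1}. *)
Definition sheffer_den (Rmu : series) (t : R) (u v : series) (x : R) : series :=
  sadd (smul (sdivX u) (sinv (sdivX v)))
       (sadd (sscale t (smul u (scomp Rmu v))) (sscale (- x) u)).

Definition genser (P : nat -> R -> {poly R}) (t x : R) : series :=
  fun n => (P n t).[x].

Definition gen_free_Sheffer (Rmu : series) (P : nat -> R -> {poly R}) : Prop :=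
  exists u v : series, [/\ P01 u, P01 v &
    forall t, 0 <= t -> forall x : R,
      genser P t x = sinv (sheffer_den Rmu t u v x)].

Definition monic_OPS (mu : probability R R) (p : nat -> {poly R}) : Prop :=
  (forall n, p n \is monic /\ size (p n) = n.+1) /\
  (forall n m : nat, n <> m ->
     (\int[mu]_x ((p n).[x] * (p m).[x])%:E)%E = 0%E).

Definition free_Meixner (mu : R -> probability R R) (P : nat -> R -> {poly R})
  : Prop :=
  exists Rmu : series,
    [/\ free_semigroup mu Rmu,
        (forall t, 0 <= t -> monic_OPS (mu t) (fun n => P n t)) &
        gen_free_Sheffer Rmu P].

Fixpoint jac_pair (al om : nat -> R) (n : nat) : {poly R} * {poly R} :=
  match n with
  | 0 => (1, 'X - (al 0%N)%:P)
  | n'.+1 => let pq := jac_pair al om n' in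
             (pq.2, ('X - (al n)%:P) * pq.2 - (om n)%:P * pq.1)
  end.
Definition jacP (al om : nat -> R) (n : nat) : {poly R} := (jac_pair al om n).1.

(* Chebyshev polynomials of the second kind: U_0 = 1, U_1 = x,
   U_{n+1} = x U_n - U_{n-1} (so that U_n(2 cos th) = sin((n+1)th)/sin th) *)
Definition chebU (n : nat) : {poly R} := jacP (fun _ => 0) (fun _ => 1) n.

(* U_n(x,t) = t^{n/2} U_n(x / sqrt t) = sum_k (U_n)_k (sqrt t)^(n-k) x^k *)
Definition chebU2 (n : nat) (t : R) : {poly R} :=
  \poly_(k < n.+1) ((chebU n)`_k * Num.sqrt t ^+ (n - k)).

Definition chebQ (n : nat) (al be : R) : {poly R} :=
  (chebU2 n be) \Po ('X - al%:P).

Definition semicirc_dens (al be x : R) : R :=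
  if `|x - al| <= 2 * Num.sqrt be
  then (2 * pi * be)^-1 * Num.sqrt (4 * be - (x - al) ^+ 2) else 0.

Inductive mcase : Type :=
| MSemicircle
| MPoisson
| MFamily of R.          (* parameter a >= 0: a<1 continuous binomial,
                            a=1 Gamma, a>1 negative binomial *)

Definition case_ok (c : mcase) : Prop :=
  match c with MFamily a => 0 <= a | _ => True end.

Definition listedP (c : mcase) (n : nat) (t : R) : {poly R} :=
  match c with
  | MSemicircle => jacP (fun _ => 0) (fun _ => t) n
  | MPoisson => jacP (fun k => if k == 0%N then t else t + 1) (fun _ => t) n
  | MFamily a => jacP (fun k => if k == 0%N then a * t else a * (t + 2))
                      (fun k => if k == 1%N then t else t + 1) n
  end.

Definition listed_u (c : mcase) : series :=
  match c with
  | MSemicircle => sX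
  | MPoisson => smul sX (sinv (spoly (1 + 'X)))
  | MFamily a =>
      smul sX (sinv (spoly (1 + (2 * a) *: 'X + 'X ^+ 2)))
  end.

Definition listed_R (c : mcase) : series :=
  match c with
  | MSemicircle => sX
  | MPoisson => sinv (spoly (1 - 'X))
  | MFamily a =>
      (* (z^{-1} - sqrt((2a - z^{-1})^2 - 4))/2, where
         sqrt((2a - z^{-1})^2 - 4) = z^{-1} sqrt((2az - 1)^2 - 4 z^2)
         (branch making R a power series) *)
      sscale (1 / 2) (sdivX (sadd (sconst 1)
        (sopp (fsqrt (spoly (((2 * a) *: 'X - 1) ^+ 2 - 4 *: 'X ^+ 2))))))
  end.

Definition listed_dens (c : mcase) (t x : R) : R :=
  match c with
  | MSemicircle => semicirc_dens 0 t x
  | MPoisson => t / x * semicirc_dens (1 + t) t x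
  | MFamily a =>
      let al := a * (t + 2) in let be := t + 1 in
      if a < 1 then t * be / (x ^+ 2 + t ^+ 2 * (1 - a ^+ 2)) * semicirc_dens al be x
      else if a == 1 then t * (1 + t) / x ^+ 2 * semicirc_dens (2 + t) (1 + t) x
      else t * be / (x ^+ 2 - t ^+ 2 * (a ^+ 2 - 1)) * semicirc_dens al be x
  end.

Definition listed_atom_w (c : mcase) (t : R) : R :=
  match c with
  | MSemicircle => 0
  | MPoisson => Num.max (1 - t) 0
  | MFamily a =>
      if 1 < a then
        Num.max (1 - t * ((a - Num.sqrt (a ^+ 2 - 1)) / (2 * Num.sqrt (a ^+ 2 - 1)))) 0
      else 0
  end.

Definition listed_atom_p (c : mcase) (t : R) : R :=
  match c with
  | MFamily a => if 1 < a then t * Num.sqrt (a ^+ 2 - 1) else 0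
  | _ => 0
  end.

Definition listedMu (c : mcase) (t : R) (A : set R) : \bar R :=
  (\int[@lebesgue_measure R]_(x in A) (listed_dens c t x)%:E
    + (listed_atom_w c t)%:E * \d_(listed_atom_p c t) A)%E.

Definition cheb_relation (c : mcase) (t : R) : Prop :=
  match c with
  | MSemicircle => forall n, listedP c n t = chebU2 n t
  | MPoisson =>
      forall n, (1 <= n)%N ->
        listedP c n t = chebQ n (t + 1) t + chebQ n.-1 (t + 1) t
  | MFamily a =>
      let Q k := chebQ k (a * (t + 2)) (t + 1) in
      listedP c 1 t = Q 1%N + (2 * a) *: Q 0%N /\
      forall n, (2 <= n)%N ->
        listedP c n t = Q n + (2 * a) *: Q n.-1 + Q n.-2
  end.

End FreeMeixner.

Arguments MSemicircle {R}.
Arguments MPoisson {R}.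

(* Main.v *)
(* Writing B = u R(u), a diagonal Sheffer system has generating function
   1 / (1 + t B - x u), and the systems of the list are the instances of
   N u = z, N B = m z + k z^2 with N = 1 + c z + d z^2, i.e. of a three-term
   recurrence with coefficients affine in t from the second step on.

   That the listed measures are the orthogonality measures rests on the
   semicircular moments and on the division of the semicircular density by a
   polynomial D: D Q_n is a combination of three consecutive P_k, so the
   moments of the P_k satisfy a linear recurrence, which is pinned down by a
   growth estimate on the support and by the Cauchy transform at the zeros of
   D.

   Conversely, pairing the generating function with mu_t and comparing with
   the R-transform equation forces u = v.  Inverting 1 + t B - x u expresses
   P_(n+1) through all the previous polynomials; the defect of the expected
   three-term recurrence has low degree and is orthogonal to everything of low
   degree, hence vanishes as long as the norms of the P_k do not.  Positivity
   of the second norm at small t gives k > 0 and d >= 0, so all the norms at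
   t = 1 are nonzero; this determines u and B, and thereby the system at all t.
   The measures are then identified by determinacy of the moment problem for
   compactly supported measures. *)

(* The zeros of D decide how the listed measures are treated. Real simple zeros lie to the left of
   the interior of the support, and partial fractions reduce mass and mean to the Cauchy transform
   of the semicircle law there, the edge included. For the family with a <= 1 the zeros are non-real
   or double. There the moments of the P_k solve a recurrence whose characteristic roots have
   modulus beta = t + 1, while the estimate on the support allows only growth sqrt(beta)^k; as beta
   > 1, only the zero solution remains, and even the total mass is read off from the recurrence.

   In the converse the obstacle is that vanishing norms cannot be excluded beforehand: mu_t might
   have finite support, and orthogonality then says little about the high polynomials. The norms of
   P_1 and P_2, however, are k t and k t (k t + d) at every t, since their computation uses only the
   norm of 1; a time with k t = - d / 2 excludes d < 0. As u and B do not depend on t, one time with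
   nonvanishing norms suffices. *)
Require Import Defs.
From HB Require Import structures.
From mathcomp Require Import all_boot all_order all_algebra.
From mathcomp Require Import all_classical all_reals all_analysis.
From mathcomp Require Import measurable_realfun.
From mathcomp Require Import ring lra.
Import Order.TTheory GRing.Theory Num.Theory.
Import numFieldNormedType.Exports.
Local Open Scope ring_scope.
Local Open Scope classical_set_scope.

Set Implicit Arguments.
Unset Strict Implicit.
Unset Printing Implicit Defensive.


(** * Formal power series *)

(* An alias of [series], so that the ring structure given by the Cauchy
   product does not clash with the pointwise one on functions. *)
Definition fps (R : realType) : Type := nat -> R.

Section SeriesRing.
Variable R : realType.
Implicit Types (f g h : fps R) (n : nat).

(** Coefficient n of a product or composition sees only coefficients up to n, so identities of
    series are inherited from polynomial truncations. *)
Definition trunc n f : {poly R} := \poly_(i < n) f i.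

Lemma coef_trunc n f i : (i < n)%N -> (trunc n f)`_i = f i.
Proof. by rewrite coef_poly => ->. Qed.

Lemma smul_coef f g (p q : {poly R}) n :
  (forall k, (k <= n)%N -> p`_k = f k) -> (forall k, (k <= n)%N -> q`_k = g k) ->
  smul f g n = (p * q)`_n.
Proof.
move=> hp hq; rewrite coefM /smul; apply: eq_bigr => i _.
by rewrite hp ?leq_ord // hq // leq_subr.
Qed.

Lemma smul_trunc f g m n : (n < m)%N -> smul f g n = (trunc m f * trunc m g)`_n.
Proof.
by move=> nm; apply: smul_coef => k kn; rewrite coef_trunc // (leq_ltn_trans kn).
Qed.

Fact smulC : commutative (@smul R).
Proof. by move=> f g; apply/funext => n; rewrite !(@smul_trunc _ _ n.+1) // mulrC. Qed.

Fact smulA : associative (@smul R).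
Proof.
move=> f g h; apply/funext => n.
have E k a b : (k <= n)%N -> (trunc n.+1 a * trunc n.+1 b)`_k = smul a b k.
  by move=> kn; rewrite (@smul_trunc _ _ n.+1).
rewrite (@smul_coef _ _ (trunc n.+1 f) (trunc n.+1 g * trunc n.+1 h)) //; last 2 first.
- by move=> k kn; rewrite coef_trunc.
- by move=> k kn; apply: E.
rewrite (@smul_coef _ _ (trunc n.+1 f * trunc n.+1 g) (trunc n.+1 h)) ?mulrA //.
- by move=> k kn; apply: E.
- by move=> k kn; rewrite coef_trunc.
Qed.

Fact smul1f : left_id (sconst 1) (@smul R).
Proof.
move=> f; apply/funext => n; rewrite /smul big_ord_recl /= subn0 mul1r.
by rewrite big1 ?addr0 // => i _; rewrite /sconst /= mul0r.
Qed.

Fact smulDl : left_distributive (@smul R) (@sadd R).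
Proof.
move=> f g h; apply/funext => n; rewrite /smul /sadd -big_split /=.
by apply: eq_bigr => i _; rewrite mulrDl.
Qed.

HB.instance Definition _ := gen_eqMixin (fps R).
HB.instance Definition _ := gen_choiceMixin (fps R).

Fact saddA : associative (@sadd R).
Proof. by move=> f g h; apply/funext => n; rewrite /sadd addrA. Qed.
Fact saddC : commutative (@sadd R).
Proof. by move=> f g; apply/funext => n; rewrite /sadd addrC. Qed.
Fact sadd0 : left_id (sconst 0) (@sadd R).
Proof. by move=> f; apply/funext => n; rewrite /sadd /sconst; case: ifP; rewrite add0r. Qed.
Fact saddN : left_inverse (sconst 0) (@sopp R) (@sadd R).
Proof. by move=> f; apply/funext => n; rewrite /sadd /sopp /sconst; case: ifP; rewrite addNr. Qed.

HB.instance Definition _ := GRing.isZmodule.Build (fps R) saddA saddC sadd0 saddN.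

Fact sconst10 : (sconst 1 : fps R) != sconst 0.
Proof. by apply/eqP => /(congr1 (fun f => f 0%N)) /eqP; rewrite /sconst /= oner_eq0. Qed.

HB.instance Definition _ :=
  GRing.Zmodule_isComNzRing.Build (fps R) smulA smulC smul1f smulDl sconst10.

Lemma fpsD f g n : (f + g) n = f n + g n. Proof. by []. Qed.
Lemma fpsN f n : (- f) n = - f n. Proof. by []. Qed.
Lemma fpsB f g n : (f - g) n = f n - g n. Proof. by []. Qed.
Lemma fps0 n : (0 : fps R) n = 0. Proof. by change (sconst (0:R) n = 0); rewrite /sconst; case: ifP. Qed.
Lemma fps1 n : (1 : fps R) n = (n == 0%N)%:R.
Proof. by change (sconst (1:R) n = (n == 0%N)%:R); rewrite /sconst; case: ifP. Qed.
Lemma fpsM f g n : (f * g) n = \sum_(k < n.+1) f k * g (n - k)%N. Proof. by []. Qed.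
Lemma fpsM0 f g : (f * g) 0%N = f 0%N * g 0%N.
Proof. by rewrite fpsM big_ord1. Qed.
Lemma fps_sum I (r : seq I) (P : pred I) (F : I -> fps R) n :
  (\sum_(i <- r | P i) F i) n = \sum_(i <- r | P i) F i n.
Proof.
by apply: (big_morph (fun f : fps R => f n) (id1 := 0) (op1 := +%R)) => //; rewrite fps0.
Qed.
Lemma sconstM (c : R) f n : ((sconst c : fps R) * f) n = c * f n.
Proof.
rewrite fpsM big_ord_recl /= subn0 big1 ?addr0 // => i _.
by rewrite /sconst /= mul0r.
Qed.
Lemma sscaleE c f : sscale c f = (sconst c : fps R) * f.
Proof. by apply/funext => n; rewrite sconstM. Qed.
Lemma sconstE (a b : R) : (sconst a : fps R) * sconst b = sconst (a * b).
Proof. by apply/funext => n; rewrite sconstM /sconst; case: ifP => // _; rewrite mulr0. Qed.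
Lemma sconstD (a b : R) : (sconst a : fps R) + sconst b = sconst (a + b).
Proof. by apply/funext => n; rewrite fpsD /sconst; case: ifP => // _; rewrite addr0. Qed.
Lemma sconst_nat n : (sconst (n%:R : R) : fps R) = n%:R.
Proof. by elim: n => [//|n IH]; rewrite !mulrS -IH -sconstD. Qed.
Lemma sXM f n : ((sX R : fps R) * f) n = if n is m.+1 then f m else 0.
Proof.
case: n => [|n]; first by rewrite fpsM0 /sX /= mul0r.
rewrite fpsM !big_ord_recl /= /sX /= mul0r add0r mul1r subSS subn0 big1 ?addr0 //.
by move=> i _; rewrite mul0r.
Qed.
Lemma spowE f k : spow f k = (f : fps R) ^+ k.
Proof. by elim: k => [|k IH] //; rewrite exprS -IH. Qed.
Lemma spolyD p q : (spoly (p + q) : fps R) = (spoly p : fps R) + spoly q.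
Proof. by apply/funext => n; rewrite /spoly coefD. Qed.
Lemma spolyN p : (spoly (- p) : fps R) = - (spoly p : fps R).
Proof. by apply/funext => n; rewrite /spoly coefN. Qed.
Lemma spolyM p q : (spoly (p * q) : fps R) = (spoly p : fps R) * spoly q.
Proof. by apply/funext => n; rewrite /spoly coefM fpsM. Qed.
Lemma spolyC c : spoly (c%:P) = sconst c :> fps R.
Proof. by apply/funext => n; rewrite /spoly coefC /sconst. Qed.
Lemma spolyX : spoly 'X = sX R :> fps R.
Proof. by apply/funext => n; rewrite /spoly coefX /sX; case: eqP. Qed.

Lemma fps_mul_ord f g i j : (forall k, (k < i)%N -> f k = 0) ->
  (forall k, (k < j)%N -> g k = 0) -> forall k, (k < i + j)%N -> (f * g) k = 0.
Proof.
move=> hf hg k kij; rewrite fpsM big1 // => l _.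
have [li|il] := ltnP l i; first by rewrite hf ?mul0r.
rewrite hg ?mulr0 // ltn_subLR; last by rewrite -ltnS.
by rewrite (leq_trans kij) // leq_add2r.
Qed.

Lemma fps_exp_ord f k n : f 0%N = 0 -> (n < k)%N -> (f ^+ k) n = 0.
Proof.
move=> f0; elim: k n => // k IH n nk; rewrite exprS.
apply: (@fps_mul_ord _ _ 1 k) => //; by case.
Qed.

(** The history list handed to [step] consists of the earlier coefficients; this yields the
    recursion equations of [sinv] and [fsqrt]. *)
Lemma srec_seqE (step : seq R -> R) n : srec_seq step n = mkseq (srec step) n.
Proof.
elim: n => // n IH; rewrite /= /mkseq -addn1 iotaD map_cat /= cats1 -/(mkseq _ _) -IH.
by rewrite add0n.
Qed.

Lemma sinv0 f : sinv f 0%N = (f 0%N)^-1. Proof. by []. Qed.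

Lemma sinvS f n : sinv f n.+1 =
  - (f 0%N)^-1 * \sum_(k < n.+1) f (n.+1 - k)%N * sinv f k.
Proof.
rewrite {1}/sinv {1}/srec srec_seqE size_mkseq /=; congr (_ * _).
by apply: eq_bigr => i _; rewrite nth_mkseq.
Qed.

Lemma mul_sinv f : f 0%N != 0 -> f * (sinv f : fps R) = 1.
Proof.
move=> f0; apply/funext => -[|n]; rewrite fps1.
  by rewrite fpsM0 sinv0 mulfV.
rewrite mulrC fpsM big_ord_recr /= subnn sinvS [X in _ + X]mulrC mulNr mulrN mulVKf //.
apply/eqP; rewrite subr_eq0; apply/eqP.
by apply: eq_bigr => i _; rewrite mulrC.
Qed.

Lemma fps_inv_uniq f g h : f * g = 1 -> f * h = 1 -> g = h.
Proof. by move=> fg fh; rewrite -[g]mulr1 -fh mulrA [g * f]mulrC fg mul1r. Qed.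

Lemma fps_unit_neq0 f g : f * g = 1 -> f 0%N != 0.
Proof.
move=> /(congr1 (fun h => h 0%N)); rewrite fpsM0 fps1 eqxx.
by apply: contra_eqN => /eqP ->; rewrite mul0r eq_sym oner_eq0.
Qed.

Lemma sinv_uniq f g : f * g = 1 -> (sinv f : fps R) = g.
Proof.
by move=> fg; apply: (@fps_inv_uniq f) => //; rewrite mul_sinv // (fps_unit_neq0 fg).
Qed.

Lemma fps_cancel f g h : f 0%N != 0 -> f * g = f * h -> g = h.
Proof.
move=> f0 e; rewrite -[g]mul1r -[h]mul1r -(mul_sinv f0).
by rewrite [f * _]mulrC -!mulrA e.
Qed.

Lemma sdivXK f : f 0%N = 0 -> (sX R : fps R) * sdivX f = f.
Proof. by move=> f0; apply/funext => -[|n]; rewrite sXM. Qed.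

Lemma fsqrt0 (q : fps R) : fsqrt q 0%N = 1. Proof. by []. Qed.

Lemma fsqrtS (q : fps R) n : fsqrt q n.+1 =
  (q n.+1 - \sum_(1 <= k < n.+1) fsqrt q k * fsqrt q (n.+1 - k)%N) / 2.
Proof.
rewrite {1}/fsqrt {1}/srec srec_seqE size_mkseq /=; congr ((_ - _) / _).
rewrite !big_nat; apply: eq_bigr => i /andP[i0 ilt].
by rewrite !nth_mkseq // ltn_subLR ?(ltnW ilt) // -{1}[n.+1]add0n ltn_add2r.
Qed.

Lemma sqr_fsqrt (q : fps R) : q 0%N = 1 -> (fsqrt q : fps R) ^+ 2 = q.
Proof.
move=> q0; rewrite expr2; apply/funext => -[|n].
  by rewrite fpsM0 fsqrt0 mulr1 q0.
rewrite fpsM -(big_mkord xpredT (fun k => fsqrt q k * fsqrt q (n.+1 - k)%N)).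
rewrite big_nat_recl // big_nat_recr //= subn0 subnn fsqrt0 mul1r mulr1.
under eq_bigr => i _ do rewrite subSS.
rewrite fsqrtS (big_add1 _ _ 0 n.+1) /=.
under [X in q n.+1 - X]eq_bigr => i _ do rewrite subSS.
by field.
Qed.

Lemma fsqrt_uniq (r : fps R) : r 0%N = 1 -> (fsqrt (r ^+ 2) : fps R) = r.
Proof.
move=> r0; have q0 : (r ^+ 2) 0%N = 1 by rewrite expr2 fpsM0 r0 mulr1.
have /eqP := sqr_fsqrt q0; rewrite -subr_eq0 subr_sqr => /eqP e.
apply/eqP; rewrite -subr_eq0; apply/eqP.
apply: (@fps_cancel ((fsqrt (r ^+ 2) : fps R) + r)).
  by rewrite fpsD r0 fsqrt0 (_ : 1 + 1 = 2%:R) ?pnatr_eq0.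
by rewrite mulrC e mulr0.
Qed.

(** Any bound m > n will do because [g ^+ k] starts in degree k; different coefficients can thus
    share one bound. *)
Lemma scompE f g n m : g 0%N = 0 -> (n < m)%N ->
  scomp f g n = \sum_(k < m) f k * (g ^+ k) n.
Proof.
move=> g0 nm; rewrite /scomp; under eq_bigr do rewrite spowE.
rewrite -!(big_mkord xpredT (fun k => f k * (g ^+ k) n)).
rewrite [RHS](@big_cat_nat _ _ _ n.+1) //=.
rewrite [X in _ = _ + X](_ : _ = 0) ?addr0 // big_nat big1 // => i /andP[ni _].
by rewrite (fps_exp_ord g0) ?mulr0.
Qed.

Lemma coef_exp_trunc g m k n : (n < m)%N -> (trunc m g ^+ k)`_n = (g ^+ k) n.
Proof.
elim: k n => [|k IH] n nm; first by rewrite !expr0 coef1 fps1.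
rewrite !exprS; apply/esym/smul_coef => i ile.
  by rewrite coef_trunc // (leq_ltn_trans ile).
by rewrite IH // (leq_ltn_trans ile).
Qed.

Lemma scomp_poly f g (p : {poly R}) n m : g 0%N = 0 -> (n < m)%N ->
  (forall k, (k <= n)%N -> p`_k = f k) ->
  scomp f g n = (p \Po trunc m g)`_n.
Proof.
move=> g0 nm hp; rewrite (@scompE _ _ _ (maxn (size p) n.+1)) ?leq_max ?leqnn ?orbT //.
rewrite comp_polyE coef_sum.
rewrite -(big_mkord xpredT (fun k => f k * (g ^+ k) n)).
rewrite -(big_mkord xpredT (fun i => (p`_i *: trunc m g ^+ i)`_n)).
rewrite (@big_cat_nat _ _ _ (size p) _ (maxn _ _)) ?leq_maxl //=.
rewrite [X in _ + X = _](_ : _ = 0) ?addr0; last first.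
  rewrite big_nat big1 // => i /andP[pi _]; have [ni|lin] := ltnP n i.
    by rewrite (fps_exp_ord g0) ?mulr0.
  by rewrite -hp // nth_default ?mul0r.
apply: eq_bigr => i _; rewrite coefZ coef_exp_trunc //.
have [ni|lin] := ltnP n i; last by rewrite hp.
by rewrite (fps_exp_ord g0) ?mulr0.
Qed.

Lemma scompM f1 f2 g : g 0%N = 0 ->
  scomp (f1 * f2) g = (scomp f1 g : fps R) * scomp f2 g.
Proof.
move=> g0; apply/funext => n.
have T f i : (i <= n)%N -> (trunc n.+1 f)`_i = f i by move=> ?; rewrite coef_trunc.
rewrite (@scomp_poly _ _ (trunc n.+1 f1 * trunc n.+1 f2) _ n.+1) //; last first.
  by move=> k kn; rewrite -smul_trunc.
rewrite comp_polyM; apply/esym/smul_coef => k kn; apply/esym/scomp_poly => //.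
- by move=> i ik; apply: T; apply: leq_trans ik kn.
- by move=> i ik; apply: T; apply: leq_trans ik kn.
Qed.

Lemma scompD f1 f2 g : scomp (f1 + f2) g = (scomp f1 g : fps R) + scomp f2 g.
Proof.
apply/funext => n; rewrite fpsD /scomp -big_split /=.
by apply: eq_bigr => i _; rewrite fpsD mulrDl.
Qed.

Lemma scompN f g : scomp (- f) g = - (scomp f g : fps R).
Proof.
apply/funext => n; rewrite fpsN /scomp -sumrN /=.
by apply: eq_bigr => i _; rewrite fpsN mulNr.
Qed.

Lemma scompC (c : R) g : scomp (sconst c) g = sconst c.
Proof.
apply/funext => n; rewrite /scomp big_ord_recl big1 ?addr0.
  by rewrite spowE expr0 fps1 /sconst /=; case: eqP => _; rewrite ?mulr1 ?mulr0.
by move=> i _; rewrite /sconst /= mul0r.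
Qed.

Lemma scomp1 g : scomp (1 : fps R) g = 1 :> fps R.
Proof. exact: scompC. Qed.

Lemma scompX g : g 0%N = 0 -> scomp (sX R) g = g.
Proof.
move=> g0; apply/funext => n; rewrite (@scompE _ _ _ n.+2) //.
rewrite !big_ord_recl big1 ?addr0 /sX /=; last by move=> i _; rewrite mul0r.
by rewrite mul0r add0r mul1r.
Qed.

Lemma scompXn f g k : g 0%N = 0 -> scomp (f ^+ k) g = (scomp f g : fps R) ^+ k.
Proof.
move=> g0; elim: k => [|k IH]; first by rewrite !expr0; apply: scompC.
by rewrite !exprS scompM // IH.
Qed.

Lemma scomp0 f g : g 0%N = 0 -> scomp f g 0%N = f 0%N.
Proof. by move=> g0; rewrite (@scompE _ _ _ 1) // big_ord1 expr0 fps1 mulr1. Qed.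

Lemma scompA f g h : g 0%N = 0 -> h 0%N = 0 ->
  scomp (scomp f g) h = scomp f (scomp g h).
Proof.
move=> g0 h0; apply/funext => n.
rewrite [RHS](@scompE _ _ _ n.+1) //; last by rewrite scomp0.
transitivity (scomp (\sum_(k < n.+1) (sconst (f k) : fps R) * g ^+ k) h n).
  rewrite /scomp; apply: eq_bigr => i _; congr (_ * _).
  rewrite -/(scomp f g i) (@scompE _ _ _ n.+1) // fps_sum.
  by apply: eq_bigr => k _; rewrite sconstM.
have E : {morph (fun a : fps R => scomp a h : fps R) : x y / x + y} by move=> x y; exact: scompD.
have -> : scomp (\sum_(k < n.+1) (sconst (f k) : fps R) * g ^+ k) h =
   \sum_(k < n.+1) (scomp ((sconst (f k) : fps R) * g ^+ k) h : fps R).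
  by apply: (big_morph (fun a : fps R => scomp a h : fps R)) => //; exact: scompC.
rewrite fps_sum; apply: eq_bigr => k _.
by rewrite scompM // scompC sconstM scompXn.
Qed.

Lemma scomp_sinv f g : g 0%N = 0 -> f 0%N != 0 -> scomp (sinv f) g = sinv (scomp f g).
Proof.
move=> g0 f0; apply/esym/sinv_uniq; rewrite -scompM // mul_sinv //; exact: scompC.
Qed.

(** Since [u ^+ k] starts with z^k, composition with [u] is triangular with unit diagonal. *)
Lemma scomp_inj f1 f2 u : P01 u -> scomp f1 u = scomp f2 u -> f1 = f2.
Proof.
case=> u0 u1 e.
have uk k : ((u : fps R) ^+ k) k = 1 :> R.
  elim: k => [|k IH]; first by rewrite expr0 fps1.
  rewrite exprS fpsM !big_ord_recl /= u0 mul0r add0r u1 mul1r subSS subn0 IH.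
  rewrite big1 ?addr0 // => i _; rewrite (fps_exp_ord u0) ?mulr0 //= /bump /=.
  by rewrite !add1n subSS ltn_subrL /= (leq_ltn_trans _ (ltn_ord i)).
apply/funext => n; elim/ltn_ind: n => n IH.
move: (congr1 (fun h => h n) e); rewrite !(@scompE _ _ n n.+1) // !big_ord_recr /=.
rewrite uk !mulr1 => /eqP; rewrite (eq_bigr (fun i : 'I_n => f2 i * ((u : fps R) ^+ i) n)).
  by rewrite (inj_eq (addrI _)) => /eqP.
by move=> i _; rewrite IH.
Qed.

End SeriesRing.

(** * Moment functionals and Sheffer systems *)

Section MomentFunctional.
Variable R : realType.
Implicit Types (m : nat -> R) (p q : {poly R}).

(** The linear functional with moments [m]. Orthogonality is argued for it algebraically;
    [dmom_poly] and [prob_poly] link it to integrals. *)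
Definition momf m p : R := \sum_(i < size p) p`_i * m i.

Lemma momf_wide m p N : (size p <= N)%N -> momf m p = \sum_(i < N) p`_i * m i.
Proof.
move=> pN; rewrite /momf -!(big_mkord xpredT (fun i => p`_i * m i)).
rewrite [RHS](@big_cat_nat _ _ _ (size p)) //=.
rewrite [X in _ = _ + X](_ : _ = 0) ?addr0 // big_nat big1 // => i /andP[pi _].
by rewrite nth_default ?mul0r.
Qed.

Lemma momfD m p q : momf m (p + q) = momf m p + momf m q.
Proof.
set N := maxn (size p) (size q).
rewrite (@momf_wide _ (p + q) N) ?size_polyD // (@momf_wide _ p N) ?leq_maxl //.
rewrite (@momf_wide _ q N) ?leq_maxr // -big_split /=.
by apply: eq_bigr => i _; rewrite coefD mulrDl.
Qed.

Lemma momfZ m c p : momf m (c *: p) = c * momf m p.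
Proof.
rewrite (@momf_wide _ (c *: p) (size p)) ?size_scale_leq // mulr_sumr.
by apply: eq_bigr => i _; rewrite coefZ mulrA.
Qed.

Lemma momf0 m : momf m 0 = 0.
Proof. by rewrite /momf size_poly0 big_ord0. Qed.

Lemma momfN m p : momf m (- p) = - momf m p.
Proof. by rewrite -scaleN1r momfZ mulN1r. Qed.

Lemma momfB m p q : momf m (p - q) = momf m p - momf m q.
Proof. by rewrite momfD momfN. Qed.

Lemma momfCM m c p : momf m (c%:P * p) = c * momf m p.
Proof. by rewrite mul_polyC momfZ. Qed.

Lemma momf_sum m I (r : seq I) (P : pred I) (F : I -> {poly R}) :
  momf m (\sum_(i <- r | P i) F i) = \sum_(i <- r | P i) momf m (F i).
Proof. by apply: (big_morph (momf m)); [exact: momfD|exact: momf0]. Qed.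

Lemma momfXn m n : momf m 'X^n = m n.
Proof.
rewrite /momf size_polyXn big_ord_recr /= coefXn eqxx mul1r big1 ?add0r // => i _.
by rewrite coefXn ltn_eqF ?mul0r.
Qed.

Lemma momf1 m : momf m 1 = m 0%N. Proof. by rewrite -(momfXn m 0) expr0. Qed.
Lemma momfX m : momf m 'X = m 1%N. Proof. by rewrite -(momfXn m 1) expr1. Qed.
Lemma momfC m c : momf m c%:P = c * m 0%N. Proof. by rewrite -[c%:P]mulr1 momfCM momf1. Qed.

Lemma momfE m p : momf m p = \sum_(i < size p) p`_i * m i. Proof. by []. Qed.

(** Monic polynomials of all degrees form a triangular basis, so values on them determine the
    moments. *)
Lemma momf_monic_inj m m' (P : nat -> {poly R}) :
  (forall n, P n \is monic /\ size (P n) = n.+1) -> m 0%N = m' 0%N ->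
  (forall n, momf m (P n.+1) = momf m' (P n.+1)) -> m =1 m'.
Proof.
move=> mP m0 e n; elim/ltn_ind: n => -[//|n] IH.
have [Pmon Psz] := mP n.+1.
have sz : (size ('X^(n.+1) - P n.+1 : {poly R})%R <= n.+1)%N.
  apply/leq_sizeP => j nj; rewrite coefB coefXn.
  move: nj; rewrite leq_eqVlt => /orP[/eqP <-|nj].
    by move/monicP: Pmon; rewrite lead_coefE Psz /= => ->; rewrite eqxx subrr.
  by rewrite gtn_eqF // nth_default ?subrr // Psz.
rewrite -(momfXn m) -(momfXn m') -['X^(n.+1)](subrK (P n.+1)).
rewrite [LHS]momfD [RHS]momfD e; congr (_ + _).
rewrite !(momf_wide _ sz); apply: eq_bigr => i _.
by rewrite IH // ltnS ltnW.
Qed.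

End MomentFunctional.

(** * Polynomials given by a three-term recurrence *)

Section Jacobi.
Variable R : realType.
Implicit Types (al om : nat -> R) (n : nat).

Lemma jac_pairE al om n : jac_pair al om n = (jacP al om n, jacP al om n.+1).
Proof. by rewrite /jacP /=; case: (jac_pair al om n). Qed.

Lemma jacP0 al om : jacP al om 0 = 1. Proof. by []. Qed.
Lemma jacP1 al om : jacP al om 1 = 'X - (al 0%N)%:P. Proof. by []. Qed.
Lemma jacPSS al om n : jacP al om n.+2 =
  ('X - (al n.+1)%:P) * jacP al om n.+1 - (om n.+1)%:P * jacP al om n.
Proof. by rewrite {1}/jacP /= jac_pairE. Qed.

Lemma jacP_ind2 (Q : nat -> Prop) : Q 0%N -> Q 1%N ->
  (forall n, Q n -> Q n.+1 -> Q n.+2) -> forall n, Q n.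
Proof.
move=> q0 q1 qs n; suff : Q n /\ Q n.+1 by case.
by elim: n => // n [a b]; split => //; apply: qs.
Qed.

Lemma jacP_uniq al om (p : nat -> {poly R}) : p 0%N = 1 -> p 1%N = 'X - (al 0%N)%:P ->
  (forall n, p n.+2 = ('X - (al n.+1)%:P) * p n.+1 - (om n.+1)%:P * p n) ->
  forall n, p n = jacP al om n.
Proof.
move=> p0 p1 ps; apply: jacP_ind2; rewrite ?jacP0 ?jacP1 // => n a b.
by rewrite ps jacPSS a b.
Qed.

Lemma jacP_monic al om n : jacP al om n \is monic /\ size (jacP al om n) = n.+1.
Proof.
elim/jacP_ind2: n => [||n [_ s0] [m1 s1]].
- by rewrite jacP0 monic1 size_poly1.
- by rewrite jacP1 monicXsubC size_XsubC.
have sM : size (('X - (al n.+1)%:P) * jacP al om n.+1) = n.+3.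
  by rewrite mulrC size_Mmonic ?monicXsubC ?monic_neq0 // s1 size_XsubC addn2.
have lt : (size (- ((om n.+1)%:P * jacP al om n)) < n.+3)%N.
  rewrite size_polyN mul_polyC (leq_ltn_trans (size_scale_leq _ _)) // s0.
  by rewrite ltnS leqW.
rewrite jacPSS size_polyDl ?sM //; split=> //.
by rewrite monicE lead_coefDl ?sM // -monicE monicMr ?monicXsubC.
Qed.

Lemma jacPX al om n : 'X * jacP al om n.+1 =
  jacP al om n.+2 + al n.+1 *: jacP al om n.+1 + om n.+1 *: jacP al om n.
Proof. by rewrite jacPSS -!mul_polyC; ring. Qed.

(** By the recurrence, x^j P_n is a combination of P_(n-j), ..., P_(n+j), which does not reach P_0
    when j < n. *)
Lemma jacP_orth m al om : (forall n, momf m (jacP al om n.+1) = 0) ->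
  forall n k, n <> k -> momf m (jacP al om n * jacP al om k) = 0.
Proof.
move=> h.
have XP j : forall n, (j < n)%N -> momf m ('X^j * jacP al om n) = 0.
  elim: j => [|j IH] [//|n] jn; first by rewrite expr0 mul1r h.
  rewrite exprSr -mulrA jacPX 2!mulrDr 2!momfD -!scalerAr !momfZ.
  rewrite (IH n.+2) 1?(IH n.+1) 1?(IH n) ?mulr0 ?addr0 //; do ?[exact: ltnW]; exact: leqW (ltnW _).
have lt n k : (k < n)%N -> momf m (jacP al om n * jacP al om k) = 0.
  move=> kn; rewrite mulrC -[jacP al om k]coefK poly_def mulr_suml momf_sum.
  rewrite big1 // => i _; rewrite -scalerAl momfZ XP ?mulr0 //.
  by apply: leq_trans (ltn_ord i) _; rewrite (proj2 (jacP_monic _ _ _)).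
move=> n k /eqP; rewrite neq_ltn => /orP[nk|kn]; last exact: lt.
by rewrite mulrC lt.
Qed.

End Jacobi.

(** * Generating functions and the R-transform *)

Section Generating.
Variable R : realType.
Implicit Types (u v f g : fps R) (m : nat -> R).

Definition geom (x : R) : fps R := fun n => x ^+ n.

Lemma geomE x : (1 - (sconst x : fps R) * sX R) * geom x = 1.
Proof.
apply/funext => n; rewrite mulrBl mul1r fpsB -mulrA sconstM sXM fps1 /geom.
case: n => [|n]; first by rewrite mulr0 subr0 expr0.
by rewrite exprS subrr.
Qed.

(** Geometric expansion in u / A. It isolates x in [geom x], so applying a functional with moments
    [m] amounts to replacing [geom x] by [m]. *)
Lemma inv_pencil (A u : fps R) x : A 0%N != 0 -> u 0%N = 0 ->
  sinv (A - (sconst x : fps R) * u) =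
    (sinv A : fps R) * scomp (geom x) (u * (sinv A : fps R)) :> fps R.
Proof.
move=> A0 u0; set H := u * _.
have H0 : H 0%N = 0 by rewrite /H fpsM0 u0 mul0r.
apply: sinv_uniq; have Ai := mul_sinv A0.
have Hg : (1 - (sconst x : fps R) * H) * (scomp (geom x) H : fps R) = 1.
  transitivity (scomp ((1 - (sconst x : fps R) * sX R) * geom x) H : fps R); last first.
    by rewrite geomE scomp1.
  by rewrite scompM // scompD scompN scompM // scompC scompX // scomp1.
rewrite mulrA -[RHS]Hg; congr (_ * _).
by rewrite mulrBl Ai -mulrA.
Qed.

Lemma poly_fun_inj (p q : {poly R}) : (forall x, p.[x] = q.[x]) -> p = q.
Proof.
move=> e; apply/eqP; rewrite -subr_eq0; apply/eqP.
apply: (@roots_geq_poly_eq0 _ _ [seq i%:R | i <- iota 0 (size (p - q))]).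
- by apply/allP => y _; rewrite /root hornerE e hornerN subrr.
- by rewrite map_inj_uniq ?iota_uniq // => i j /eqP; rewrite eqr_nat => /eqP.
- by rewrite size_map size_iota.
Qed.

Lemma momf_gen m (A u : fps R) (P : nat -> {poly R}) :
  A 0%N != 0 -> u 0%N = 0 ->
  (forall n x, (P n).[x] = sinv (A - (sconst x : fps R) * u) n) ->
  (fun n => momf m (P n)) =
    (sinv A : fps R) * scomp m (u * (sinv A : fps R)) :> fps R.
Proof.
move=> A0 u0 hP; set H := u * _; set iA := (sinv A : fps R).
have H0 : H 0%N = 0 by rewrite /H fpsM0 u0 mul0r.
apply/funext => n.
have PE : P n = \sum_(k < n.+1) iA k *: \sum_(j < n.+1) (H ^+ j) (n - k)%N *: 'X^j.
  apply: poly_fun_inj => x; rewrite hP inv_pencil // fpsM horner_sum.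
  apply: eq_bigr => k _; rewrite hornerZ horner_sum -/H; congr (_ * _).
  rewrite (@scompE _ _ _ _ n.+1) ?ltnS ?leq_subr //.
  by apply: eq_bigr => j _; rewrite hornerZ hornerXn mulrC.
rewrite PE momf_sum fpsM; apply: eq_bigr => k _; rewrite momfZ momf_sum; congr (_ * _).
rewrite (@scompE _ _ _ _ n.+1) ?ltnS ?leq_subr //.
by apply: eq_bigr => j _; rewrite momfZ momfXn mulrC.
Qed.

(** [cauchyf m] is G(1/w) as a series in w, and [hser f] is 1 / K(z) for K(z) = 1/z + f(z); their
    composition is G(K(z)). *)
Definition cauchyf m : fps R := (sX R : fps R) * (m : fps R).
Definition hser (f : fps R) : fps R := (sX R : fps R) * (sinv (1 + (sX R : fps R) * f) : fps R).

Lemma sheffer_denE f t u v x : sheffer_den f t u v x =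
  ((sdivX u : fps R) * (sinv (sdivX v) : fps R) +
    (sconst t : fps R) * (u * (scomp f v : fps R))) - (sconst x : fps R) * u :> fps R.
Proof.
apply/funext => n; rewrite !fpsD fpsN !sconstM /sheffer_den /sadd /sscale addrA.
by rewrite mulNr.
Qed.

(** The functional turns 1 / (u (K(v) - x)) into G(K(v)) / u, where K(z) = 1/z + t f(z). *)
Lemma momf_sheffer m f t u v (P : nat -> {poly R}) : P01 u -> P01 v ->
  (forall n x, (P n).[x] = sinv (sheffer_den f t u v x) n) ->
  u * (fun n => momf m (P n)) =
   scomp (scomp (cauchyf m) (hser (sscale t f))) v :> fps R.
Proof.
case=> u0 u1 [v0 v1] hP.
set A := (sdivX u : fps R) * (sinv (sdivX v) : fps R) +
    (sconst t : fps R) * (u * (scomp f v : fps R)).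
have dv0 : sdivX v 0%N != 0 by rewrite /sdivX v1 oner_eq0.
have A0 : A 0%N != 0.
  rewrite /A fpsD sconstM !fpsM0 u0 mul0r mulr0 addr0 sinv0 /sdivX u1 v1 invr1 mulr1.
  by rewrite oner_eq0.
have den n x : (P n).[x] = sinv (A - (sconst x : fps R) * u) n by rewrite hP sheffer_denE.
rewrite (momf_gen m A0 u0 den) mulrA; set H := u * _.
have H0 : H 0%N = 0 by rewrite /H fpsM0 u0 mul0r.
have Xi (f' : fps R) : ((1 + (sX R : fps R) * f') : fps R) 0%N != 0.
  by rewrite fpsD fps1 fpsM0 /sX /= mul0r addr0 oner_eq0.
have h0 (f' : fps R) : hser f' 0%N = 0 by rewrite /hser fpsM0 /sX /= mul0r.
rewrite scompA // /cauchyf.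
rewrite scompM ?scomp0 //.
rewrite scompX ?scomp0 //.
(* Here [A] is u K(v), so that both sides are 1 / K(v). *)
suff -> : scomp (hser (sscale t f)) v = H by [].
rewrite /hser scompM // scompX // scomp_sinv // scompD scompM // scompX // sscaleE.
rewrite scompM // scompC scomp1.
set B := 1 + _.
have B0 : B 0%N != 0.
  by rewrite /B fpsD fps1 fpsM0 v0 mul0r addr0 oner_eq0.
apply: (fps_cancel A0); rewrite /H [A * (u * _)]mulrCA mul_sinv // mulr1.
have E1 (x a b ib F : fps R) : b * ib = 1 -> x * a * F = a * ib * (x * b * F).
  by move=> e; transitivity (x * a * F * (b * ib)); [rewrite e mulr1|ring].
have -> : A = (sdivX u : fps R) * (sinv (sdivX v) : fps R) * B.
  rewrite /A /B mulrDr mulr1; congr (_ + _).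
  transitivity ((sX R : fps R) * sdivX u * ((sconst t : fps R) * scomp f v)).
    by rewrite sdivXK //; ring.
  by rewrite (E1 _ _ _ _ _ (mul_sinv dv0)) sdivXK.
have E2 (x a b ib B' iB : fps R) : b * ib = 1 -> B' * iB = 1 ->
    a * ib * B' * (x * b * iB) = x * a.
  by move=> e e'; transitivity (x * a * (b * ib) * (B' * iB)); [ring|rewrite e e' !mulr1].
have := E2 (sX R) (sdivX u) (sdivX v) _ _ _ (mul_sinv dv0) (mul_sinv B0).
by rewrite !sdivXK.
Qed.

(** The paired generating function is the constant 1, so [momf_sheffer] reads u = G(K(u)), and
    composition with [u] can be cancelled. *)
Lemma Rtransform_of_sheffer m f t u (P : nat -> {poly R}) : P01 u ->
  (forall n x, (P n).[x] = sinv (sheffer_den f t u u x) n) ->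
  momf m (P 0%N) = 1 -> (forall n, momf m (P n.+1) = 0) ->
  scomp (cauchyf m) (hser (sscale t f)) = sX R.
Proof.
move=> pu hP L0 LS; apply: (scomp_inj pu); case: (pu) => u0 _.
rewrite -(momf_sheffer m pu pu hP) scompX //.
rewrite (_ : (fun n => _) = 1 :> fps R) ?mulr1 //.
by apply/funext => -[|n]; rewrite fps1.
Qed.

(** The paired generating function is again 1, so [momf_sheffer] reads u = G(K(v)), and the right
    side is v. *)
Lemma sheffer_of_Rtransform m f t u v (P : nat -> {poly R}) : P01 u -> P01 v ->
  (forall n x, (P n).[x] = sinv (sheffer_den f t u v x) n) ->
  scomp (cauchyf m) (hser (sscale t f)) = sX R ->
  momf m (P 0%N) = 1 -> (forall n, momf m (P n.+1) = 0) -> u = v.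
Proof.
move=> pu pv hP hR L0 LS; move: (momf_sheffer m pu pv hP).
rewrite hR scompX; last by case: pv.
rewrite (_ : (fun n => _) = 1 :> fps R) ?mulr1 //.
by apply/funext => -[|n]; rewrite fps1.
Qed.

Lemma sheffer_den_diag f t u x : P01 u -> sheffer_den f t u u x =
  sadd (sconst 1) (sadd (sscale t (smul u (scomp f u))) (sscale (- x) u)).
Proof.
case=> u0 u1; rewrite /sheffer_den -[smul (sdivX u) _]/((sdivX u : fps R) * sinv (sdivX u)).
by rewrite mul_sinv // /sdivX u1 oner_eq0.
Qed.

End Generating.

(** * Free Meixner polynomials *)

Section MeixnerPolynomials.
Variable R : realType.
Local Notation X := (sX R : fps R).
Local Notation "c %:S" := (sconst c : fps R) (at level 2, format "c %:S").

(* Every free Meixner system, normalised or not, is of this form. *)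
Definition meixP (m k c d : R) (n : nat) (t : R) : {poly R} :=
  jacP (fun i => if i == 0%N then m * t else m * t + c)
       (fun i => if i == 1%N then k * t else k * t + d) n.

Definition meixN (c d : R) : fps R := 1 + c%:S * X + d%:S * X ^+ 2.

Lemma fps_gen_rec3 (F : fps R) (A B : R) : F 0%N = 1 ->
  (forall n, F n.+3 = A * F n.+2 - B * F n.+1) ->
  F * (1 - A%:S * X + B%:S * X ^+ 2) =
  1 + (F 1%N - A)%:S * X + (F 2%N - A * F 1%N + B)%:S * X ^+ 2.
Proof.
move=> F0 Fr.
have -> : F * (1 - A%:S * X + B%:S * X ^+ 2) =
   F - A%:S * (X * F) + B%:S * (X * (X * F)) by ring.
have -> : 1 + (F 1%N - A)%:S * X + (F 2%N - A * F 1%N + B)%:S * X ^+ 2 =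
  1 + (F 1%N - A)%:S * (X * 1) + (F 2%N - A * F 1%N + B)%:S * (X * (X * 1)) by ring.
apply/funext => n; rewrite !(fpsD, fpsN) !sconstM !sXM.
case: n => [|[|[|n]]]; rewrite ?sXM ?fps1 ?F0 ?Fr /=; ring.
Qed.

(** Only [al 0] and [om 1] deviate from the later recurrence coefficients, which leaves a numerator
    of degree two; their values make it independent of [t] and [x]. *)
Lemma meixP_gen m k c d t x :
  ((fun n => (meixP m k c d n t).[x]) : fps R) *
    (meixN c d + t%:S * (m%:S * X + k%:S * X ^+ 2) - x%:S * X) = meixN c d :> fps R.
Proof.
set F : fps R := fun n => _.
have F0 : F 0%N = 1 by rewrite /F /meixP jacP0 hornerC.
have F1 : F 1%N = x - m * t by rewrite /F /meixP jacP1 hornerXsubC.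
have F2 : F 2%N = (x - (m * t + c)) * (x - m * t) - k * t.
  by rewrite /F /meixP jacPSS jacP1 jacP0 /= !(hornerE, hornerXsubC).
have Fr n : F n.+3 = (x - (m * t + c)) * F n.+2 - (k * t + d) * F n.+1.
  by rewrite /F /meixP jacPSS /= !hornerE /= -/(meixP _ _ _ _ _ _).
have := @fps_gen_rec3 F _ _ F0 Fr.
rewrite F1 F2.
have -> : x - m * t - (x - (m * t + c)) = c by ring.
have -> : (x - (m * t + c)) * (x - m * t) - k * t - (x - (m * t + c)) * (x - m * t) + (k * t + d) = d by ring.
move=> h; rewrite -[RHS]h; congr (_ * _); rewrite /meixN.
rewrite -!sconstD -!sconstE.
have -> : (- (m * t + c))%:S = - (m%:S * t%:S + c%:S).
  by rewrite sconstE sconstD; apply/funext => i; rewrite fpsN /sconst; case: ifP; rewrite ?oppr0.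
ring.
Qed.

Lemma meixN0 c d : meixN c d 0%N = 1.
Proof. by rewrite /meixN !fpsD fps1 !sconstM expr2 !sXM /sX /= !mulr0 !addr0. Qed.

Lemma meixP_den m k c d t x (u B : fps R) : meixN c d * u = X ->
  meixN c d * B = m%:S * X + k%:S * X ^+ 2 ->
  (fun n => (meixP m k c d n t).[x] : R) =
   sinv (1 + t%:S * B - x%:S * u) :> fps R.
Proof.
move=> eu eB; apply/esym/sinv_uniq.
apply: (@fps_cancel _ (meixN c d)); first by rewrite meixN0 oner_eq0.
rewrite mulr1 -[RHS](meixP_gen m k c d t x) -eB -eu.
set F : fps R := (fun n => _); ring.
Qed.

Lemma jacP_affine (al om : nat -> R) (lam c : R) n : lam != 0 ->
  lam ^+ n *: (jacP al om n \Po (lam^-1 *: ('X - c%:P))) =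
  jacP (fun k => lam * al k + c) (fun k => lam ^+ 2 * om k) n.
Proof.
move=> l0; set q := lam^-1 *: _.
have lq : lam%:P * q = 'X - c%:P by rewrite mul_polyC /q scalerA mulfV // scale1r.
elim/jacP_ind2: n => [||n IH0 IH1].
- by rewrite !jacP0 expr0 scale1r comp_polyC.
- rewrite !jacP1 expr1 comp_polyB comp_polyX comp_polyC -mul_polyC mulrBr lq.
  by rewrite -polyCM polyCD opprD addrCA addrC.
- rewrite !jacPSS -IH0 -IH1 !comp_polyD !linearN /= !comp_polyM comp_polyB comp_polyX !comp_polyC.
  set a := jacP _ _ n.+1 \Po _; set b := jacP _ _ n \Po _.
  rewrite -!mul_polyC !polyCD !polyCM !polyC_exp.
  have E (L K Q A C O f g : {poly R}) : L * Q = 'X - C ->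
      L * (L * K) * ((Q - A) * f - O * g) =
      ('X - (L * A + C)) * (L * K * f) - L * L * O * (K * g).
    by move=> h; transitivity (L * K * ((L * Q - L * A) * f) - L * (L * K) * (O * g));
      [ring|rewrite h; ring].
  by rewrite !exprS; apply: E.
Qed.

Lemma coef_chebU2 n (t : R) k : (chebU2 n t)`_k = (chebU R n)`_k * Num.sqrt t ^+ (n - k).
Proof.
rewrite coef_poly; case: ltnP => // nk.
by rewrite nth_default ?mul0r // (proj2 (jacP_monic _ _ _)).
Qed.

Lemma chebU2E n (t : R) : 0 <= t -> chebU2 n t = jacP (fun=> 0) (fun=> t) n.
Proof.
move=> t0; apply: (jacP_uniq (p := fun n => chebU2 n t)) => [||{}n].
- by apply/polyP => k; rewrite coef_chebU2 /chebU jacP0 sub0n expr0 mulr1.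
- rewrite subr0; apply/polyP => k; rewrite coef_chebU2 /chebU jacP1 subr0 coefX.
  by case: k => [|[|k]]; rewrite /= ?mul0r // expr0 mulr1.
- apply/polyP => k; rewrite subr0 coefB coefXM coefCM !coef_chebU2 /chebU jacPSS.
  rewrite -!/(chebU _ _) subr0 coefB coefXM mul1r.
  have E : (chebU R n)`_k * Num.sqrt t ^+ (n.+2 - k) = t * ((chebU R n)`_k * Num.sqrt t ^+ (n - k)).
    have [kn|nk] := leqP k n.
      by rewrite -addn2 addnC -addnBA // exprD sqr_sqrtr //; ring.
    by rewrite nth_default ?mul0r ?mulr0 // (proj2 (jacP_monic _ _ _)).
  case: k E => [|k] E /=; first by rewrite !sub0r mulNr E.
  by rewrite mulrBl E subSS.
Qed.

Lemma chebQE n (al be : R) : 0 <= be -> chebQ n al be = jacP (fun=> al) (fun=> be) n.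
Proof.
move=> b0; rewrite /chebQ chebU2E //.
have := @jacP_affine (fun=> 0) (fun=> be) 1 al n (oner_neq0 _).
rewrite expr1n invr1 !scale1r => ->; congr (jac_pair _ _ _).1.
  by apply/funext => k; rewrite mul1r add0r.
by apply/funext => k; rewrite expr1n mul1r.
Qed.

(** Mirrors the generating function (1 + c z + d z^2) / (1 - (x - m t - c) z + (k t + d) z^2): the
    reciprocal of the denominator generates the [Q i]. *)
Lemma meixP_cheb m k c d (t : R) n : 0 <= k * t + d ->
  let Q i := chebQ i (m * t + c) (k * t + d) in
  meixP m k c d 1 t = Q 1%N + c *: Q 0%N /\
  meixP m k c d n.+2 t = Q n.+2 + c *: Q n.+1 + d *: Q n.
Proof.
move=> b0; rewrite /= !chebQE // /meixP jacP0 !jacP1 /=.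
have E1 : 'X - (m * t)%:P = 'X - (m * t + c)%:P + c *: (1 : {poly R}).
  by rewrite -mul_polyC polyCD; ring.
split=> //; elim/jacP_ind2: n => [||n IH0 IH1].
- by rewrite !jacPSS !jacP1 !jacP0 /= -!mul_polyC !polyCD !polyCM; ring.
- by rewrite !jacPSS !jacP1 !jacP0 /= -!mul_polyC !polyCD !polyCM; ring.
- rewrite [LHS]jacPSS IH0 IH1 [jacP _ _ n.+4]jacPSS [jacP _ _ n.+3 in X in _ = _ + X + _]jacPSS.
  rewrite [in X in _ = _ + X](jacPSS _ _ n) /= -!mul_polyC; ring.
Qed.

(** The triple (m, c, d) of the case in [meixP]; k is 1 throughout. *)
Definition mcase_par (c : mcase R) : R * R * R :=
  match c with
  | MSemicircle => (0, 0, 0)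
  | MPoisson => (1, 1, 0)
  | MFamily a => (a, 2 * a, 1)
  end.

Lemma listedPE (c : mcase R) n t :
  listedP c n t = meixP (mcase_par c).1.1 1 (mcase_par c).1.2 (mcase_par c).2 n t.
Proof.
case: c => [||a] /=; congr (jac_pair _ _ _).1; apply/funext => k; case: ifP => _; ring.
Qed.

Lemma invN_u c d (f : fps R) : f = meixN c d -> meixN c d * smul X (sinv f) = X.
Proof.
move=> ->; rewrite -[smul _ _]/(X * sinv (meixN c d)) mulrCA mul_sinv ?mulr1 //.
by rewrite meixN0 oner_eq0.
Qed.

Lemma P01_invN c d (f : fps R) : f = meixN c d -> P01 (smul X (sinv f)).
Proof.
move=> ->; rewrite -[smul _ _]/(X * sinv (meixN c d)) /P01 !sXM sinv0 meixN0 invr1.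
by [].
Qed.

Lemma sqr_fps_inj (f g : fps R) : f 0%N = 1 -> g 0%N = 1 -> f ^+ 2 = g ^+ 2 -> f = g.
Proof. by move=> f0 g0 e; rewrite -(fsqrt_uniq f0) e fsqrt_uniq. Qed.

Lemma listed_uE (c : mcase R) : P01 (listed_u c) /\
  meixN (mcase_par c).1.2 (mcase_par c).2 * listed_u c = X.
Proof.
case: c => [||a] /=.
- by split=> //; rewrite /meixN -[(0:R)%:S]/(0 : fps R) !mul0r !addr0 mul1r.
- have E : (spoly (1 + 'X) : fps R) = meixN 1 0.
    by rewrite spolyD spolyC spolyX /meixN -[(0:R)%:S]/(0 : fps R) mul0r addr0 mul1r.
  by split; [apply: (P01_invN E)|apply: (invN_u E)].
- have E : (spoly (1 + (2 * a) *: 'X + 'X ^+ 2) : fps R) = meixN (2 * a) 1.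
    rewrite -mul_polyC !spolyD !spolyM !spolyC !spolyX.
    by rewrite /meixN -[(1:R)%:S]/(1 : fps R) mul1r expr2.
  by split; [apply: (P01_invN E)|apply: (invN_u E)].
Qed.

Lemma listed_uR (c : mcase R) :
  meixN (mcase_par c).1.2 (mcase_par c).2 *
    (smul (listed_u c) (scomp (listed_R c) (listed_u c)) : fps R) =
  ((mcase_par c).1.1)%:S * X + (1:R)%:S * X ^+ 2.
Proof.
have [[u0 u1] Nu] := listed_uE c.
rewrite -[smul _ _]/((listed_u c : fps R) * (scomp (listed_R c) (listed_u c) : fps R)).
rewrite -[(1:R)%:S]/(1 : fps R) mul1r.
case: c u0 u1 Nu => [||a]; set u := listed_u _ => u0 u1.
- move=> Nu; rewrite mulrA Nu scompX //= -[(0:R)%:S]/(0 : fps R) mul0r add0r.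
  by rewrite expr2.
- move=> h; have {h}Nu : meixN 1 0 * (u : fps R) = X := h.
  rewrite mulrA Nu -[mcase_par _]/(1, 1, 0) -[(1:R)%:S]/(1 : fps R) mul1r.
  have E : (spoly (1 - 'X) : fps R) = 1 - X by rewrite spolyD spolyN spolyC spolyX.
  rewrite [listed_R _]/(sinv (spoly (1 - 'X))) E scomp_sinv //; last first.
    by rewrite fpsB fps1 /sX /= subr0 oner_eq0.
  rewrite scompD scompN scomp1 scompX // (@sinv_uniq _ _ (meixN 1 0)).
    by rewrite /meixN -[(0:R)%:S]/(0 : fps R) -[(1:R)%:S]/(1 : fps R); ring.
  rewrite mulrBl mul1r [(u : fps R) * _]mulrC Nu /meixN -[(0:R)%:S]/(0 : fps R) -[(1:R)%:S]/(1 : fps R); ring.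
- rewrite -[mcase_par _]/(a, 2 * a, 1); set N := meixN _ _ => Nu.
  set q : fps R := spoly (((2 * a) *: 'X - 1) ^+ 2 - 4 *: 'X ^+ 2).
  have Eq : q = ((2 * a)%:S * X - 1) ^+ 2 - 4%:S * X ^+ 2.
    rewrite /q -!mul_polyC expr2 !spolyD !spolyN !spolyM !spolyD !spolyN !spolyM.
    by rewrite !spolyC spolyX expr2.
  have q0 : q 0%N = 1.
    by rewrite Eq fpsB expr2 fpsM0 fpsB fps1 !sconstM expr2 fpsM0 /sX /=; ring.
  set s : fps R := fsqrt q; have s2 : s ^+ 2 = q by apply: sqr_fsqrt.
  have N0 : N 0%N != 0 by rewrite /N meixN0 oner_eq0.
  (* With u = X / N the radicand becomes ((1 + X^2)^2 - 4 X^2) / N^2 = ((1 - X^2) / N)^2; constant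
     term 1 selects the root. *)
  have su : N * scomp s u = 1 - X ^+ 2.
    apply: (@fps_cancel _ (sinv N : fps R)); first by rewrite sinv0 invr_eq0.
    rewrite mulrA [(sinv N : fps R) * N]mulrC mul_sinv // mul1r.
    apply: sqr_fps_inj.
    - by rewrite scomp0 // /s fsqrt0.
    - by rewrite fpsM0 sinv0 /N meixN0 invr1 fpsB fps1 expr2 fpsM0 /sX /= mulr0 subr0 mulr1.
    rewrite -scompXn // s2 Eq scompD scompN scompXn // scompD scompN !scompM // !scompC.
    rewrite !scompX // -(expr2 (u : fps R)) -[(1:R)%:S]/(1 : fps R).
    have Ni : u = X * sinv N.
      by apply: (@fps_cancel _ N) => //; rewrite Nu mulrCA mul_sinv // mulr1.
    rewrite Ni; transitivity (((2 * a)%:S * (X * sinv N) - N * sinv N) ^+ 2 - 4%:S * (X * sinv N) ^+ 2).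
      by rewrite mul_sinv.
    rewrite (sconst_nat R 4).
    rewrite /N /meixN -[(1:R)%:S]/(1 : fps R); ring.
  have XR : X * listed_R (MFamily a) = (2^-1)%:S * (1 - s).
    rewrite /= sscaleE mulrCA div1r; congr (_ * _).
    by rewrite sdivXK // /sadd /sconst /sopp /= subrr.
  have := congr1 (fun f : fps R => scomp f u : fps R) XR.
  rewrite !scompM // scompX // scompC scompD scompN scomp1 => ->.
  rewrite mulrCA mulrBr mulr1 su /N /meixN -[(1:R)%:S]/(1 : fps R).
  have -> : (2 * a)%:S = 2 * a%:S.
    by rewrite -sconstE (sconst_nat R 2).
  have h2 : (2^-1)%:S * 2 = 1.
    by rewrite -(sconst_nat R 2) sconstE mulVf ?pnatr_eq0.
  transitivity ((2^-1)%:S * 2 * (a%:S * X + X ^+ 2)); first by ring.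
  by rewrite h2 mul1r.
Qed.

Lemma listed_genser (c : mcase R) t x :
  genser (listedP c) t x = sinv (sadd (sconst 1)
     (sadd (sscale t (smul (listed_u c) (scomp (listed_R c) (listed_u c))))
           (sscale (- x) (listed_u c)))) :> fps R.
Proof.
have [_ Nu] := listed_uE c.
rewrite /genser; under [LHS]funext => n do rewrite listedPE.
rewrite (meixP_den _ _ Nu (listed_uR c)); congr (sinv _).
apply/funext => n; rewrite !fpsD fpsN !sconstM /sadd /sscale addrA.
by rewrite mulNr.
Qed.

Lemma listed_cheb_relation (c : mcase R) t : 0 <= t -> cheb_relation c t.
Proof.
move=> t0; case: c => [||a] /=.
- by move=> n; rewrite chebU2E.
- move=> [//|[|n]] _; have := @meixP_cheb 1 1 1 0 t; rewrite !mul1r !addr0 => h.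
    by have [+ _] := h 0%N t0; rewrite -mul_polyC mul1r => <-; rewrite -(listedPE MPoisson).
  have [_] := h n t0; rewrite scale0r addr0 scale1r => /= <-.
  by rewrite -(listedPE MPoisson).
- have h n := @meixP_cheb a 1 (2 * a) 1 t n.
  have E : a * t + 2 * a = a * (t + 2) by ring.
  rewrite mul1r E in h; have t1 : 0 <= t + 1 by rewrite addr_ge0.
  split.
    by have [<- _] := h 0%N t1; exact: (listedPE (MFamily a) 1 t).
  move=> [|[|n]] // _; have [_] := h n t1; rewrite scale1r => <-.
  exact: (listedPE (MFamily a) n.+2 t).
Qed.

End MeixnerPolynomials.

(** * Semicircular densities and their quotients *)

Section Densities.
Variable R : realType.
Notation mu := (@lebesgue_measure R).
Implicit Types (f g : R -> R) (p q D : {poly R}).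

Lemma measurable_inv : measurable_fun [set: R] (fun x : R => x^-1).
Proof.
have -> : [set: R] = [set 0] `|` ~` [set 0] by rewrite setUv.
apply/measurable_funU => //; first exact: measurableC.
split; first exact: measurable_fun_set1.
apply: open_continuous_measurable_fun.
  by rewrite openC; exact: closed_eq.
move=> x /set_mem /= x0; apply: inv_continuous; exact/eqP.
Qed.

Lemma measurable_horner p : measurable_fun [set: R] (horner p).
Proof. by apply: continuous_measurable_fun; exact: continuous_horner. Qed.

Lemma horner_bounded p (C : R) : exists M, 0 <= M /\ forall x, `|x| <= C -> `|p.[x]| <= M.
Proof.
exists (\sum_(i < size p) `|p`_i| * `|C| ^+ i); split.
  by apply: sumr_ge0 => i _; rewrite mulr_ge0 // exprn_ge0.
move=> x xC; rewrite horner_coef (le_trans (ler_norm_sum _ _ _)) //.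
apply: ler_sum => i _; rewrite normrM normrX ler_wpM2l // lerXn2r ?nnegrE //.
by rewrite (le_trans xC) // ler_norm.
Qed.

Lemma integrable_restr (D : set R) (f : R -> \bar R) :
  measurable D -> mu.-integrable D f -> mu.-integrable setT (f \_ D).
Proof.
move=> mD h; have h' := proj1 (@integrable_mkcond _ _ R mu D f mD) h; exact: h'.
Qed.

(** Bounded support makes this class stable under multiplication by polynomials, so all moments
    exist. *)
Record density f := Density {
  density_int : mu.-integrable setT (EFin \o f);
  density_bnd : exists C, forall x, C < `|x| -> f x = 0 }.

Definition dmom f n : R := (\int[mu]_x (x ^+ n * f x))%R.

Lemma density_measurable f : density f -> measurable_fun setT f.
Proof. by case=> /measurable_int /measurable_EFinP. Qed.

Lemma density_poly f p : density f -> density (fun x => p.[x] * f x).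
Proof.
move=> df; have [fi [C fC]] := df; have [M [M0 pM]] := horner_bounded p C.
split; last by exists C => x /fC ->; rewrite mulr0.
apply: (@le_integrable _ _ _ mu setT measurableT _ (fun x => (M * f x)%:E)).
- apply/measurable_EFinP/measurable_funM; [exact: measurable_horner|exact: density_measurable].
- move=> x _; rewrite /= lee_fin !normrM [`|M|]ger0_norm //.
  have [xC|Cx] := leP `|x| C; first by rewrite ler_wpM2r // pM.
  by rewrite fC // normr0 !mulr0.
- by under eq_fun do rewrite EFinM; apply: integrableZl.
Qed.

Lemma density_scale f (c : R) : density f -> density (fun x => c * f x).
Proof. by move=> /(density_poly c%:P); under eq_fun do rewrite hornerC. Qed.

Lemma density_add f g : density f -> density g -> density (fun x => f x + g x).
Proof.
move=> [fi [C fC]] [gi [C' gC]]; split.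
  exact: (integrableD measurableT fi gi).
exists (Num.max C C') => x; rewrite gt_max => /andP[xC xC'].
by rewrite fC // gC // addr0.
Qed.

Lemma RintegralDd f g : density f -> density g ->
  (\int[mu]_x (f x + g x))%R = (\int[mu]_x f x)%R + (\int[mu]_x g x)%R.
Proof. by move=> [fi _] [gi _]; rewrite RintegralD. Qed.

Lemma dmom_poly f p : density f -> (\int[mu]_x (p.[x] * f x))%R = momf (dmom f) p.
Proof.
move=> df; rewrite -[in LHS](coefK p) poly_def momfE.
elim: (size p) => [|n IH].
  rewrite !big_ord0; under eq_Rintegral do rewrite horner0 mul0r.
  by rewrite Rintegral_cst // mul0r.
rewrite !big_ord_recr /=.
under eq_Rintegral do rewrite hornerD mulrDl.
rewrite RintegralDd ?IH; [|exact: density_poly|exact: density_poly].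
congr (_ + _); under eq_Rintegral do rewrite hornerZ hornerXn -mulrA.
rewrite RintegralZl //; have [] // := density_poly 'X^n df.
by under eq_fun do rewrite hornerXn.
Qed.

Lemma dmom_scale f (c : R) n : density f -> dmom (fun x => c * f x) n = c * dmom f n.
Proof.
move=> df; rewrite /dmom; under eq_Rintegral do rewrite mulrCA.
rewrite RintegralZl //; have [] // := density_poly 'X^n df.
by under eq_fun do rewrite hornerXn.
Qed.

Lemma dmom_add f g n : density f -> density g ->
  dmom (fun x => f x + g x) n = dmom f n + dmom g n.
Proof.
move=> df dg; rewrite /dmom; under eq_Rintegral do rewrite mulrDr.
rewrite RintegralDd //.
  by have := density_poly 'X^n df; under eq_fun do rewrite hornerXn.
by have := density_poly 'X^n dg; under eq_fun do rewrite hornerXn.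
Qed.

Lemma momf_mul_density f g D q (K : R) : density f -> density g ->
  (forall x, f x * D.[x] = K * g x) -> momf (dmom f) (D * q) = K * momf (dmom g) q.
Proof.
move=> df dg e; rewrite -!dmom_poly //.
under eq_Rintegral do rewrite hornerM mulrAC [D.[_] * _]mulrC e -mulrA.
rewrite RintegralZl //; first by congr (_ * _); apply: eq_Rintegral => x _; rewrite mulrC.
by have [] // := density_poly q dg; under eq_fun do rewrite mulrC.
Qed.

Lemma Rintegral_le_itv f (l b M : R) : density f -> l <= b ->
  (forall x, `|f x| <= M) -> (forall x, ~~ (l <= x <= b) -> f x = 0) ->
  `|(\int[mu]_x f x)%R| <= M * (b - l).
Proof.
move=> df lb fM f0; have [fi _] := df.
apply: (le_trans (le_normr_Rintegral measurableT fi)).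
have -> : (\int[mu]_x `|f x|)%R = (\int[mu]_(x in `[l, b]) `|f x|)%R.
  rewrite [RHS]Rintegral_mkcond; apply: eq_Rintegral => x _; rewrite patchE.
  case: ifPn => // h; rewrite f0 ?normr0 //; apply: contra h => h.
  by rewrite inE /= in_itv.
have mu_lb : mu `[l, b] = (b - l)%:E.
  rewrite lebesgue_measure_itv /= lte_fin; move: lb; rewrite le_eqVlt => /predU1P[<-|->].
    by rewrite ltxx subrr.
  by rewrite EFinD.
have -> : M * (b - l) = (\int[mu]_(x in `[l, b]) M)%R.
  by rewrite Rintegral_cst // (_ : fine _ = b - l) //; exact: (congr1 fine mu_lb).
apply: le_Rintegral => //.
- by apply: integrable_norm => //; apply: (integrableS measurableT).
- apply: continuous_compact_integrable; first exact: segment_compact.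
  by apply: continuous_subspaceT => x; exact: cvg_cst.
Qed.

Lemma geo_le0 (x C q : R) : 0 <= q < 1 -> (forall k, x <= C * q ^+ k) -> x <= 0.
Proof.
move=> /andP[q0 q1] h.
have cv : (fun k => C * q ^+ k) @ \oo --> (C * 0 : R).
  by apply: cvgM; [exact: cvg_cst|apply: cvg_expr; rewrite ger0_norm].
rewrite mulr0 in cv; apply: (cvgr_to_ge cv); exact: nearW.
Qed.

End Densities.

(** * The semicircle law and its Chebyshev polynomials *)

Section Semicircle.
Variable R : realType.
Variables al be : R.
Hypothesis be0 : 0 < be.
Notation mu := (@lebesgue_measure R).
Local Notation s := (Num.sqrt be).
Local Notation l := (al - 2 * s).
Local Notation b := (al + 2 * s).
Local Notation S := (semicirc_dens al be).
Local Notation Q := (jacP (fun=> al) (fun=> be)).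

Let s0 : 0 < s. Proof. by rewrite sqrtr_gt0. Qed.
Let s2 : s ^+ 2 = be. Proof. by rewrite sqr_sqrtr // ltW. Qed.
Let lb : l < b. Proof. by rewrite ltrD2l; move: s0; lra. Qed.

Definition discr : {poly R} := locked ((4 * be)%:P - ('X - al%:P) ^+ 2).

Lemma discrE x : discr.[x] = 4 * be - (x - al) ^+ 2.
Proof. by rewrite /discr -lock !hornerE. Qed.

Lemma discr_factor x : discr.[x] = (x - l) * (b - x).
Proof.
rewrite discrE; transitivity (4 * s ^+ 2 - (x - al) ^+ 2); first by rewrite s2.
by move: s => r; ring.
Qed.

Lemma discr_ge0 x : (0 <= discr.[x]) = (l <= x <= b).
Proof.
rewrite discr_factor; apply/idP/andP => [h|[h1 h2]]; last first.
  by rewrite mulr_ge0 ?subr_ge0.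
split; rewrite leNgt; apply/negP => h'; move: h; rewrite leNgt => /negP; apply.
  by rewrite nmulr_rlt0 ?subr_lt0 // subr_gt0 (lt_trans h').
by rewrite pmulr_rlt0 ?subr_lt0 // subr_gt0 (lt_trans _ h').
Qed.

Lemma discr_gt0 x : l < x -> x < b -> 0 < discr.[x].
Proof. by move=> h1 h2; rewrite discr_factor mulr_gt0 ?subr_gt0. Qed.

Lemma semicircE x : S x = (2 * pi * be)^-1 * Num.sqrt discr.[x].
Proof.
rewrite /semicirc_dens discrE; case: ifPn => // h; rewrite ler0_sqrtr ?mulr0 //.
rewrite leNgt; apply: contra h => /ltW; rewrite -discrE discr_ge0.
by move=> /andP[h1 h2]; rewrite ler_norml; apply/andP; split; lra.
Qed.

Lemma semicirc_ge0 x : 0 <= S x.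
Proof.
by rewrite semicircE mulr_ge0 ?sqrtr_ge0 // invr_ge0 !mulr_ge0 ?pi_ge0 // ltW.
Qed.

Lemma semicirc_out x : ~~ (l <= x <= b) -> S x = 0.
Proof.
by rewrite -discr_ge0 -ltNge semicircE => h; rewrite ler0_sqrtr ?mulr0 // ltW.
Qed.

Lemma continuous_sqrt_discr : continuous (fun x => Num.sqrt discr.[x]).
Proof.
move=> x; apply: (@continuous_comp _ _ _ (horner discr) Num.sqrt).
  exact: continuous_horner.
exact: sqrt_continuous.
Qed.

Lemma continuous_semicirc : continuous (S : R -> R).
Proof.
rewrite (_ : S = fun x => (2 * pi * be)^-1 * Num.sqrt discr.[x]).
  by move=> x; apply: cvgM; [exact: cvg_cst|exact: continuous_sqrt_discr].
by apply/funext => x; exact: semicircE.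
Qed.

Lemma measurable_semicirc : measurable_fun [set: R] S.
Proof. by apply: continuous_measurable_fun; exact: continuous_semicirc. Qed.

Lemma density_itv (f : R -> R) : {within `[l, b], continuous f} ->
  (forall x, ~~ (l <= x <= b) -> f x = 0) -> density f.
Proof.
move=> cf f0; split.
  have fE : f \_ `[l, b] = f.
    apply/funext => x; rewrite patchE; case: ifPn => // h; rewrite f0 //.
    by apply: contra h => h; rewrite inE /= in_itv.
  have : mu.-integrable `[l, b] (EFin \o f).
    by apply: continuous_compact_integrable => //; exact: segment_compact.
  move/(integrable_restr (measurable_itv _)).
  by rewrite restrict_EFin fE.
exists (`|al| + 2 * s) => x xC; apply: f0; apply/negP => /andP[h1 h2].
move: xC; rewrite ltNge => /negP; apply.
rewrite -[x](subrK al) addrC (le_trans (ler_normD _ _)) // lerD2l ler_norml.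
by apply/andP; split; lra.
Qed.

Lemma density_semicirc : density S.
Proof.
apply: density_itv; last exact: semicirc_out.
by apply: continuous_subspaceT; exact: continuous_semicirc.
Qed.

Lemma Rintegral_semicirc_poly p (F : R -> R) :
  derivable_oo_LRcontinuous F l b ->
  {in `]l, b[%R, F^`() =1 (fun x => p.[x] * Num.sqrt discr.[x])} ->
  momf (dmom S) p = (2 * pi * be)^-1 * (F b - F l).
Proof.
move=> dF eF; rewrite -dmom_poly; last exact: density_semicirc.
have c : {within `[l, b], continuous (fun x => p.[x] * Num.sqrt discr.[x])}.
  apply: continuous_subspaceT => x; apply: cvgM; first exact: continuous_horner.
  exact: continuous_sqrt_discr.
have e := continuous_FTC2 lb c dF eF.
transitivity (\int[mu]_x ((2 * pi * be)^-1 * ((fun x => p.[x] * Num.sqrt discr.[x]) \_ `[l, b]) x))%R.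
  apply: eq_Rintegral => x _; rewrite semicircE patchE mulrCA; congr (_ * _).
  case: ifPn => // h; rewrite ler0_sqrtr ?mulr0 // leNgt; apply: contra h => /ltW.
  by rewrite discr_ge0 => h; rewrite inE /= in_itv.
rewrite RintegralZl //.
  by rewrite -Rintegral_mkcond /Rintegral e -EFinB.
rewrite -restrict_EFin; apply: (integrable_restr (measurable_itv _)).
by apply: continuous_compact_integrable => //; exact: segment_compact.
Qed.

Let w : {poly R} := 'X - al%:P.
Let WE : discr = 4%:P * be%:P - w ^+ 2. Proof. by rewrite /discr -lock -polyCM. Qed.

(** Ladder relations of the Chebyshev polynomials. They are proved jointly, as the inductive step
    for the first uses both. *)
Lemma cheb_deriv n :
  discr * (Q n.+1)^`() = (2 * be * n.+2%:R)%:P * Q n - n.+1%:R%:P * (w * Q n.+1) /\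
  discr * (Q n)^`() = n.+2%:R%:P * (w * Q n) - (2 * n.+1%:R)%:P * Q n.+1.
Proof.
elim: n => [|n [IH1 IH2]].
  rewrite !jacP1 jacP0 derivB derivX derivC subr0 mulr1 -[1]/(1%:P) derivC mulr0.
  by split; rewrite ?WE -/w !polyCM; ring.
have Qr : Q n.+2 = w * Q n.+1 - be%:P * Q n by rewrite jacPSS.
split; last first.
  rewrite IH1 Qr !polyCM -![n.+3%:R]natr1 -![n.+2%:R]natr1 !polyCD; ring.
rewrite Qr derivB !derivM derivB derivX !derivC subr0 mul1r mul0r add0r.
rewrite mulrBr mulrDr [discr * (w * _)]mulrCA IH1 [discr * (be%:P * _)]mulrCA IH2 WE.
rewrite !polyCM -![n.+3%:R]natr1 -![n.+2%:R]natr1 !polyCD; ring.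
Qed.

(** The Chebyshev differential equation in Sturm-Liouville form: as sqrt(discr)' = - w /
    sqrt(discr), it says that sqrt(discr) G is, up to a constant, a primitive of [Q n.+1]
    sqrt(discr). *)
Lemma cheb_primitive n (G := discr * (Q n.+1)^`()) :
  discr * deriv G - w * G = - (n.+1%:R * n.+3%:R)%:P * (discr * Q n.+1).
Proof.
have [h1 h2] := cheb_deriv n.
have -> : deriv G = (2 * be * n.+2%:R)%:P * (Q n)^`() - n.+1%:R%:P * (Q n.+1 + w * (Q n.+1)^`()).
  rewrite /G h1 derivB !derivM !derivC !mul0r !add0r derivB derivX derivC subr0 mul1r.
  ring.
transitivity ((2 * be * n.+2%:R)%:P * (discr * (Q n)^`())
  - n.+1%:R%:P * (discr * Q n.+1 + w * G) - w * G); first by rewrite /G; ring.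
rewrite /G h1 h2 WE !polyCM -![n.+3%:R]natr1 -![n.+2%:R]natr1 !polyCD; ring.
Qed.

(** The primitive provided by [cheb_primitive] carries the factor sqrt(discr), which vanishes at
    both end points. *)
Lemma semicirc_orth n : momf (dmom S) (Q n.+1) = 0.
Proof.
pose G := discr * (Q n.+1)^`().
pose c := - (n.+1%:R * n.+3%:R)^-1 : R.
have nz : n.+1%:R * n.+3%:R != 0 :> R by rewrite mulf_neq0 ?pnatr_eq0.
pose F := fun x : R => c * (Num.sqrt discr.[x] * G.[x]).
have dsq x : x \in `]l, b[%R -> 0 < discr.[x].
  rewrite in_itv /= => /andP[h1 h2].
  exact: discr_gt0.
have dF x : x \in `]l, b[%R ->
    is_derive x 1 F (c * ((2 * Num.sqrt discr.[x])^-1 * discr^`().[x] * G.[x] +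
      Num.sqrt discr.[x] * (deriv G).[x])).
  move=> xlb; have dx := dsq _ xlb.
  have D1 : is_derive x 1 (Num.sqrt \o horner discr) ((2 * Num.sqrt discr.[x])^-1 * discr^`().[x]).
    by apply: is_derive1_comp; exact: is_derive1_sqrt.
  have D2 : is_derive x 1 (horner G) (deriv G).[x] by exact: is_derive_poly.
  have D3 := is_deriveM D1 D2.
  have D4 : is_derive x 1 (c \*: ((Num.sqrt \o horner discr) * horner G)) _ := is_deriveZ c D3.
  have FE : F = c \*: ((Num.sqrt \o horner discr) * horner G) by [].
  rewrite FE; apply: (trigger_derive D4).
  by rewrite /GRing.scale /=; ring.
have cF : continuous F.
  move=> x; apply: cvgM; first exact: cvg_cst.
  by apply: cvgM; [exact: continuous_sqrt_discr|exact: continuous_horner].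
rewrite (@Rintegral_semicirc_poly _ F).
- have z x : discr.[x] = 0 -> F x = 0 by move=> h; rewrite /F h sqrtr0 mul0r mulr0.
  by rewrite !z ?subrr ?mulr0 // discr_factor subrr ?mulr0 ?mul0r.
- split.
  + by move=> x /dF [].
  + by apply: cvg_at_right_filter; exact: cF.
  + by apply: cvg_at_left_filter; exact: cF.
- move=> x xlb; have [_ e] := dF x xlb; have dx := dsq _ xlb.
  rewrite derive1E e.
  have E := congr1 (horner^~ x) (cheb_primitive n).
  rewrite /= !hornerE /= -/G in E.
  have dd : discr^`().[x] = - 2 * (x - al).
    by rewrite WE expr2 derivB -polyCM derivC derivM derivB derivX derivC !hornerE /=; ring.
  have q0 : 0 < Num.sqrt discr.[x] by rewrite sqrtr_gt0.
  have q2 : Num.sqrt discr.[x] ^+ 2 = discr.[x] by rewrite sqr_sqrtr // ltW.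
  rewrite dd; set a := Num.sqrt _ in q0 q2 *; rewrite -q2 in E.
  have a0 : a != 0 by rewrite gt_eqF.
  transitivity (c / a * (a ^+ 2 * (deriv G).[x] - (x - al) * G.[x])); first by field.
  have -> : (x - al) * G.[x] = (x - al) * a ^+ 2 * (deriv (Q n.+1)).[x].
    by rewrite /G hornerM -q2 mulrA.
  rewrite E /c; move: nz; rewrite mulf_eq0 negb_or.
  by move: (n.+1%:R : R) (n.+3%:R : R) => k1 k3 /andP[k10 k30]; field; rewrite a0 k10 k30.
Qed.

(** Continuity up to the end points: the function inverts x |-> al + 2 s sin x, continuous on the
    closed interval [-pi/2, pi/2]. *)
Lemma asin_cvg : {within `[l, b], continuous (fun x => asin ((x - al) / (2 * s)))}.
Proof.
have p2 : 0 <= pi / 2 :> R by rewrite divr_ge0 ?pi_ge0.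
have cf : {within `[- (pi / 2), pi / 2], continuous (fun x : R => al + 2 * s * sin x)}.
  apply: continuous_subspaceT => x; apply: cvgD; first exact: cvg_cst.
  by apply: cvgM; [exact: cvg_cst|exact: continuous_sin].
have := segment_can_le_continuous (g := fun x => asin ((x - al) / (2 * s))) _ cf.
rewrite sin_pihalf sinN sin_pihalf !mulrN1 mulr1; apply.
  by rewrite (le_trans _ p2) // oppr_le0.
move=> x xI /=; rewrite [al + _]addrC addrK [2 * s * _]mulrC mulfK ?sinK //.
by rewrite mulf_neq0 ?pnatr_eq0 // gt_eqF.
Qed.

Lemma semicirc_mass : dmom S 0 = 1.
Proof.
(* The classical primitive of sqrt(r^2 - y^2), with y = x - al and r = 2 s. *)
pose F := fun x : R => ((x - al) * Num.sqrt discr.[x] + 4 * be * asin ((x - al) / (2 * s))) / 2.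
have [_ al_ ab_] := (continuous_within_itvP _ lb).1 asin_cvg.
have sn0 : 2 * s != 0 by rewrite mulf_neq0 ?pnatr_eq0 // gt_eqF.
have dF x : x \in `]l, b[%R -> is_derive x 1 F (Num.sqrt discr.[x]).
  rewrite in_itv /= => /andP[h1 h2]; have dx := discr_gt0 h1 h2.
  have D1 : is_derive x 1 (Num.sqrt \o horner discr) ((2 * Num.sqrt discr.[x])^-1 * discr^`().[x]).
    by apply: is_derive1_comp; exact: is_derive1_sqrt.
  have D2 : is_derive x 1 (horner ('X - al%:P)) ('X - al%:P)^`().[x] by exact: is_derive_poly.
  have D3 := is_deriveM D2 D1.
  pose p : {poly R} := (2 * s)^-1%:P * ('X - al%:P).
  have pE y : p.[y] = (y - al) / (2 * s) by rewrite /p !hornerE mulrC.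
  have D4 : is_derive x 1 (horner p) p^`().[x] by exact: is_derive_poly.
  have px : -1 < p.[x] < 1.
    rewrite pE ltr_pdivlMr ?ltr_pdivrMr ?mulr_gt0 //; apply/andP; split; lra.
  have D5 : is_derive x 1 (asin \o horner p) ((Num.sqrt (1 - p.[x] ^+ 2))^-1 * p^`().[x]).
    by apply: is_derive1_comp; exact: is_derive1_asin.
  have D6 := is_deriveZ 2^-1 (is_deriveD D3 (is_deriveZ (4 * be) D5)).
  have FE : F = 2^-1 \*: (horner ('X - al%:P) * (Num.sqrt \o horner discr) + (4 * be) \*: (asin \o horner p)).
    apply/funext => y; rewrite /F /= !fctE /= pE /GRing.scale /= !hornerE; ring.
  rewrite FE; apply: (trigger_derive D6).
  have q0 : 0 < Num.sqrt discr.[x] by rewrite sqrtr_gt0.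
  have q2 : Num.sqrt discr.[x] ^+ 2 = discr.[x] by rewrite sqr_sqrtr // ltW.
  have E : Num.sqrt (1 - p.[x] ^+ 2) = Num.sqrt discr.[x] / (2 * s).
    rewrite -[RHS]ger0_norm ?divr_ge0 ?mulr_ge0 ?sqrtr_ge0 // -sqrtr_sqr; congr Num.sqrt.
    rewrite expr_div_n q2 pE discr_factor; move: sn0; move: s => r r0; field.
    by rewrite mulf_eq0 negb_or in r0; case/andP: r0.
  have dd : discr^`().[x] = - 2 * (x - al).
    by rewrite WE expr2 derivB -polyCM derivC derivM derivB derivX derivC !hornerE /=; ring.
  have dp : p^`().[x] = (2 * s)^-1.
    by rewrite /p derivM derivC derivB derivX derivC !hornerE /=; ring.
  have d1 : ('X - al%:P)^`().[x] = 1 by rewrite derivB derivX derivC subr0 hornerE.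
  rewrite E dd dp d1 hornerXsubC /GRing.scale /=.
  set a := Num.sqrt _ in q0 q2 *; have a0 : a != 0 by rewrite gt_eqF.
  have sn : s != 0 by rewrite gt_eqF.
  transitivity ((a + (4 * be - (x - al) ^+ 2) / a) / 2).
    by move: sn; move: s => r r0; field; rewrite a0.
  by rewrite -discrE -q2; field.
have cs : continuous (fun x => (x - al) * Num.sqrt discr.[x]).
  move=> x; apply: cvgM; last exact: continuous_sqrt_discr.
  by apply: cvgB; [exact: cvg_id|exact: cvg_cst].
rewrite -momf1 (@Rintegral_semicirc_poly _ F).
- have z x : discr.[x] = 0 -> F x = 2 * be * asin ((x - al) / (2 * s)).
    by move=> h; rewrite /F h sqrtr0; field.
  rewrite !z ?discr_factor ?subrr ?mulr0 ?mul0r //.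
  rewrite [al + _ - al]addrC addKr [al - _ - al]addrC addKr mulNr divff //.
  have -> : asin (- 1 : R) = - (pi / 2).
    by rewrite -(@sinK R (- (pi / 2))) ?sinN ?sin_pihalf //
      in_itv /= lexx /= (le_trans _ (_ : 0 <= _)) ?oppr_le0 ?divr_ge0 ?pi_ge0.
  have -> : asin (1 : R) = pi / 2.
    by rewrite -(@sinK R (pi / 2)) ?sin_pihalf //
      in_itv /= lexx andbT (le_trans (_ : _ <= 0)) ?oppr_le0 ?divr_ge0 ?pi_ge0.
  by have := gt_eqF (pi_gt0 R); move: (@pi R) => p p0; field; rewrite (gt_eqF be0) p0.
- split.
  + by move=> x /dF [].
  + apply: cvgM; last exact: cvg_cst.
    apply: cvgD; first by apply: cvg_at_right_filter; exact: cs.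
    by apply: cvgM; [exact: cvg_cst|exact: al_].
  + apply: cvgM; last exact: cvg_cst.
    apply: cvgD; first by apply: cvg_at_left_filter; exact: cs.
    by apply: cvgM; [exact: cvg_cst|exact: ab_].
- by move=> x xlb; have [_ e] := dF x xlb; rewrite derive1E e hornerE mul1r.
Qed.

(** This quadratic form in two consecutive values is multiplied by [be] at each step of the
    recurrence. *)
Lemma cheb_invariant n :
  be%:P * Q n ^+ 2 - w * Q n * Q n.+1 + Q n.+1 ^+ 2 = be%:P ^+ n.+1.
Proof.
elim: n => [|n IH]; first by rewrite jacP1 jacP0 -/w; ring.
by rewrite [RHS]exprS -IH jacPSS -/w; ring.
Qed.

(** Algebraic form of |sin((n+1) theta)| <= 1: completing the square in [cheb_invariant] gives discr
    Q_n^2 <= 4 be^(n+1). *)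
Lemma cheb_bound n x : `|(Q n).[x] * S x| <= (pi * be)^-1 * s * s ^+ n.
Proof.
have [h|h] := boolP (l <= x <= b); last first.
  rewrite semicirc_out // mulr0 normr0 !mulr_ge0 ?exprn_ge0 ?invr_ge0 ?mulr_ge0 ?pi_ge0 //; exact: ltW.
rewrite semicircE; rewrite -discr_ge0 in h.
have K0 : 0 <= (2 * pi * be)^-1 by rewrite invr_ge0 !mulr_ge0 ?pi_ge0 // ltW.
have : `|(Q n).[x] * Num.sqrt discr.[x]| <= 2 * s ^+ n.+1.
  rewrite -(@ler_pXn2r _ 2) ?nnegrE ?mulr_ge0 ?exprn_ge0 // -normrX ger0_norm ?sqr_ge0 //.
  rewrite exprMn sqr_sqrtr // [(2 * _) ^+ 2]exprMn -exprM mulnC exprM s2.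
  set q := (Q n).[x]; pose q' := (Q n.+1).[x].
  have <- : be * q ^+ 2 - (x - al) * q * q' + q' ^+ 2 = be ^+ n.+1.
    by have := congr1 (horner^~ x) (cheb_invariant n); rewrite /= !(hornerE, horner_exp).
  rewrite discrE -subr_ge0.
  rewrite [X in 0 <= X](_ : _ = (2 * q' - (x - al) * q) ^+ 2) ?sqr_ge0 //; ring.
move=> /(ler_wpM2l K0); rewrite -{1}(ger0_norm K0) -normrM.
rewrite [(2 * pi * be)^-1 * (_ * _)]mulrCA => /le_trans; apply.
rewrite exprS le_eqVlt; apply/orP; left; apply/eqP.
by have := gt_eqF (pi_gt0 R); move: (@pi R) s => p r p0; field; rewrite (gt_eqF be0) p0.
Qed.

End Semicircle.

(** * Quotients of the semicircular density and its Cauchy transform left of the support *)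

Section CauchyTransform.
Variable R : realType.
Variables al be : R.
Hypothesis be0 : 0 < be.
Notation mu := (@lebesgue_measure R).
Local Notation s := (Num.sqrt be).
Local Notation l := (al - 2 * s).
Local Notation b := (al + 2 * s).
Local Notation S := (semicirc_dens al be).
Local Notation Q := (jacP (fun=> al) (fun=> be)).

Let s0 : 0 < s. Proof. by rewrite sqrtr_gt0. Qed.
Let s2 : s ^+ 2 = be. Proof. by rewrite sqr_sqrtr // ltW. Qed.
Let lb : l < b. Proof. by rewrite ltrD2l; move: s0; lra. Qed.

Lemma semicirc_le x : x <= l -> S x = 0.
Proof.
rewrite le_eqVlt => /predU1P[->|xl]; first by rewrite semicircE // discr_factor // subrr mul0r sqrtr0 mulr0.
by rewrite semicirc_out //; apply/negP => /andP[h _]; move: xl; rewrite ltNge h.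
Qed.

Section Quotient.
Variables (D : {poly R}) (dl : R).
Hypothesis dl0 : 0 < dl.
Hypothesis Dl : forall x, l <= x <= b -> dl <= `|D.[x]|.

Let Sq_le (g : R) x : `|g * (S x / D.[x])| <= dl^-1 * `|g * S x|.
Proof.
have [h|h] := boolP (l <= x <= b); last by rewrite semicirc_out // mul0r !mulr0 normr0 mulr0.
have := Dl h => h'; have D0 : 0 < `|D.[x]| by exact: lt_le_trans h'.
by rewrite mulrA normrM normfV mulrC ler_wpM2r // lef_pV2.
Qed.

Lemma density_quot : density (fun x => S x / D.[x]).
Proof.
have [fi _] := density_semicirc al be0; split.
  apply: (@le_integrable _ _ _ mu setT measurableT _ (fun x => (dl^-1 * S x)%:E)).
  - apply/measurable_EFinP/measurable_funM; first exact: measurable_semicirc.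
    by apply: measurableT_comp; [exact: measurable_inv|exact: measurable_horner].
  - move=> x _; rewrite /= lee_fin; have := Sq_le 1 x; rewrite !mul1r => /le_trans; apply.
    by rewrite normrM (ger0_norm (_ : 0 <= dl^-1)) // invr_ge0 ltW.
  - by under eq_fun do rewrite EFinM; apply: integrableZl.
have [_ [C fC]] := density_semicirc al be0.
by exists C => x /fC ->; rewrite mul0r.
Qed.

Lemma density_quotK x : S x / D.[x] * D.[x] = 1 * S x.
Proof.
rewrite mul1r; have [h|h] := boolP (l <= x <= b); last by rewrite semicirc_out // !mul0r.
by rewrite divfK // -normr_gt0; exact: lt_le_trans (Dl h).
Qed.

(** The growth estimate with ratio sqrt(be); it rules out every recurrence mode of larger
    modulus. *)
Lemma quot_bound : exists C, 0 <= C /\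
  forall n, `|momf (dmom (fun x => S x / D.[x])) (Q n)| <= C * s ^+ n.
Proof.
exists (dl^-1 * ((pi * be)^-1 * s) * (b - l)).
have P0 : 0 <= (pi * be)^-1 :> R by rewrite invr_ge0 mulr_ge0 ?pi_ge0 ?(ltW be0).
split.
  apply: mulr_ge0; last by rewrite subr_ge0 ltW.
  by apply: mulr_ge0; [rewrite invr_ge0 ltW|apply: mulr_ge0 => //; exact: ltW].
move=> n; rewrite -dmom_poly; last exact: density_quot.
rewrite [X in _ <= X](_ : _ = dl^-1 * ((pi * be)^-1 * s * s ^+ n) * (b - l)); last by rewrite !mulrA; ring.
apply: Rintegral_le_itv.
- exact: density_poly density_quot.
- exact: ltW.
- move=> x; apply: le_trans (Sq_le _ _) _.
  by rewrite ler_wpM2l ?invr_ge0 ?(ltW dl0) // cheb_bound.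
- by move=> x h; rewrite semicirc_out // mul0r mulr0.
Qed.

Lemma momf_quot q : momf (dmom (fun x => S x / D.[x])) (D * q) = momf (dmom S) q.
Proof.
rewrite (@momf_mul_density _ _ S _ _ 1) ?mul1r //.
- exact: density_quot.
- exact: density_semicirc.
- exact: density_quotK.
Qed.

End Quotient.

Lemma geo_eq0 (x C q r : R) : 0 <= q < r -> (forall k, `|x| * r ^+ k <= C * q ^+ k) -> x = 0.
Proof.
move=> /andP[q0 qr] h; have r0 : 0 < r by exact: le_lt_trans qr.
apply/eqP; rewrite -normr_le0; apply: (@geo_le0 _ _ C (q / r)).
  by rewrite divr_ge0 ?(ltW r0) //= ltr_pdivrMr // mul1r.
by move=> k; rewrite expr_div_n mulrA ler_pdivlMr ?exprn_gt0.
Qed.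

(* G(y) for real y left of the support, with the sign convention 1/(x - y). *)
Definition cauchy_val (v : R) : R := (v - Num.sqrt (v ^+ 2 - 4 * be)) / (2 * be).

(** The numbers e(Q_k) obey a recurrence with characteristic roots -r1 and -r2, where r1 r2 = be and
    s < r2. The bound by s^k excludes the mode (-r2)^k; hence e(Q_1) = - r1 e(Q_0), and the
    inhomogeneous first equation gives e(Q_0) = 1 / r2. *)
Lemma cauchy_strict y : 2 * s < al - y ->
  density (fun x => S x / (x - y)) /\
  dmom (fun x => S x / (x - y)) 0 = cauchy_val (al - y).
Proof.
set v := al - y => hv; set D : {poly R} := 'X - y%:P.
have fE : (fun x => S x / (x - y)) = (fun x => S x / D.[x]).
  by apply/funext => x; rewrite hornerXsubC.
rewrite fE; have dl0 : 0 < v - 2 * s by rewrite subr_gt0.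
have Dl x : l <= x <= b -> v - 2 * s <= `|D.[x]|.
  move=> /andP[h _]; rewrite hornerXsubC (le_trans _ (ler_norm _)) //.
  by rewrite /v; move: h; lra.
split; first exact: (density_quot dl0 Dl).
have [C [C0 bd]] := quot_bound dl0 Dl.
have mq := momf_quot dl0 Dl.
set e := momf _ in bd mq *.
pose rt := Num.sqrt (v ^+ 2 - 4 * be).
have vv : 0 <= v ^+ 2 - 4 * be.
  have -> : v ^+ 2 - 4 * be = (v - 2 * s) * (v + 2 * s).
    by transitivity (v ^+ 2 - 4 * s ^+ 2); [rewrite s2|ring].
  by rewrite mulr_ge0 //; move: s0 dl0; lra.
have rt0 : 0 <= rt by rewrite sqrtr_ge0.
have rt2 : rt ^+ 2 = v ^+ 2 - 4 * be by rewrite sqr_sqrtr.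
pose r1 := (v - rt) / 2; pose r2 := (v + rt) / 2.
have r12 : r1 * r2 = be.
  rewrite /r1 /r2; transitivity ((v ^+ 2 - rt ^+ 2) / 4); first by field.
  by rewrite rt2; field.
have sr2 : s < r2 by rewrite /r2; move: rt0 hv; lra.
have rec0 : e (Q 1) + v * e (Q 0) = 1.
  have := mq 1; rewrite momf1 semicirc_mass // => <-.
  rewrite -momfCM -momfD; congr (momf _ _).
  by rewrite jacP1 jacP0 /D /v polyCB; ring.
have recS k : e (Q k.+2) + v * e (Q k.+1) + be * e (Q k) = 0.
  have := mq (Q k.+1); rewrite semicirc_orth // => <-.
  rewrite -!momfCM -!momfD; congr (momf _ _).
  by rewrite jacPSS /D /v polyCB; ring.
pose eps k := e (Q k.+1) + r1 * e (Q k).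
have epsS k : eps k.+1 = - r2 * eps k.
  have -> : eps k.+1 = - (v - r1) * e (Q k.+1) - be * e (Q k).
    by rewrite /eps; have := recS k; lra.
  have vr : v - r1 = r2 by rewrite /r1 /r2; field.
  transitivity (- r2 * e (Q k.+1) - r1 * r2 * e (Q k)); first by rewrite vr r12.
  by rewrite /eps; ring.
have epsE k : eps k = (- r2) ^+ k * eps 0%N.
  by elim: k => [|k IH]; rewrite ?expr0 ?mul1r // epsS IH exprS mulrA.
have r20 : 0 < r2 by exact: lt_trans sr2.
have eps0 : eps 0%N = 0.
  apply: (@geo_eq0 _ (C * (s + `|r1|)) s r2); first by rewrite (ltW s0).
  move=> k; rewrite mulrC -[r2]ger0_norm ?(ltW r20) // -normrX -normrM.
  have -> : `|r2 ^+ k * eps 0%N| = `|eps k|.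
    by rewrite [in RHS]epsE !normrM !normrX normrN.
  apply: le_trans (ler_normD _ _) _; rewrite normrM.
  apply: (le_trans (lerD (bd _) (ler_wpM2l (normr_ge0 _) (bd _)))).
  by rewrite exprS le_eqVlt; apply/orP; left; apply/eqP; ring.
have e0 : r2 * e (Q 0) = 1.
  rewrite -rec0; have : e (Q 1) = - r1 * e (Q 0) by move: eps0; rewrite /eps; lra.
  by move=> ->; rewrite /r1 /r2; field.
rewrite -(momf1 (dmom _)) -/e -(jacP0 (fun=> al) (fun=> be)).
have r2n : r2 != 0 by rewrite gt_eqF.
apply: (mulfI r2n); rewrite e0 /cauchy_val -/rt -r12.
have r1n : r1 != 0 by apply: contraTneq be0 => h; rewrite -r12 h mul0r ltxx.
have -> : v - rt = 2 * r1 by rewrite /r1; field.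
by field; rewrite r1n r2n.
Qed.

(** At the edge 1 / (x - y) is unbounded on the support, and the value is the monotone limit of
    those at y - 1/(n+1). The edge does occur: the pole 0 of the Poisson density lies on it at t =
    1. *)
Lemma cauchy_transform y : 2 * s <= al - y ->
  density (fun x => S x / (x - y)) /\
  dmom (fun x => S x / (x - y)) 0 = cauchy_val (al - y).
Proof.
rewrite le_eqVlt => /predU1P[hv|]; last exact: cauchy_strict.
have yl : y = l by rewrite hv; ring.
pose d (n : nat) : R := n.+1%:R^-1.
have d0 n : 0 < d n by rewrite invr_gt0.
have st n : density (fun x => S x / (x - (y - d n))) /\
    dmom (fun x => S x / (x - (y - d n))) 0 = cauchy_val (al - y + d n).
  have -> : al - y + d n = al - (y - d n) by ring.
  by apply: cauchy_strict; move: (d0 n) hv; lra.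
pose g n x := (S x / (x - (y - d n)))%:E.
pose f x := S x / (x - y).
have posd x n : y < x -> 0 < x - (y - d n) by move: (d0 n); lra.
have g0 n x : (0 <= g n x)%E.
  rewrite lee_fin; have [h|h] := leP x y; first by rewrite semicirc_le ?mul0r // -yl.
  by rewrite divr_ge0 ?semicirc_ge0 // ltW // posd.
have f0 x : 0 <= f x.
  rewrite /f; have [h|h] := leP x y; first by rewrite semicirc_le ?mul0r // -yl.
  by rewrite divr_ge0 ?semicirc_ge0 // subr_ge0 ltW.
have mg n : measurable_fun setT (g n).
  by apply/measurable_EFinP; exact: density_measurable (st n).1.
have ndg x : nondecreasing_seq (g ^~ x).
  move=> m n mn; rewrite /g lee_fin.
  have [h|h] := leP x y; first by rewrite semicirc_le ?mul0r // -yl.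
  rewrite ler_wpM2l ?semicirc_ge0 // lef_pV2 ?posrE ?posd //.
  by rewrite !opprB lerD2l lerB // lef_pV2 ?posrE // ler_nat.
have dcvg : d @ \oo --> (0 : R) by exact: cvg_harmonic.
have gf x : limn (g ^~ x) = (f x)%:E.
  apply/cvg_lim => //; apply: cvg_EFin; first exact: nearW.
  rewrite /g /f /=; have [h|h] := leP x y.
    by rewrite semicirc_le ?mul0r -?yl //; under eq_fun do rewrite mul0r; exact: cvg_cst.
  apply: cvgM; first exact: cvg_cst.
  apply: cvgV; first by rewrite subr_eq0 gt_eqF.
  apply: cvgB; first exact: cvg_cst.
  by rewrite -[X in _ --> X]subr0; apply: cvgB => //; exact: cvg_cst.
have fint : (\int[mu]_x (f x)%:E = (cauchy_val (al - y))%:E)%E.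
  have := @cvg_monotone_convergence _ _ R mu setT measurableT g mg (fun n x _ => g0 n x) (fun x _ => ndg x).
  under [X in _ --> X -> _]eq_integral do rewrite gf.
  move=> /cvg_lim <- //; apply/cvg_lim => //.
  have -> : (fun n => \int[mu]_x g n x)%E = (fun n => (cauchy_val (al - y + d n))%:E).
    apply/funext => n; have [[/integrable_fin_num fi _] <-] := st n.
    rewrite /dmom /Rintegral; under [X in _ = (fine X)%:E]eq_integral do rewrite expr0 mul1r.
    by rewrite fineK //; exact: fi.
  apply: cvg_EFin; first exact: nearW.
  have vcv : (fun n => al - y + d n) @ \oo --> al - y.
    by rewrite -[X in _ --> X]addr0; apply: cvgD => //; exact: cvg_cst.
  apply: cvgM; last exact: cvg_cst.
  apply: cvgB => //; apply: (continuous_cvg _ (@sqrt_continuous R _)).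
  apply: cvgB; last exact: cvg_cst.
  by rewrite expr2; apply: cvgM.
have fi : mu.-integrable setT (EFin \o f).
  apply/integrableP; split.
    apply/measurable_EFinP/measurable_funM; first exact: measurable_semicirc.
    apply: measurableT_comp; first exact: measurable_inv.
    by apply: measurable_funB => //; exact: measurable_cst.
  under eq_integral do rewrite /= ger0_norm //.
  by rewrite fint ltry.
split; last first.
  rewrite /dmom; under eq_Rintegral do rewrite expr0 mul1r.
  by rewrite /Rintegral fint.
have [_ [C fC]] := density_semicirc al be0.
by split=> //; exists C => x /fC; rewrite /f => ->; rewrite mul0r.
Qed.

End CauchyTransform.

(** * The listed measures *)

Section ListedDensities.
Variable R : realType.
Notation mu := (@lebesgue_measure R).
Local Notation atomf w x0 := (fun n : nat => w * x0 ^+ n).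

Lemma momf_add (m m' : nat -> R) p : momf (fun n => m n + m' n) p = momf m p + momf m' p.
Proof. by rewrite /momf -big_split /=; apply: eq_bigr => i _; rewrite mulrDr. Qed.

Lemma momf_atom (w x0 : R) p : momf (atomf w x0) p = w * p.[x0].
Proof.
by rewrite /momf horner_coef mulr_sumr; apply: eq_bigr => i _; rewrite mulrCA.
Qed.

Definition listed_mom (c : mcase R) (t : R) n : R :=
  dmom (listed_dens c t) n + listed_atom_w c t * listed_atom_p c t ^+ n.

Lemma listed_momE c t p : momf (listed_mom c t) p =
  momf (dmom (listed_dens c t)) p + listed_atom_w c t * p.[listed_atom_p c t].
Proof. by rewrite momf_add momf_atom. Qed.

(** Orthogonality is recorded against constants only; [jacP_orth] extends it to all pairs. *)
Record listed_spec (c : mcase R) (t : R) : Prop := ListedSpec {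
  lspec_density : density (listed_dens c t);
  lspec_ge0 : forall x, 0 <= listed_dens c t x;
  lspec_w : 0 <= listed_atom_w c t;
  lspec_mass : momf (listed_mom c t) 1 = 1;
  lspec_orth : forall n, momf (listed_mom c t) (listedP c n.+1 t) = 0 }.

Lemma semicircle_spec t : 0 < t -> listed_spec MSemicircle t.
Proof.
move=> t0; split.
- exact: density_semicirc.
- exact: semicirc_ge0.
- by [].
- by rewrite listed_momE mul0r addr0 momf1 semicirc_mass.
- by move=> n; rewrite listed_momE mul0r addr0; exact: semicirc_orth.
Qed.

(** The density times x is t S and the atom sits at 0, so pairing x Q_k = P_(k+1) + t P_k gives
    L(P_1) + t L(1) = t and L(P_(k+1)) = - t L(P_k) for k >= 1. The total mass comes from the Cauchy
    transform at 0. *)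
Lemma poisson_spec t : 0 < t -> listed_spec MPoisson t.
Proof.
move=> t0; set r := Num.sqrt t; have r0 : 0 < r by rewrite sqrtr_gt0.
have r2 : r ^+ 2 = t by rewrite sqr_sqrtr // ltW.
have edge : 2 * r <= 1 + t - 0.
  by rewrite subr0 -r2 -subr_ge0 (_ : _ - _ = (1 - r) ^+ 2) ?sqr_ge0 //; ring.
have [df mass] := cauchy_transform t0 edge.
have fE : listed_dens MPoisson t = fun x => t * (semicirc_dens (1 + t) t x / (x - 0)).
  by apply/funext => x; rewrite subr0 /=; ring.
have dl : density (listed_dens MPoisson t) by rewrite fE; exact: density_scale.
have S0 x : x <= 0 -> semicirc_dens (1 + t) t x = 0.
  by move=> x0; apply: semicirc_le => //; move: edge; rewrite -/r; lra.
have w0 : 0 <= listed_atom_w MPoisson t by rewrite /= le_max lexx orbT.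
have vv : (1 + t) ^+ 2 - 4 * t = (1 - t) ^+ 2 by ring.
have L1 : momf (listed_mom MPoisson t) 1 = 1.
  rewrite listed_momE hornerC mulr1 momf1 fE dmom_scale // mass subr0 /cauchy_val vv.
  rewrite sqrtr_sqr /=; have tn : t != 0 by rewrite gt_eqF.
  (* The Cauchy transform contains sqrt((1 - t)^2) = |1 - t|; the atom compensates its change of
     sign at t = 1. *)
  have [h|h] := leP t 1.
    rewrite ger0_norm ?subr_ge0 // max_l ?subr_ge0 //; field; by [].
  rewrite ltr0_norm ?subr_lt0 // max_r ?subr_le0 ?(ltW h) //; field; by [].
split=> //.
  move=> x; rewrite /=; have [h|h] := leP x 0; first by rewrite S0 ?mulr0.
  by rewrite mulr_ge0 ?semicirc_ge0 // divr_ge0 // ltW.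
pose Q := jacP (fun=> 1 + t) (fun=> t).
have LQ k : momf (listed_mom MPoisson t) ('X * Q k) = t * momf (dmom (semicirc_dens (1 + t) t)) (Q k).
  rewrite listed_momE hornerM hornerX /= mul0r mulr0 addr0.
  apply: momf_mul_density => //; first exact: density_semicirc.
  move=> x; rewrite hornerX; have [->|xn] := eqVneq x 0; first by rewrite S0 ?mulr0.
  by rewrite mulrAC divfK.
have XQ k : 'X * Q k = listedP MPoisson k.+1 t + t%:P * listedP MPoisson k t.
  rewrite /Q /listedP; elim/jacP_ind2: k => [||k I0 I1].
  - by rewrite !jacP0 jacP1 /=; ring.
  - rewrite jacPSS !jacP1 jacP0 /=; apply: poly_fun_inj => x; rewrite !hornerE /=; ring.
  - rewrite jacPSS mulrBr [_ * (_ * _)]mulrCA I1 [_ * (_ * _)]mulrCA I0.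
    rewrite [jacP _ _ k.+3]jacPSS [jacP (fun k => if _ then _ else _) _ k.+2]jacPSS /= !polyCD; ring.
elim=> [|n IH].
  have := LQ 0%N; rewrite XQ momfD momfCM -[Q 0%N]/(1 : {poly R}) -[listedP MPoisson 0 t]/(1 : {poly R}).
  rewrite L1 momf1 semicirc_mass // mulr1.
  by move=> /eqP; rewrite addrC -[eqbRHS]addr0 (inj_eq (addrI _)) => /eqP.
have := LQ n.+1; rewrite XQ momfD momfCM IH mulr0 addr0 => ->.
by rewrite semicirc_orth // mulr0.
Qed.

Lemma geometric_seq (u : nat -> R) (c : R) :
  (forall k, u k.+1 = c * u k) -> forall k, u k = c ^+ k * u 0%N.
Proof. by move=> h; elim=> [|k IH]; rewrite ?mul1r // h IH exprS mulrA. Qed.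

Lemma geometric_norm (u : nat -> R) (c : R) :
  (forall k, u k.+1 = c * u k) -> forall k, `|u 1%N| * `|c| ^+ k = `|u k.+1|.
Proof.
move=> h k; have -> : u k.+1 = c ^+ k * u 1%N.
  exact: (geometric_seq (u := fun k => u k.+1) (fun k => h k.+1)).
by rewrite normrM normrX mulrC.
Qed.

Section Family.
Variables a t : R.
Hypothesis a0 : 0 <= a.
Hypothesis t0 : 0 < t.
Let al := a * (t + 2).
Let be := t + 1.
Local Notation S := (semicirc_dens al be).
Local Notation Q := (jacP (fun=> al) (fun=> be)).
Local Notation s := (Num.sqrt be).
Local Notation f := (listed_dens (MFamily a) t).
Local Notation P := (listedP (MFamily a)).
Local Notation L := (momf (listed_mom (MFamily a) t)).

Let be0 : 0 < be. Proof. by rewrite addr_gt0. Qed.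
Let s0 : 0 < s. Proof. by rewrite sqrtr_gt0. Qed.
Let s2 : s ^+ 2 = be. Proof. by rewrite sqr_sqrtr // ltW. Qed.

(** Without real zeros for a < 1, with the zeros t sqrt(a^2 - 1) and - t sqrt(a^2 - 1) for a >=
    1. *)
Definition fam_den : {poly R} := 'X ^+ 2 + (t ^+ 2 * (1 - a ^+ 2))%:P.

Lemma fam_denE x : fam_den.[x] = x ^+ 2 + t ^+ 2 * (1 - a ^+ 2).
Proof. by rewrite /fam_den !hornerE. Qed.

Lemma fam_densE : f = fun x => t * be * (S x / fam_den.[x]).
Proof.
apply/funext => x; rewrite fam_denE /=; case: ifP => [_|h]; first by rewrite /be; ring.
case: eqP => [a1|_].
  rewrite /al /be a1 mul1r [t + 2]addrC [t + 1]addrC expr1n subrr mulr0 addr0; ring.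
rewrite /al /be; have -> : x ^+ 2 + t ^+ 2 * (1 - a ^+ 2) = x ^+ 2 - t ^+ 2 * (a ^+ 2 - 1) by ring.
ring.
Qed.

Lemma fam_denQ k : fam_den * Q k.+1 =
  P k.+3 t + (2 * a * be)%:P * P k.+2 t + (be ^+ 2)%:P * P k.+1 t.
Proof.
rewrite /listedP; elim/jacP_ind2: k => [||k I0 I1].
- rewrite !jacPSS !jacP1 !jacP0 /= /fam_den /be /al; apply: poly_fun_inj => x.
  rewrite !hornerE /=; ring.
- rewrite !jacPSS !jacP1 !jacP0 /= /fam_den /be /al; apply: poly_fun_inj => x.
  rewrite !hornerE /=; ring.
- rewrite [Q k.+3]jacPSS mulrBr [_ * (_ * _)]mulrCA I1 [_ * (_ * _)]mulrCA I0.
  set PP := jacP (fun k0 => if _ then _ else _) _.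
  have PS j : PP j.+3 = ('X - al%:P) * PP j.+2 - be%:P * PP j.+1 by rewrite /PP jacPSS.
  move: (PS k) (PS k.+1) (PS k.+2); move: (PP k.+1) (PP k.+2) (PP k.+3) (PP k.+4) (PP k.+4.+1).
  by move=> p1 p2 p3 p4 p5 -> -> ->; ring.
Qed.

(** The start of [fam_denQ]. Its last coefficient is [t * be] and not [be ^+ 2], as the first
    off-diagonal coefficient of [P] is [t] and not [be]. *)
Lemma fam_den0 : fam_den = P 2 t + (2 * a * be)%:P * P 1 t + (t * be)%:P * P 0 t.
Proof.
rewrite /listedP jacPSS !jacP1 !jacP0 /= /fam_den /be /al; apply: poly_fun_inj => x.
rewrite !hornerE /=; ring.
Qed.

Hypothesis df : density f.
Hypothesis fK : forall x, f x * fam_den.[x] = t * be * S x.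
Hypothesis atom : listed_atom_w (MFamily a) t * fam_den.[listed_atom_p (MFamily a) t] = 0.

(** An atom of nonzero weight sits at a zero of [fam_den], so it disappears once this factor is
    present. *)
Lemma fam_LD q : L (fam_den * q) = t * be * momf (dmom S) q.
Proof.
rewrite listed_momE hornerM mulrA atom mul0r addr0.
apply: momf_mul_density => //; exact: density_semicirc.
Qed.

Lemma fam_rec0 : L (P 2 t) + 2 * a * be * L (P 1 t) + t * be * L 1 = t * be.
Proof.
have h := fam_LD 1; rewrite momf1 semicirc_mass // !mulr1 in h.
by rewrite -[RHS]h fam_den0 -!momfCM -!momfD.
Qed.

Lemma fam_recS k :
  L (P k.+3 t) + 2 * a * be * L (P k.+2 t) + be ^+ 2 * L (P k.+1 t) = 0.
Proof.
by rewrite -!momfCM -!momfD -fam_denQ fam_LD semicirc_orth // mulr0.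
Qed.

(** The recurrence has order two, so each range of [a] only has to supply these two initial
    values. *)
Lemma fam_orth : L 1 = 1 -> L (P 1 t) = 0 -> forall n, L (P n.+1 t) = 0.
Proof.
move=> L1 LP1; elim/jacP_ind2 => [//||n I0 I1].
  by have := fam_rec0; rewrite L1 LP1; lra.
by have := fam_recS n; rewrite I0 I1; lra.
Qed.

End Family.

(** The sequence p_k = L(P_(k+1)) solves p_(k+2) + 2 a be p_(k+1) + be^2 p_k = 0. For a <= 1 both
    characteristic roots have modulus be, while p_k = O(s^k) with s < be, so p = 0. [rec0] then
    gives the total mass. *)
Lemma family_le1_spec a t : 0 <= a <= 1 -> 0 < t -> listed_spec (MFamily a) t.
Proof.
move=> /andP[a0 a1] t0; set al := a * (t + 2); set be := t + 1.
have be0 : 0 < be by rewrite addr_gt0.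
set s := Num.sqrt be; have s0 : 0 < s by rewrite sqrtr_gt0.
have s2 : s ^+ 2 = be by rewrite sqr_sqrtr // ltW.
have s1 : 1 < s by rewrite -(@ltr_pXn2r _ 2) ?nnegrE ?(ltW s0) // expr1n s2 /be; lra.
set S := semicirc_dens al be; set D := fam_den a t.
have fE : listed_dens (MFamily a) t = fun x => t * be * (S x / D.[x]) by exact: fam_densE.
have [dl [dl0 Dl]] : exists dl, 0 < dl /\ forall x, al - 2 * s <= x <= al + 2 * s -> dl <= `|D.[x]|.
  have [h|h] : a < 1 \/ a = 1 by move: a1; rewrite le_eqVlt => /predU1P[|]; [right|left].
    have p : 0 < t ^+ 2 * (1 - a ^+ 2).
      by rewrite mulr_gt0 ?exprn_gt0 // subr_gt0 expr_lt1.
    exists (t ^+ 2 * (1 - a ^+ 2)); split => // x _.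
    by rewrite /D fam_denE (le_trans _ (ler_norm _)) // lerDr sqr_ge0.
  (* For a = 1 the double zero 0 of D lies strictly left of the support because s > 1. *)
  have lE : al - 2 * s = (s - 1) ^+ 2.
    have -> : al = s ^+ 2 + 1 by rewrite s2 /al /be h; ring.
    ring.
  have l0 : 0 < al - 2 * s by rewrite lE exprn_gt0 // subr_gt0.
  exists ((al - 2 * s) ^+ 2); split; first by rewrite exprn_gt0.
  move=> x /andP[hx _]; rewrite /D fam_denE h expr1n subrr mulr0 addr0.
  by rewrite (le_trans _ (ler_norm _)) // lerXn2r ?nnegrE // ltW // (lt_le_trans l0).
have d0 : density (fun x => S x / D.[x]) := density_quot be0 dl0 Dl.
have df : density (listed_dens (MFamily a) t) by rewrite fE; exact: density_scale.
have fK x : listed_dens (MFamily a) t x * D.[x] = t * be * S x.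
  by rewrite fE -[LHS]mulrA (density_quotK be0 dl0 Dl) mul1r.
have w0 : listed_atom_w (MFamily a) t = 0 by rewrite /= ltNge a1.
have atom : listed_atom_w (MFamily a) t * D.[listed_atom_p (MFamily a) t] = 0 by rewrite w0 mul0r.
have Dge0 x : 0 <= D.[x].
  by rewrite /D fam_denE addr_ge0 ?sqr_ge0 // mulr_ge0 ?sqr_ge0 // subr_ge0 expr_le1.
pose L := momf (listed_mom (MFamily a) t).
pose P n := listedP (MFamily a) n t.
pose p k := L (P k.+1).
have rec k : p k.+2 + 2 * a * be * p k.+1 + be ^+ 2 * p k = 0 := fam_recS t0 df fK atom k.
have rec0 : p 1%N + 2 * a * be * p 0%N + t * be * L 1 = t * be := fam_rec0 t0 df fK atom.
(* The three-term Chebyshev expansion of P_n starts at n = 2, so the bound starts at [p 1]; hence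
   the arguments below first kill [J 1], [d 1] and [p 1], then step back to index 0. *)
have [C [C0 bd]] : exists C, 0 <= C /\ forall k, `|p k.+1| <= C * s ^+ k.
  have [C [C0 bd]] := quot_bound be0 dl0 Dl.
  exists (t * be * C * (s ^+ 2 + 2 * a * s + 1)); split.
    by rewrite !mulr_ge0 ?addr_ge0 ?mulr_ge0 ?sqr_ge0 ?(ltW s0) // ltW.
  move=> k; rewrite /p /L listed_momE w0 mul0r addr0.
  have -> : P k.+2 = jacP (fun=> al) (fun=> be) k.+2 +
      (2 * a)%:P * jacP (fun=> al) (fun=> be) k.+1 + jacP (fun=> al) (fun=> be) k.
    have b0 : 0 <= 1 * t + 1 by rewrite mul1r ltW.
    have [_] := @meixP_cheb R a 1 (2 * a) 1 t k b0.
    rewrite -(listedPE (MFamily a)) !chebQE // -/(P _) => ->.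
    by rewrite scale1r -mul_polyC mul1r /al /be (_ : a * (t + 2) = a * t + 2 * a) //; ring.
  rewrite 2!momfD momfCM fE.
  have dE q : momf (dmom (fun x => t * be * (S x / D.[x]))) q = t * be * momf (dmom (fun x => S x / D.[x])) q.
    by rewrite /momf mulr_sumr; apply: eq_bigr => i _; rewrite dmom_scale // mulrCA.
  rewrite !dE.
  set e2 := momf _ (jacP _ _ k.+2); set e1 := momf _ (jacP _ _ k.+1); set e0 := momf _ _.
  have -> : t * be * e2 + 2 * a * (t * be * e1) + t * be * e0 = t * be * (e2 + 2 * a * e1 + e0) by ring.
  have tb0 : 0 <= t * be by rewrite mulr_ge0 // ltW.
  rewrite (_ : t * be * C * _ * _ = t * be * (C * (s ^+ 2 + 2 * a * s + 1) * s ^+ k)); last by ring.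
  rewrite normrM (ger0_norm tb0) ler_wpM2l //.
  apply: le_trans (ler_normD _ _) _.
  apply: le_trans (lerD (ler_normD _ _) (lexx _)) _.
  rewrite normrM (ger0_norm (_ : 0 <= 2 * a)) ?mulr_ge0 //.
  apply: le_trans (lerD (lerD (bd _) (ler_wpM2l _ (bd _))) (bd _)) _; first by rewrite mulr_ge0.
  by rewrite -/s !exprS le_eqVlt; apply/orP; left; apply/eqP; ring.
have sb : s < be by rewrite -s2 expr2 ltr_pMr.
have [p0 p1] : p 0%N = 0 /\ p 1%N = 0.
  have [h|h] : a < 1 \/ a = 1 by move: a1; rewrite le_eqVlt => /predU1P[|]; [right|left].
    (* The roots are complex conjugate. [J] is definite for a < 1, is multiplied by be^2 at each
       step, but grows at most like s^(2k) = be^k. *)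
    pose J k := p k.+1 ^+ 2 + 2 * a * be * p k.+1 * p k + be ^+ 2 * p k ^+ 2.
    have JS k : J k.+1 = be ^+ 2 * J k.
      have e : p k.+2 = - (2 * a * be * p k.+1 + be ^+ 2 * p k) by have := rec k; lra.
      by rewrite /J e; ring.
    have JE := geometric_seq JS.
    have J10 : J 1%N = 0.
      apply: (@geo_eq0 _ _ (C ^+ 2 * (s ^+ 2 + 2 * a * be * s + be ^+ 2)) be (be ^+ 2)).
        by rewrite (ltW be0) /= expr2 ltr_pMr // /be; lra.
      move=> k; have := geometric_norm JS k; rewrite (ger0_norm (sqr_ge0 be)) => ->.
      rewrite /J; apply: le_trans (ler_normD _ _) _.
      apply: le_trans (lerD (ler_normD _ _) (lexx _)) _.
      have T2 x y : `|2 * a * be * x * y| = 2 * a * be * `|x| * `|y|.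
        by rewrite !normrM (gtr0_norm be0) (ger0_norm a0) ger0_norm.
      have T3 y : `|be ^+ 2 * y ^+ 2| = be ^+ 2 * `|y| ^+ 2.
        by rewrite real_normK ?num_real // ger0_norm // mulr_ge0 ?sqr_ge0.
      rewrite T2 T3 normrX.
      have A : `|p k.+2| <= C * s ^+ k * s by rewrite -mulrA -exprSr.
      have B := bd k; have q0 : 0 <= `|p k.+1| by [].
      have q0' : 0 <= `|p k.+2| by [].
      set y := C * s ^+ k in A B; have y0 : 0 <= y by rewrite mulr_ge0 ?exprn_ge0 // ltW.
      have -> : C ^+ 2 * (s ^+ 2 + 2 * a * be * s + be ^+ 2) * be ^+ k =
         (y * s) ^+ 2 + 2 * a * be * (y * s) * y + be ^+ 2 * y ^+ 2.
        have -> : be ^+ k = (s ^+ k) ^+ 2 by rewrite -s2 -!exprM mulnC.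
        by rewrite /y; ring.
      have ys0 : 0 <= y * s := mulr_ge0 y0 (ltW s0).
      apply: lerD; first apply: lerD.
      - by rewrite lerXn2r ?nnegrE.
      - rewrite -[leLHS]mulrA -[leRHS]mulrA; apply: ler_wpM2l; last by apply: ler_pM.
        by rewrite !mulr_ge0 // ltW.
      - by rewrite ler_wpM2l ?sqr_ge0 // lerXn2r ?nnegrE.
    have : J 0%N = 0.
      have := JE 1%N; rewrite J10 expr1 => /esym/eqP; rewrite mulf_eq0 expf_eq0 /=.
      by rewrite (gt_eqF be0) /= => /eqP.
    have -> : J 0%N = (p 1%N + a * be * p 0%N) ^+ 2 + (1 - a ^+ 2) * be ^+ 2 * p 0%N ^+ 2 by rewrite /J; ring.
    have q : 0 < (1 - a ^+ 2) * be ^+ 2 by rewrite mulr_gt0 ?exprn_gt0 // subr_gt0 expr_lt1.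
    move/eqP; rewrite (paddr_eq0 (sqr_ge0 _) (mulr_ge0 (ltW q) (sqr_ge0 _))) => /andP[h1 h2].
    have z : p 0%N = 0 by move: h2; rewrite mulf_eq0 (gt_eqF q) /= sqrf_eq0 => /eqP.
    by split=> //; move: h1; rewrite z mulr0 addr0 sqrf_eq0 => /eqP.
  (* Here - be is a double root: the growth argument is applied to [d], which removes one factor,
     and then to [p]. *)
  pose d k := p k.+1 + be * p k.
  have dS k : d k.+1 = - be * d k.
    by have := rec k; rewrite /d h mulr1; set x := p k.+2; set y := p k.+1; set z := p k; lra.
  have dE := geometric_seq dS.
  have d1 : d 1%N = 0.
    apply: (@geo_eq0 _ _ (C * (s + be)) s be); first by rewrite (ltW s0).
    move=> k; have := geometric_norm dS k; rewrite (normrN be) (gtr0_norm be0) => ->.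
    apply: le_trans (ler_normD _ _) _; rewrite normrM (gtr0_norm be0).
    apply: le_trans (lerD (bd _) (ler_wpM2l (ltW be0) (bd _))) _.
    by rewrite exprS le_eqVlt; apply/orP; left; apply/eqP; ring.
  have d00 : d 0%N = 0.
    by have /eqP := dE 1%N; rewrite d1 expr1 eq_sym mulf_eq0 oppr_eq0 (gt_eqF be0) => /eqP.
  have pS k : p k.+1 = - be * p k.
    have : d k = 0 by rewrite dE d00 mulr0.
    by rewrite /d mulNr => /eqP; rewrite addr_eq0 => /eqP.
  have pE := geometric_seq pS.
  have p1 : p 1%N = 0.
    apply: (@geo_eq0 _ _ C s be); first by rewrite (ltW s0).
    move=> k; have := geometric_norm pS k; rewrite (normrN be) (gtr0_norm be0) => ->; exact: bd.
  split=> //; have /eqP := pE 1%N.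
  by rewrite p1 expr1 eq_sym mulf_eq0 oppr_eq0 (gt_eqF be0) => /eqP.
have L1 : L 1 = 1.
  have tb : t * be != 0 by rewrite mulf_neq0 ?gt_eqF.
  by apply: (mulfI tb); move: rec0; rewrite p0 p1 mulr0 !add0r mulr1.
split=> //.
- move=> x; rewrite fE; apply: mulr_ge0; first by apply: mulr_ge0; exact: ltW.
  by apply: divr_ge0; [exact: semicirc_ge0|exact: Dge0].
- by rewrite w0.
- exact: (fam_orth t0 df fK atom L1 p0).
Qed.

(** D splits as (x - x0) (x + x0). Partial fractions of 1 / D and x / D express mass and mean by two
    values of the Cauchy transform; the atom sits at x0. *)
Lemma family_gt1_spec a t : 1 < a -> 0 < t -> listed_spec (MFamily a) t.
Proof.
move=> a1 t0; set al := a * (t + 2); set be := t + 1.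
have be0 : 0 < be by rewrite addr_gt0.
set s := Num.sqrt be; have s0 : 0 < s by rewrite sqrtr_gt0.
have s2 : s ^+ 2 = be by rewrite sqr_sqrtr // ltW.
pose sg := Num.sqrt (a ^+ 2 - 1).
have a2 : 0 < a ^+ 2 - 1 by rewrite subr_gt0 expr_gt1 // ltW // (lt_trans _ a1).
have sg0 : 0 < sg by rewrite sqrtr_gt0.
have sg2 : sg ^+ 2 = a ^+ 2 - 1 by rewrite sqr_sqrtr // ltW.
(* The parametrisation a = (q + 1/q) / 2 makes both radicands in the Cauchy transforms perfect
   squares. *)
pose q := a - sg.
have qi : q * (a + sg) = 1 by rewrite /q -subr_sqr sg2; ring.
have asg : 0 < a + sg by rewrite addr_gt0 // (lt_trans _ a1).
have q0 : 0 < q by rewrite -(pmulr_lgt0 _ asg) qi.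
have qn : q != 0 by rewrite gt_eqF.
have qV : q^-1 = a + sg by apply: (mulfI qn); rewrite mulfV.
have sgq : sg = (q^-1 - q) / 2 by rewrite qV /q; field.
have aq : a = (q^-1 + q) / 2 by rewrite qV /q; field.
pose x0 := t * sg; have x00 : 0 < x0 by rewrite mulr_gt0.
set S := semicirc_dens al be; set D := fam_den a t.
have v1 : al - x0 = be * q + q^-1 by rewrite /al /x0 /be sgq aq; field.
have v2 : al - (- x0) = be * q^-1 + q by rewrite /al /x0 /be sgq aq; field.
(* Arithmetic-geometric mean: x0 and - x0 lie at or left of the lower edge, since al - x0 and al +
   x0 are sums of two positive numbers with product be. *)
have agm (u v : R) : 0 < u -> 0 < v -> u * v = be -> 2 * s <= u + v.
  move=> u0 w0 uv; rewrite -(@ler_pXn2r _ 2) ?nnegrE ?addr_ge0 ?mulr_ge0 ?(ltW s0) ?(ltW u0) ?(ltW w0) //.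
  rewrite exprMn s2 -uv -subr_ge0 (_ : _ - _ = (u - v) ^+ 2) ?sqr_ge0 //; ring.
have e1 : 2 * s <= al - x0.
  by rewrite v1; apply: agm; rewrite ?mulr_gt0 ?invr_gt0 // -mulrA mulfV // mulr1.
have e2 : 2 * s <= al - (- x0).
  by rewrite v2; apply: agm; rewrite ?mulr_gt0 ?invr_gt0 // -mulrA mulVf // mulr1.
have [d1 c1] := cauchy_transform be0 e1; have [d2 c2] := cauchy_transform be0 e2.
have DE x : D.[x] = (x - x0) * (x + x0).
  rewrite /D fam_denE -subr_sqr /x0 exprMn sg2; ring.
have Sx x : x <= x0 -> S x = 0.
  by move=> h; apply: semicirc_le => //; move: e1 h; rewrite -/s; lra.
have fE : listed_dens (MFamily a) t = fun x => t * be * (S x / D.[x]).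
  by exact: fam_densE.
have fE' : listed_dens (MFamily a) t =
    fun x => t * be / (2 * x0) * (S x / (x - x0) + - 1 * (S x / (x - (- x0)))).
  rewrite fE; apply/funext => x; have [h|h] := leP x x0; first by rewrite Sx // !mul0r !mulr0 addr0 mulr0.
  have n1 : x - x0 != 0 by rewrite gt_eqF // subr_gt0.
  have n2 : x + x0 != 0 by rewrite gt_eqF // addr_gt0 // (lt_trans x00).
  have n3 : x0 != 0 by rewrite gt_eqF.
  by rewrite DE opprK; field; rewrite n1 n2 n3.
have df : density (listed_dens (MFamily a) t).
  by rewrite fE'; apply: density_scale; apply: density_add => //; apply: density_scale.
have fK x : listed_dens (MFamily a) t x * D.[x] = t * be * S x.
  rewrite fE; have [h|h] := leP x x0; first by rewrite Sx // mul0r !mulr0 mul0r.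
  by rewrite -[LHS]mulrA divfK // DE mulf_neq0 // gt_eqF ?subr_gt0 // addr_gt0 // (lt_trans x00).
have wE : listed_atom_w (MFamily a) t = Num.max (1 - t * (q / (2 * sg))) 0 by rewrite /= a1.
have xE : listed_atom_p (MFamily a) t = x0 by rewrite /= a1.
have atom : listed_atom_w (MFamily a) t * D.[listed_atom_p (MFamily a) t] = 0.
  by rewrite xE DE subrr mul0r mulr0.
have w0 : 0 <= listed_atom_w (MFamily a) t by rewrite wE le_max lexx orbT.
have fge0 x : 0 <= listed_dens (MFamily a) t x.
  rewrite fE; have [h|h] := leP x x0; first by rewrite Sx // mul0r mulr0.
  apply: mulr_ge0; first by apply: mulr_ge0; exact: ltW.
  apply: divr_ge0; [exact: semicirc_ge0|rewrite DE].
  by rewrite ltW // mulr_gt0 ?subr_gt0 // addr_gt0 // (lt_trans x00).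
have sq1 : (be * q + q^-1) ^+ 2 - 4 * be = (be * q - q^-1) ^+ 2 by field.
have sq2 : (be * q^-1 + q) ^+ 2 - 4 * be = (be * q^-1 - q) ^+ 2 by field.
(* The minimum stems from the absolute value |be q - 1/q| of the root; the atom is present exactly
   when be q < 1/q. *)
pose M := Num.min (be * q) q^-1.
have c1E : cauchy_val be (al - x0) = M / be.
  rewrite v1 /cauchy_val sq1 sqrtr_sqr /M; have bn : be != 0 by rewrite gt_eqF.
  have [h|h] := leP (be * q) q^-1.
    by rewrite ler0_norm ?subr_le0 //; field; rewrite qn bn.
  by rewrite gtr0_norm ?subr_gt0 //; field; rewrite qn bn.
have qq : q <= q^-1 by rewrite -subr_ge0 (_ : q^-1 - q = 2 * sg) ?mulr_ge0 ?(ltW sg0) // sgq; field.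
have c2E : cauchy_val be (al - (- x0)) = q / be.
  rewrite v2 /cauchy_val sq2 sqrtr_sqr; have bn : be != 0 by rewrite gt_eqF.
  rewrite ger0_norm; first by field; rewrite qn bn.
  rewrite subr_ge0 (le_trans qq) // ler_peMl ?invr_ge0 ?(ltW q0) //.
  by rewrite /be lerDr ltW.
have bn : be != 0 by rewrite gt_eqF.
have sn : sg != 0 by rewrite gt_eqF.
have tn : t != 0 by rewrite gt_eqF.
have xn : x0 != 0 by rewrite gt_eqF.
have Wq : 1 - t * (q / (2 * sg)) = (q^-1 - be * q) / (2 * sg).
  have -> : q^-1 = 2 * sg + q by rewrite sgq; field.
  by rewrite /be; field.
have mass : dmom (listed_dens (MFamily a) t) 0 = (M - q) / (2 * sg).
  rewrite fE' dmom_scale ?dmom_add ?dmom_scale //; last 2 first.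
  - exact: density_scale.
  - by apply: density_add => //; apply: density_scale.
  by rewrite c1 c2 c1E c2E /x0; field; rewrite tn sn bn.
have mean : dmom (listed_dens (MFamily a) t) 1 = t * (M + q) / 2.
  transitivity (dmom (fun x => t * be / 2 * (S x / (x - x0) + S x / (x - (- x0)))) 0).
    apply: eq_Rintegral => x _; rewrite fE expr0 mul1r expr1 DE.
    have [h|h] := leP x x0; first by rewrite Sx // !mul0r !mulr0 addr0 mulr0.
    have n1 : x - x0 != 0 by rewrite gt_eqF // subr_gt0.
    have n2 : x + x0 != 0 by rewrite gt_eqF // addr_gt0 // (lt_trans x00).
    by rewrite opprK; field; rewrite n1 n2.
  rewrite dmom_scale ?dmom_add //; last exact: density_add.
  by rewrite c1 c2 c1E c2E; field.
have L1 : momf (listed_mom (MFamily a) t) 1 = 1.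
  rewrite momf1 /listed_mom mass wE Wq expr0 mulr1 /M.
  have two : q^-1 - q = 2 * sg by rewrite sgq; field.
  have e : 1 = (q^-1 - q) / (2 * sg) by rewrite two divff // mulf_neq0 ?pnatr_eq0.
  have [h|h] := leP (be * q) q^-1.
    rewrite max_l ?divr_ge0 ?subr_ge0 ?mulr_ge0 ?(ltW sg0) // [RHS]e; field; by rewrite qn sn.
  rewrite max_r ?addr0 -?e // pmulr_lle0 ?invr_gt0 ?mulr_gt0 // subr_le0 ltW //.
have LP1 : momf (listed_mom (MFamily a) t) (listedP (MFamily a) 1 t) = 0.
  rewrite /listedP jacP1 momfB momfX momfC /= -(momf1 (listed_mom _ _)) L1 mulr1.
  rewrite /listed_mom mean wE Wq xE expr1 /M [X in _ - X * t]aq /x0.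
  have [h|h] := leP (be * q) q^-1.
    rewrite max_l ?divr_ge0 ?subr_ge0 ?mulr_ge0 ?(ltW sg0) //; field; by rewrite qn sn.
  rewrite max_r ?mul0r ?addr0; first by field.
  by rewrite pmulr_lle0 ?invr_gt0 ?mulr_gt0 // subr_le0 ltW.
split=> //; exact: (fam_orth t0 df fK atom L1 LP1).
Qed.

Lemma listed_specP c t : case_ok c -> 0 < t -> listed_spec c t.
Proof.
case: c => [||a] ok t0; [exact: semicircle_spec|exact: poisson_spec|].
have [a1|a1] := leP a 1; last exact: family_gt1_spec.
by apply: family_le1_spec => //; apply/andP.
Qed.

End ListedDensities.

(** * Probability measures made of a density and one atom *)

Section DensityMeasure.
Variable R : realType.
Notation mu := (@lebesgue_measure R).
Notation T := (measurableTypeR R).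

Record pdens := PDens {
  pd_f : R -> R; pd_w : R; pd_x : R;
  pd_density : density pd_f;
  pd_ge0 : forall x, 0 <= pd_f x;
  pd_w0 : 0 <= pd_w;
  pd_mass : (\int[mu]_x pd_f x)%R + pd_w = 1 }.

Definition ac_meas (d : pdens) (A : set T) : \bar R :=
  (\int[mu]_(x in A) (pd_f d x)%:E)%E.

Section Construction.
Variable d : pdens.
Let f := pd_f d.

Let mf : measurable_fun setT f. Proof. exact: density_measurable (pd_density d). Qed.
Let fi : mu.-integrable setT (EFin \o f). Proof. by have [] := pd_density d. Qed.

Let ac0 : ac_meas d set0 = 0%E. Proof. by rewrite /ac_meas integral_set0. Qed.

Let ac_ge0 A : (0 <= ac_meas d A)%E.
Proof. by apply: integral_ge0 => x _; rewrite lee_fin pd_ge0. Qed.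

Let ac_sigma_additive : semi_sigma_additive (ac_meas d).
Proof.
move=> /= A mA tA mUA; rewrite /ac_meas integral_bigcup //=; last first.
  by apply: (integrableS _ _ (@subsetT _ _)).
apply: is_cvg_ereal_nneg_natsum_cond => n _ _.
by apply: integral_ge0 => /= x ?; rewrite lee_fin pd_ge0.
Qed.

HB.instance Definition _ := isMeasure.Build _ _ _ (ac_meas d) ac0 ac_ge0 ac_sigma_additive.

Let ac_fin : fin_num_fun (ac_meas d).
Proof.
move=> A mA; apply: integrable_fin_num => //.
by apply: (integrableS measurableT) => //; exact: subsetT.
Qed.

HB.instance Definition _ := Measure_isFinite.Build _ _ _ (ac_meas d) ac_fin.

End Construction.

Section Integration.
Variable d : pdens.
Let f := pd_f d.
Let mf : measurable_fun setT f. Proof. exact: density_measurable (pd_density d). Qed.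
Let fi : mu.-integrable setT (EFin \o f). Proof. by have [] := pd_density d. Qed.

Lemma ac_dominates : ac_meas d `<< mu.
Proof.
apply/null_content_dominatesP => A mA A0; rewrite /ac_meas.
by apply: null_set_integral => //; apply: measurable_funTS; exact/measurable_EFinP.
Qed.

(** The Radon-Nikodym derivative of [ac_meas d] has the same integrals as [f] and so agrees with it
    almost everywhere; its change of variables formula passes to [f]. *)
Lemma ge0_integral_ac (g : T -> \bar R) : (forall x, 0 <= g x)%E ->
  measurable_fun setT g ->
  (\int[ac_meas d]_x g x = \int[mu]_x (g x * (f x)%:E))%E.
Proof.
move=> g0 mg; rewrite -(Radon_Nikodym_SigmaFinite.change_of_variables ac_dominates) //.
have hi := Radon_Nikodym_SigmaFinite.f_integrable ac_dominates.
apply: ae_eq_integral => //.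
- by apply: emeasurable_funM => //; exact: measurable_int hi.
- by apply: emeasurable_funM => //; exact/measurable_EFinP.
- apply: ae_eqe_mul2l; apply: integral_ae_eq => //.
  + exact/measurable_EFinP.
  + by move=> E _ mE; rewrite -(Radon_Nikodym_SigmaFinite.f_integral ac_dominates).
Qed.

Definition pd_total : {measure set T -> \bar R} :=
  measure_add (ac_meas d) (mscale (NngNum (pd_w0 d)) (\d_(pd_x d : T))).

Lemma pd_totalE A : pd_total A = (\int[mu]_(x in A) (f x)%:E + (pd_w d)%:E * \d_(pd_x d) A)%E.
Proof. exact: measure_addE. Qed.

Lemma ge0_integral_pd (h : R -> R) : (forall x, 0 <= h x) ->
  measurable_fun setT h -> mu.-integrable setT (fun x => (h x * f x)%:E) ->
  (\int[pd_total]_x (h x)%:E = ((\int[mu]_x (h x * f x))%R + pd_w d * h (pd_x d))%:E)%E.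
Proof.
move=> h0 mh hi; have mh' : measurable_fun setT (EFin \o h) by exact/measurable_EFinP.
rewrite /pd_total ge0_integral_measure_add // ?ge0_integral_mscale // ?integral_dirac //;
  try by move=> x _; rewrite lee_fin.
rewrite ge0_integral_ac //.
rewrite diracT mul1e EFinD EFinM; congr (_ + _)%E.
by rewrite /Rintegral fineK //; exact: integrable_fin_num hi.
Qed.

Lemma integral_pd (h : R -> R) : measurable_fun setT h ->
  mu.-integrable setT (fun x => (h x * f x)%:E) ->
  pd_total.-integrable setT (EFin \o h) /\
  (\int[pd_total]_x (h x)%:E = ((\int[mu]_x (h x * f x))%R + pd_w d * h (pd_x d))%:E)%E.
Proof.
move=> mh hi.
have int_le (k : R -> R) : measurable_fun setT k -> (forall x, `|k x| <= `|h x|) ->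
    mu.-integrable setT (fun x => (k x * f x)%:E).
  move=> mk kh; apply: (le_integrable measurableT _ _ hi).
    by apply/measurable_EFinP; exact: measurable_funM.
  by move=> x _; rewrite lee_fin !normrM ler_wpM2r.
have ge0_int (k : R -> R) : (forall x, 0 <= k x) -> measurable_fun setT k ->
    (forall x, `|k x| <= `|h x|) -> pd_total.-integrable setT (EFin \o k).
  move=> k0 mk kh; apply/integrableP; split; first exact/measurable_EFinP.
  under eq_integral do rewrite /= ger0_norm //.
  by rewrite ge0_integral_pd // ?ltry //; exact: int_le.
pose hp x := Num.max (h x) 0; pose hn x := Num.max (- h x) 0.
have mhp : measurable_fun setT hp by apply: measurable_maxr => //; exact: measurable_cst.
have mhn : measurable_fun setT hn.
  by apply: measurable_maxr; [exact: measurableT_comp|exact: measurable_cst].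
have p0 x : 0 <= hp x by rewrite le_max lexx orbT.
have n0 x : 0 <= hn x by rewrite le_max lexx orbT.
have hE x : h x = hp x - hn x.
  rewrite /hp /hn; have [h0|h0] := leP 0 (h x).
    by rewrite max_r ?oppr_le0 // subr0.
  by rewrite max_l ?oppr_ge0 ?ltW // sub0r opprK.
have pb x : `|hp x| <= `|h x|.
  by rewrite ger0_norm // /hp ge_max ler_norm normr_ge0.
have nb x : `|hn x| <= `|h x|.
  by rewrite ger0_norm // /hn ge_max -normrN ler_norm normr_ge0.
have ip := ge0_int hp p0 mhp pb; have im := ge0_int hn n0 mhn nb.
split.
  have -> : EFin \o h = ((EFin \o hp) \- (EFin \o hn))%E.
    by apply/funext => x /=; rewrite hE EFinB.
  exact: integrableB.
under eq_integral do rewrite hE.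
rewrite integralB_EFin // (ge0_integral_pd p0) ?(ge0_integral_pd n0) //; [|exact: int_le|exact: int_le].
rewrite -EFinB; congr (_%:E).
have -> : (\int[mu]_x (h x * f x))%R = (\int[mu]_x (hp x * f x))%R - (\int[mu]_x (hn x * f x))%R.
  rewrite -RintegralB //; [|exact: int_le|exact: int_le].
  by apply: eq_Rintegral => x _; rewrite {1}hE mulrBl.
by rewrite hE; ring.
Qed.

End Integration.

Section Probability.
Variable d : pdens.

Definition pd_meas (A : set T) : \bar R := pd_total d A.

Let pd0 : pd_meas set0 = 0%E. Proof. exact: measure0. Qed.
Let pd_ge0' A : (0 <= pd_meas A)%E. Proof. exact: measure_ge0. Qed.
Let pd_sa : semi_sigma_additive pd_meas. Proof. exact: measure_semi_sigma_additive. Qed.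
HB.instance Definition _ := isMeasure.Build _ _ _ pd_meas pd0 pd_ge0' pd_sa.
Let pdT : pd_meas setT = 1%E.
Proof.
rewrite /pd_meas pd_totalE diracT mule1 -[X in _ = X%:E](pd_mass d) EFinD.
congr (_ + _)%E; rewrite /Rintegral fineK //; apply: integrable_fin_num => //.
by have [] := pd_density d.
Qed.
HB.instance Definition _ := @Measure_isProbability.Build _ _ R pd_meas pdT.

Let idm : T -> R := id.
Let midm : measurable_fun setT idm.
Proof. by move=> _ A mA; rewrite setTI. Qed.
HB.instance Definition _ := isMeasurableFun.Build _ _ _ _ idm midm.

(* Pushing forward along the identity only changes the measurable structure of
   R from the one of [lebesgue_measure] to the one used by [probability R R]. *)
Definition pd_prob : probability R R := distribution pd_meas idm.

Lemma pd_probE A : pd_prob A =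
  (\int[mu]_(x in A) (pd_f d x)%:E + (pd_w d)%:E * \d_(pd_x d) A)%E.
Proof. exact: pd_totalE. Qed.

Lemma pd_prob_integral (h : R -> R) : measurable_fun setT h ->
  mu.-integrable setT (fun x => (h x * pd_f d x)%:E) ->
  pd_prob.-integrable setT (EFin \o h) /\
  (\int[pd_prob]_x (h x)%:E = ((\int[mu]_x (h x * pd_f d x))%R + pd_w d * h (pd_x d))%:E)%E.
Proof.
move=> mh hi; have [i1 i2] := integral_pd mh hi.
have mE : measurable_fun setT (EFin \o h) by exact/measurable_EFinP.
split.
  by apply: (integrable_pushforward midm mE) => //; rewrite preimage_setT; exact: i1.
rewrite -i2; have := integral_pushforward midm mE _ measurableT.
by rewrite preimage_setT; apply; exact: i1.
Qed.

End Probability.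
End DensityMeasure.

(** * Moment determinacy *)

Section Determinacy.
Variable R : realType.
Implicit Types P : probability R R.

Definition all_moments P := forall n : nat, P.-integrable setT (fun x : R => (x ^+ n)%:E).

Lemma prob_poly P (p : {poly R}) : all_moments P ->
  P.-integrable setT (fun x : R => (p.[x])%:E) /\
  (\int[P]_x (p.[x])%:E = (momf (moment P) p)%:E)%E.
Proof.
move=> hm.
have mon (c : R) n : P.-integrable setT (fun x : R => ((c *: 'X^n).[x])%:E) /\
    (\int[P]_x ((c *: 'X^n).[x])%:E = (momf (moment P) (c *: 'X^n))%:E)%E.
  have E x : ((c *: 'X^n).[x])%:E = (c%:E * (x ^+ n)%:E)%E :> \bar R by rewrite hornerZ hornerXn EFinM.
  split; first by under eq_fun do rewrite E; exact: integrableZl.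
  under eq_integral do rewrite E.
  rewrite integralZl // momfZ momfXn EFinM; congr (_ * _)%E.
  by rewrite /moment fineK //; exact: integrable_fin_num (hm n).
rewrite -(coefK p) poly_def; elim: (size p) => [|n [IH1 IH2]].
  rewrite big_ord0; split.
    by under eq_fun do rewrite horner0; exact: integrable0.
  by under eq_integral do rewrite horner0; rewrite integral0 momf0.
have [m1 m2] := mon p`_n n; rewrite big_ord_recr /=; set q := \sum_(_ < _) _ in IH1 IH2 *.
have E x : ((q + p`_n *: 'X^n).[x])%:E = ((q.[x])%:E + ((p`_n *: 'X^n).[x])%:E)%E :> \bar R.
  by rewrite hornerD EFinD.
split; first by under eq_fun do rewrite E; exact: integrableD.
under eq_integral do rewrite E.
by rewrite integralD // IH2 m2 momfD EFinD.
Qed.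

(** Markov's inequality for x^(2n) gives P(A) (2C)^(2n) <= C^(2n) for every n. *)
Lemma moment_tail P (C : R) : 0 < C -> all_moments P ->
  (forall n, moment P (2 * n)%N <= C ^+ (2 * n)) ->
  P [set x : R | 2 * C <= `|x|] = 0%E.
Proof.
move=> C0 hm hC; set A := [set x | _].
have mA : measurable A.
  rewrite /A (_ : [set x | _] = `]-oo, - (2 * C)]%classic `|` `[2 * C, +oo[%classic).
    by apply: measurableU; exact: measurable_itv.
  apply/seteqP; split => x /=; rewrite !in_itv /= andbT ler_normr lerNr.
    by move=> /orP[]; [right|left].
  by move=> [->|->]; rewrite ?orbT.
have fin : P A \is a fin_num by exact: fin_num_measure.
rewrite -(fineK fin); congr (_%:E); apply: (@geo_eq0 _ _ 1 (C ^+ 2) ((2 * C) ^+ 2)).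
  rewrite exprn_ge0 ?(ltW C0) //= ltrXn2r // ?nnegrE ?mulr_ge0 ?(ltW C0) //; lra.
move=> n; rewrite ger0_norm ?fine_ge0 // mul1r -!exprM -lee_fin.
have h := hC n; rewrite -lee_fin in h; apply: le_trans h.
have fm : (\int[P]_x (x ^+ (2 * n))%:E)%E \is a fin_num by exact: integrable_fin_num (hm _).
rewrite /moment fineK // EFinM fineK // muleC.
have <- : (\int[P]_x ((2 * C) ^+ (2 * n) * \1_A x)%:E = ((2 * C) ^+ (2 * n))%:E * P A)%E.
  under eq_integral do rewrite EFinM.
  rewrite ge0_integralZl //.
  - by rewrite integral_indic // setIT.
  - by apply/measurable_EFinP; exact: measurable_indic.
  - by rewrite lee_fin exprn_ge0 // mulr_ge0 // ltW.
apply: ge0_le_integral => //.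
- by move=> x _; rewrite lee_fin mulr_ge0 // exprn_ge0 // mulr_ge0 // ltW.
- by apply/measurable_EFinP/measurable_funM => //; exact: measurable_indic.
- by have /measurable_int := hm (2 * n)%N.
- move=> x _; rewrite lee_fin indicE; have [xA|xA] := boolP (x \in A).
    rewrite mulr1; move: xA; rewrite inE /A /= => xA.
    rewrite exprM [leRHS]exprM -[x ^+ 2]real_normK ?num_real //.
    by rewrite lerXn2r ?nnegrE ?sqr_ge0 // lerXn2r ?nnegrE // mulr_ge0 // ltW.
  by rewrite mulr0 exprM exprn_ge0 // sqr_ge0.
Qed.

(* (1 - s^n)^(n 2^n) tends to the indicator of s < 1/2 on [0, 1]. *)
Lemma threshold_lt (s : R) n : 0 <= s -> s ^+ n <= 1 ->
  1 - n%:R * (2 * s) ^+ n <= (1 - s ^+ n) ^+ (n * 2 ^ n).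
Proof.
move=> s0 s1; have bern N (y : R) : 0 <= y <= 1 -> 1 - N%:R * y <= (1 - y) ^+ N.
  move=> /andP[y0 y1]; elim: N => [|N IH]; first by rewrite mul0r subr0 expr0.
  rewrite exprSr; apply: (@le_trans _ _ ((1 - N%:R * y) * (1 - y))); last first.
    by rewrite ler_wpM2r // subr_ge0.
  rewrite -natr1 -subr_ge0 (_ : _ - _ = N%:R * y ^+ 2); last by ring.
  by rewrite mulr_ge0 // sqr_ge0.
have := bern (n * 2 ^ n)%N (s ^+ n); rewrite s1 exprn_ge0 // natrM natrX exprMn mulrA.
by apply.
Qed.

(** Bernoulli's inequality for (1 + y)^N, transferred by (1 - y)^N (1 + y)^N <= 1, with y = s^n and
    N = n 2^n. *)
Lemma threshold_ge (s : R) n : 0 <= s -> s ^+ n <= 1 ->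
  0 <= (1 - s ^+ n) ^+ (n * 2 ^ n) <= (1 + n%:R * (2 * s) ^+ n)^-1.
Proof.
move=> s0 s1; have y0 : 0 <= s ^+ n by rewrite exprn_ge0.
rewrite exprn_ge0 ?subr_ge0 //=.
have bern N (y : R) : 0 <= y -> 1 + N%:R * y <= (1 + y) ^+ N.
  move=> y0'; elim: N => [|N IH]; first by rewrite mul0r addr0 expr0.
  rewrite exprSr; apply: (@le_trans _ _ ((1 + N%:R * y) * (1 + y))); last first.
    by rewrite ler_wpM2r // addr_ge0.
  rewrite -natr1 -subr_ge0 (_ : _ - _ = N%:R * y ^+ 2); last by ring.
  by rewrite mulr_ge0 // sqr_ge0.
have h := bern (n * 2 ^ n)%N _ y0; rewrite natrM natrX -mulrA -exprMn in h.
have p0 : 0 < 1 + n%:R * (2 * s) ^+ n.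
  by rewrite ltr_pwDl // mulr_ge0 // exprn_ge0 // mulr_ge0.
rewrite -(ler_pM2r p0) mulVf ?gt_eqF //.
apply: (@le_trans _ _ ((1 - s ^+ n) ^+ (n * 2 ^ n) * (1 + s ^+ n) ^+ (n * 2 ^ n))).
  by rewrite ler_wpM2l // exprn_ge0 // subr_ge0.
rewrite -exprMn -subr_sqr expr1n; apply: exprn_ile1.
  by rewrite subr_ge0; exact: exprn_ile1.
by rewrite lerBlDr lerDl sqr_ge0.
Qed.

Lemma n_geo_cvg0 (q : R) : 0 <= q < 1 -> (fun n => n%:R * q ^+ n) @ \oo --> (0 : R).
Proof.
(* Half of the decay absorbs the factor n: n r^n <= 1 / (1 - r), hence n q^n <= r^n / (1 - r). *)
move=> /andP[q0 q1]; pose r := Num.sqrt q.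
have r0 : 0 <= r by rewrite sqrtr_ge0.
have r2 : r ^+ 2 = q by rewrite sqr_sqrtr.
have r1 : r < 1 by rewrite -(@ltr_pXn2r _ 2) ?nnegrE // r2 expr1n.
have bnd n : n%:R * r ^+ n <= (1 - r)^-1.
  have d0 : 0 < 1 - r by rewrite subr_gt0.
  rewrite -(ler_pM2r d0) mulVf ?gt_eqF //.
  suff : n%:R * r ^+ n * (1 - r) <= 1 - r ^+ n by move=> /le_trans; apply; rewrite lerBlDr lerDl exprn_ge0.
  elim: n => [|n IH]; first by rewrite !mul0r expr0 subrr.
  have p0 : 0 <= r ^+ n by rewrite exprn_ge0.
  rewrite -natr1 exprSr mulrDl mul1r mulrDl.
  have -> : n%:R * (r ^+ n * r) * (1 - r) = n%:R * r ^+ n * (1 - r) * r by ring.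
  have : n%:R * r ^+ n * (1 - r) * r <= (1 - r ^+ n) * r by rewrite ler_wpM2r.
  have h : 0 <= (1 - r) * (1 - r ^+ n * r).
    by rewrite mulr_ge0 ?(ltW d0) // subr_ge0 -exprSr exprn_ile1 // ltW.
  by move: h; set y := n%:R * _ * _ * _; nra.
apply: (@squeeze_cvgr _ _ _ _ (fun=> 0) (fun n => (1 - r)^-1 * r ^+ n)).
- apply: nearW => n; rewrite mulr_ge0 ?exprn_ge0 //= -r2 -exprM mulnC exprM expr2 mulrA.
  by rewrite ler_wpM2r ?exprn_ge0.
- exact: cvg_cst.
- rewrite -[X in _ --> X](mulr0 (1 - r)^-1); apply: cvgM; first exact: cvg_cst.
  by apply: cvg_expr; rewrite ger0_norm.
Qed.

Lemma threshold_cvg (s : R) : 0 <= s <= 1 ->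
  (fun n => (1 - s ^+ n) ^+ (n * 2 ^ n)) @ \oo --> (((s < 2^-1)%R)%:R : R).
Proof.
move=> /andP[s0 s1]; have s1n n : s ^+ n <= 1 by exact: exprn_ile1.
have [h|h] := ltP s 2^-1.
  have q1 : 0 <= 2 * s < 1 by apply/andP; split; lra.
  apply: (@squeeze_cvgr _ _ _ _ (fun n => 1 - n%:R * (2 * s) ^+ n) (fun=> 1)).
  - apply: nearW => n; rewrite threshold_lt //=.
    by apply: exprn_ile1; rewrite ?subr_ge0 // lerBlDr lerDl exprn_ge0.
  - rewrite -[X in _ --> X]subr0; apply: cvgB; first exact: cvg_cst.
    exact: n_geo_cvg0.
  - exact: cvg_cst.
have q1 : 1 <= 2 * s by lra.
apply: (@squeeze_cvgr _ _ _ _ (fun=> 0) (fun n => n.+1%:R^-1)).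
- apply: nearW => n; have /andP[-> /le_trans] := threshold_ge s0 (s1n n).
  have h1 : 0 < n.+1%:R :> R by rewrite ltr0n.
  have le : n.+1%:R <= 1 + n%:R * (2 * s) ^+ n.
    by rewrite mulrS lerD2l ler_peMr // exprn_ege1.
  by apply; rewrite lef_pV2 ?posrE // (lt_le_trans h1).
- exact: cvg_cst.
- exact: cvg_harmonic.
Qed.

Section Threshold.
Variables (C x0 : R).
Hypothesis C0 : 0 < C.
(** [K] bounds |x - x0| for |x| < 2C, so the affine map [sp] sends this region into [0, 1] and x0 to
    1/2. *)
Let K : R := 2 * C + `|x0| + 1.
Let K0 : 0 < K. Proof. by rewrite /K; have := normr_ge0 x0; move: C0; lra. Qed.
Let sp : {poly R} := (2 * K)^-1%:P * ('X - x0%:P) + (2^-1)%:P.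
Definition threshold_poly n : {poly R} := (1 - sp ^+ n) ^+ (n * 2 ^ n).

Let spE x : sp.[x] = (x - x0) / (2 * K) + 2^-1.
Proof. by rewrite /sp !hornerE mulrC. Qed.

Let sp01 x : `|x| < 2 * C -> 0 <= sp.[x] <= 1.
Proof.
move=> h; have hx : `|x - x0| <= K.
  by rewrite (le_trans (ler_normB _ _)) // /K -addrA lerD // ?ltW // ltrDl.
rewrite spE; have K20 : 0 < 2 * K by rewrite mulr_gt0.
have : `|(x - x0) / (2 * K)| <= 2^-1.
  rewrite normrM normfV (gtr0_norm K20) ler_pdivrMr // mulrA mulVf ?pnatr_eq0 // mul1r; exact: hx.
by rewrite ler_norml => /andP[h1 h2]; apply/andP; split; lra.
Qed.

Lemma threshold_polyE n x : (threshold_poly n).[x] = (1 - sp.[x] ^+ n) ^+ (n * 2 ^ n).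
Proof. by rewrite /threshold_poly !(horner_exp, hornerE). Qed.

(** Off the null tail the polynomials are bounded by 1 and tend to the indicator of the ray, so
    dominated convergence applies. This makes the probability of a ray a function of the moments. *)
Lemma threshold_poly_cvg P : all_moments P ->
  P [set x : R | 2 * C <= `|x|] = 0%E ->
  (fun n => \int[P]_x ((threshold_poly n).[x])%:E)%E @ \oo --> P `]-oo, x0[%classic.
Proof.
move=> hm tail.
have aeP (Q : R -> Prop) : (forall x, `|x| < 2 * C -> Q x) -> {ae P, forall x, Q x}.
  move=> h; exists [set x : R | 2 * C <= `|x|]; split => //.
    rewrite (_ : [set x | _] = `]-oo, - (2 * C)]%classic `|` `[2 * C, +oo[%classic).
      by apply: measurableU; exact: measurable_itv.
    apply/seteqP; split => x /=; rewrite !in_itv /= andbT ler_normr lerNr.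
      by move=> /orP[]; [right|left].
    by move=> [->|->]; rewrite ?orbT.
  by move=> x /= nQ; rewrite leNgt; apply/negP => /h.
have mI : measurable (`]-oo, x0[%classic : set R) by exact: measurable_itv.
have <- : (\int[P]_x (\1_(`]-oo, x0[%classic : set R) x : R)%:E = P `]-oo, x0[%classic)%E.
  by rewrite integral_indic // setIT.
have mf n : measurable_fun setT (fun x : R => ((threshold_poly n).[x])%:E).
  by apply/measurable_EFinP; exact: measurable_horner.
have mi : measurable_fun setT (fun x : R => (\1_(`]-oo, x0[%classic : set R) x : R)%:E).
  by apply/measurable_EFinP; exact: measurable_indic.
have cv : {ae P, forall x : R, setT x -> (fun n => ((threshold_poly n).[x])%:E) @ \oo -->
    (\1_(`]-oo, x0[%classic : set R) x : R)%:E}.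
  apply: aeP => x hx _; apply: cvg_EFin; first exact: nearW.
  under eq_fun do rewrite /= threshold_polyE.
  rewrite indicE (_ : (x \in _) = (sp.[x] < 2^-1)%R); first exact: threshold_cvg (sp01 hx).
  rewrite spE -[ltRHS]add0r ltrD2r pmulr_llt0 ?invr_gt0 ?mulr_gt0 // subr_lt0.
  by apply/idP/idP; rewrite inE /= in_itv.
have i1 : P.-integrable setT (cst 1%E : R -> \bar R).
  by have := hm 0%N; under eq_fun do rewrite expr0.
have bd : {ae P, forall (x : R) n, setT x -> (`|((threshold_poly n).[x])%:E| <= cst 1 x)%E}.
  apply: aeP => x hx n _; rewrite /= lee_fin threshold_polyE.
  have /andP[s0 s1] := sp01 hx.
  have h0 : 0 <= 1 - sp.[x] ^+ n by rewrite subr_ge0 exprn_ile1.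
  rewrite ger0_norm ?exprn_ge0 // exprn_ile1 //.
  by rewrite lerBlDr lerDl exprn_ge0.
by have [_ _] := dominated_convergence measurableT mf mi cv i1 bd.
Qed.

End Threshold.

Theorem moment_determinacy P P' (C : R) : 0 < C ->
  all_moments P -> all_moments P' -> moment P =1 moment P' ->
  (forall n, moment P (2 * n)%N <= C ^+ (2 * n)) ->
  forall A, measurable A -> P A = P' A.
Proof.
move=> C0 hP hP' e bd; have bd' n : moment P' (2 * n)%N <= C ^+ (2 * n) by rewrite -e.
have tl := moment_tail C0 hP bd; have tl' := moment_tail C0 hP' bd'.
have ray x : P `]-oo, x[%classic = P' `]-oo, x[%classic.
  have h := threshold_poly_cvg (x0 := x) C0 hP tl.
  have h' := threshold_poly_cvg (x0 := x) C0 hP' tl'.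
  apply: (cvg_unique _ h) => //; apply: cvg_trans h'.
  apply: near_eq_cvg; apply: nearW => n.
  rewrite (prob_poly _ hP).2 (prob_poly _ hP').2; congr (_%:E).
  by rewrite /momf; apply: eq_bigr => i _; rewrite e.
move=> A mA.
apply: (@measure_unique _ R R [set B | exists x : R, B = `]-oo, x[%classic]
  (fun n => `]-oo, n%:R[%classic)) => //.
- exact: RGenInftyO.measurableE.
- move=> _ _ [x ->] [y ->]; exists (Num.min x y).
  apply/seteqP; split => z /=; rewrite !in_itv /= lt_min; first by move=> [-> ->].
  by move=> /andP[-> ->].
- by move=> n; exists n%:R.
- apply/seteqP; split => // x _; exists (Num.truncn `|x|).+1 => //=.
  by rewrite in_itv /= (le_lt_trans (ler_norm _)) // truncnS_gt.
- by move=> _ [x ->]; exact: ray.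
- by move=> n; rewrite (le_lt_trans (probability_le1 _ _)) ?ltry //; exact: measurable_itv.
Qed.

End Determinacy.

(** * The listed systems *)

Section ListedSystems.
Variable R : realType.
Notation mu := (@lebesgue_measure R).

Lemma cauchy_serE (P : probability R R) : cauchy_ser P = cauchyf (moment P).
Proof. by apply/funext => -[|n]; rewrite /cauchyf sXM. Qed.

Lemma measurable_exp n : measurable_fun setT (fun x : R => x ^+ n).
Proof.
rewrite (_ : (fun x => _) = horner ('X^n)); first exact: measurable_horner.
by apply/funext => x; rewrite hornerXn.
Qed.

Lemma pd_prob_moments (d : pdens R) : all_moments (pd_prob d) /\
  forall n, moment (pd_prob d) n = dmom (pd_f d) n + pd_w d * pd_x d ^+ n.
Proof.
have h n : (pd_prob d).-integrable setT (EFin \o (fun x : R => x ^+ n)) /\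
  (\int[pd_prob d]_x (x ^+ n)%:E = (dmom (pd_f d) n + pd_w d * pd_x d ^+ n)%:E)%E.
  apply: pd_prob_integral; first exact: measurable_exp.
  by have [+ _] := density_poly 'X^n (pd_density d); under eq_fun do rewrite /= hornerXn.
by split=> n; [exact: (h n).1|rewrite /moment (h n).2].
Qed.

Lemma moment0 (P : probability R R) : moment P 0 = 1.
Proof.
rewrite /moment; under eq_integral do rewrite expr0.
by rewrite integral_cst // mul1e; exact: (congr1 fine (probability_setT P)).
Qed.

Lemma dirac_moments : all_moments (\d_(0 : R) : probability R R) /\
  forall n, moment (\d_(0 : R) : probability R R) n = 0 ^+ n.
Proof.
have mX n : measurable_fun setT (fun x : R => (x ^+ n)%:E).
  by apply/measurable_EFinP; exact: measurable_exp.
split=> n; last by rewrite /moment integral_dirac // diracT mul1e.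
apply/integrableP; split=> //; rewrite integral_dirac //; last exact: measurableT_comp.
by rewrite diracT mul1e ltry.
Qed.

(** At t = 0 the measure is the Dirac mass at 0, for which orthogonality to constants is this
    vanishing. *)
Lemma meixP_at0 (m k c d : R) n : (meixP m k c d n.+1 0).[0] = 0.
Proof.
rewrite /meixP; elim/jacP_ind2: n => [||n I0 I1].
- by rewrite jacP1 hornerXsubC /= mulr0 subrr.
- by rewrite jacPSS jacP1 jacP0 /= !hornerE /=; ring.
- by rewrite jacPSS hornerD hornerN !hornerM I0 I1 !mulr0 subrr.
Qed.

Lemma listed_massE (c : mcase R) t : case_ok c -> 0 < t ->
  (\int[mu]_x listed_dens c t x)%R + listed_atom_w c t = 1.
Proof.
move=> ok t0; have [_ _ _ + _] := listed_specP ok t0.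
rewrite momf1 /listed_mom expr0 mulr1 /dmom.
by under eq_Rintegral do rewrite expr0 mul1r.
Qed.

Definition listed_pdens (c : mcase R) t (ok : case_ok c) (t0 : 0 < t) : pdens R :=
  @PDens R (listed_dens c t) (listed_atom_w c t) (listed_atom_p c t)
    (lspec_density (listed_specP ok t0)) (lspec_ge0 (listed_specP ok t0))
    (lspec_w (listed_specP ok t0)) (listed_massE ok t0).

(** The Dirac mass is the prescribed value at t = 0 and a default for t < 0. *)
Definition listed_prob (c : mcase R) (ok : case_ok c) t : probability R R :=
  match pselect (0 < t) with
  | left t0 => pd_prob (listed_pdens ok t0)
  | right _ => \d_(0 : R)
  end.

Lemma listed_probE (c : mcase R) (ok : case_ok c) t (A : set R) : 0 < t ->
  listed_prob ok t A = listedMu c t A.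
Proof. by rewrite /listed_prob; case: pselect => // t0 _; exact: pd_probE. Qed.

Lemma listed_prob_moments (c : mcase R) (ok : case_ok c) t : all_moments (listed_prob ok t).
Proof.
by rewrite /listed_prob; case: pselect => h; [exact: (pd_prob_moments _).1|exact: dirac_moments.1].
Qed.

Lemma listed_prob_orth (c : mcase R) (ok : case_ok c) t n : 0 <= t ->
  momf (moment (listed_prob ok t)) (listedP c n.+1 t) = 0.
Proof.
rewrite /listed_prob; case: pselect => [t0 _|h t0].
  rewrite (_ : moment _ = listed_mom c t); first exact: (lspec_orth (listed_specP ok t0)).
  by apply/funext => k; rewrite (pd_prob_moments _).2.
have -> : t = 0 by apply/eqP; rewrite eq_le t0 andbT leNgt; apply/negP.
rewrite (_ : moment _ = fun n => 1 * 0 ^+ n).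
  by rewrite momf_atom mul1r listedPE meixP_at0.
by apply/funext => k; rewrite dirac_moments.2 mul1r.
Qed.

(** Makes non-triviality at t = 1 the condition that k is nonzero, in both directions of the
    theorem. *)
Lemma meixP_var (m' : nat -> R) (m k c d t : R) : m' 0%N = 1 ->
  momf m' (meixP m k c d 1 t) = 0 -> momf m' (meixP m k c d 2 t) = 0 ->
  m' 2%N - m' 1%N ^+ 2 = k * t.
Proof.
move=> h0; rewrite /meixP jacPSS jacP1 jacP0 /= momfB momfX momfC h0 mulr1.
move=> /eqP; rewrite subr_eq0 => /eqP e1.
have -> : ('X - (m * t + c)%:P) * ('X - (m * t)%:P) - (k * t)%:P =
  'X^2 - (2 * (m * t) + c)%:P * 'X + ((m * t + c) * (m * t) - k * t)%:P :> {poly R}.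
  by apply: poly_fun_inj => x; rewrite !hornerE /=; ring.
rewrite momfD momfB momfCM momfXn momfX momfC h0 e1 => e2.
by rewrite -[RHS]addr0 -e2; ring.
Qed.

Lemma OPS_of_momf (P : probability R R) (al om : nat -> R) : all_moments P ->
  (forall n, momf (moment P) (jacP al om n.+1) = 0) -> monic_OPS P (jacP al om).
Proof.
move=> hP h; split=> [n|n k nk]; first exact: jacP_monic.
under eq_integral do rewrite -hornerM.
by rewrite (prob_poly _ hP).2 jacP_orth.
Qed.

Lemma listed_system (c : mcase R) (ok : case_ok c) :
  [/\ free_semigroup (listed_prob ok) (listed_R c), nontrivial (listed_prob ok) &
    forall t, 0 <= t -> monic_OPS (listed_prob ok t) (fun n => listedP c n t)].
Proof.
have [pu _] := listed_uE c.
split.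
- split=> [t _ n|A mA|t t0]; first exact: listed_prob_moments.
    by rewrite /listed_prob; case: pselect => // h; have := h; rewrite ltxx.
  rewrite /is_Rtransform cauchy_serE.
  apply: (Rtransform_of_sheffer (P := fun n => listedP c n t) pu).
  + by move=> n x; rewrite sheffer_den_diag // -listed_genser.
  + by rewrite listedPE momf1 moment0.
  + by move=> n; exact: listed_prob_orth.
- have orth n := listed_prob_orth ok n (ler01 : 0 <= 1 :> R).
  rewrite /nontrivial (@meixP_var _ (mcase_par c).1.1 1 (mcase_par c).1.2 (mcase_par c).2 1).
  + by rewrite mulr1 oner_neq0.
  + exact: moment0.
  + by have := orth 0%N; rewrite listedPE.
  + by have := orth 1%N; rewrite listedPE.
- move=> t t0; have -> : (fun n => listedP c n t) =
      fun n => meixP (mcase_par c).1.1 1 (mcase_par c).1.2 (mcase_par c).2 n t.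
    by apply/funext => n; rewrite listedPE.
  apply: OPS_of_momf; first exact: listed_prob_moments.
  by move=> n; have := listed_prob_orth ok n t0; rewrite listedPE.
Qed.

End ListedSystems.

(** * The converse *)

Section MonicOrthogonal.
Variable R : realType.
Variables (m : nat -> R) (p : nat -> {poly R}).
Hypothesis p_monic : forall n, p n \is monic /\ size (p n) = n.+1.
Hypothesis p_orth : forall n k, n <> k -> momf m (p n * p k) = 0.
Let h n := momf m (p n * p n).

Lemma monic_reduce N (q : {poly R}) : (size q <= N.+1)%N ->
  (size (q - q`_N *: p N)%R <= N)%N.
Proof.
move=> sq; have [pm ps] := p_monic N.
apply/leq_sizeP => j; rewrite leq_eqVlt coefB coefZ => /orP[/eqP <-|Nj].
  by have := monicP pm; rewrite lead_coefE ps /= => ->; rewrite mulr1 subrr.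
by rewrite [q`_j]nth_default ?(leq_trans sq) // [(p N)`_j]nth_default ?ps // mulr0 subr0.
Qed.

Lemma momf_low N n (q : {poly R}) : (size q <= N)%N -> (N <= n)%N ->
  momf m (p n * q) = 0.
Proof.
elim: N q => [|N IH] q sq Nn.
  by move: sq; rewrite leqn0 size_poly_eq0 => /eqP ->; rewrite mulr0 momf0.
have := IH _ (monic_reduce sq) (ltnW Nn).
by rewrite mulrBr momfB -scalerAr momfZ p_orth ?mulr0 ?subr0 // => e; rewrite e ltnn in Nn.
Qed.

(** Pairing with the top [p N] isolates the leading coefficient of [q] times the norm [h N]; descend
    on the degree. *)
Lemma momf_low_eq0 N (q : {poly R}) : (size q <= N)%N ->
  (forall i, (i < N)%N -> momf m (q * p i) = 0) ->
  (forall i, (i < N)%N -> h i != 0) -> q = 0.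
Proof.
elim: N q => [|N IH] q sq qp hn.
  by move: sq; rewrite leqn0 size_poly_eq0 => /eqP.
suff q0 : q`_N = 0.
  apply: IH => [|i iN|i iN]; [|by apply: qp; exact: ltnW|by apply: hn; exact: ltnW].
  by have := monic_reduce sq; rewrite q0 scale0r subr0.
have := momf_low (monic_reduce sq) (leqnn N).
rewrite mulrBr momfB -scalerAr momfZ mulrC qp // sub0r => /eqP.
by rewrite oppr_eq0 mulf_eq0 (negbTE (hn _ _)) // orbF => /eqP.
Qed.

(** L(x p_n p_(n+1)) is [h n.+1] by comparing leading terms and [b * h n] by the recurrence. *)
Lemma norm_rec n (a b : R) : p n.+2 = ('X - a%:P) * p n.+1 - b%:P * p n ->
  h n.+1 = b * h n.
Proof.
move=> e; have [pm ps] := p_monic n; have [pm' ps'] := p_monic n.+1.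
have low : (size ('X * p n - p n.+1)%R <= n.+1)%N.
  have -> : 'X * p n - p n.+1 = 'X * p n - ('X * p n)`_n.+1 *: p n.+1.
    rewrite coefXM /=; have := monicP pm; rewrite lead_coefE ps /= => ->.
    by rewrite scale1r.
  by apply: monic_reduce; rewrite (leq_trans (size_polyMleq _ _)) // size_polyX ps.
have := momf_low low (leqnn _).
have E : p n.+1 * ('X * p n - p n.+1) =
  p n.+2 * p n + a%:P * (p n.+1 * p n) + b%:P * (p n * p n) - p n.+1 * p n.+1.
  by rewrite e; ring.
have o1 : momf m (p n.+1 * p n) = 0 by apply: p_orth; apply/eqP; rewrite gtn_eqF.
have o2 : momf m (p n.+2 * p n) = 0 by apply: p_orth; apply/eqP; rewrite gtn_eqF.
rewrite E momfB 2!momfD 2!momfCM o1 o2 mulr0 !add0r => /eqP.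
by rewrite subr_eq0 => /eqP.
Qed.

End MonicOrthogonal.

(** * From a diagonal Sheffer system to a three-term recurrence *)

Section ShefferRecursion.
Variable R : realType.
Local Notation X := (sX R : fps R).
Local Notation "c %:S" := (sconst c : fps R) (at level 2, format "c %:S").
Variables u B : fps R.
Hypothesis u0 : u 0%N = 0.
Hypothesis u1 : u 1%N = 1.
Hypothesis B0 : B 0%N = 0.

(** For i >= 1, minus the coefficient of z^i in 1 + t B - x u, as a polynomial in x. *)
Definition pencil_coef (t : R) i : {poly R} := (u i)%:P * 'X - (t * B i)%:P.

Lemma pencil_inv_rec (t : R) (p : nat -> {poly R}) :
  (forall x, (fun n => (p n).[x]) = sinv (1 + t%:S * B - x%:S * u) :> fps R) ->
  p 0%N = 1 /\
  forall n, p n.+1 = \sum_(k < n.+1) pencil_coef t (n.+1 - k) * p k.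
Proof.
move=> hp; set D := fun x => 1 + t%:S * B - x%:S * u.
have D0 x : D x 0%N = 1.
  by rewrite /D fpsB fpsD !sconstM u0 B0 !mulr0 fps1 addr0 subr0.
have hp' n x : (p n).[x] = sinv (D x) n by rewrite -[RHS](congr1 (fun f => f n) (hp x)).
split=> [|n]; apply: poly_fun_inj => x.
  by rewrite hp' sinv0 D0 invr1 hornerE.
rewrite hp' sinvS D0 invr1 mulN1r horner_sum -sumrN; apply: eq_bigr => k _.
rewrite hornerM -hp' -mulNr; congr (_ * _).
rewrite /D fpsB fpsD !sconstM fps1 /pencil_coef !hornerE.
by case: (n.+1 - k)%N (subn_gt0 k n.+1) => [|i _]; [rewrite ltn_ord|rewrite /=; ring].
Qed.

Section FixedTime.
Variables (t : R) (p : nat -> {poly R}) (m : nat -> R).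
Hypothesis p0 : p 0%N = 1.
Hypothesis prec : forall n, p n.+1 = \sum_(k < n.+1) pencil_coef t (n.+1 - k) * p k.
Hypothesis p_monic : forall n, p n \is monic /\ size (p n) = n.+1.
Hypothesis p_orth : forall n k, n <> k -> momf m (p n * p k) = 0.
Hypothesis m0 : m 0%N = 1.

Let h n := momf m (p n * p n).
(** The constants come from z / u = 1 - u_2 z + d z^2 + ... and z B / u = B_1 z + ka z^2 + ..., the
    candidates for N and N B. *)
Let al := t * B 1%N - u 2%N.
Let ka := B 2%N - u 2%N * B 1%N.
Let d := u 2%N ^+ 2 - u 3%N.
(** The contribution of p_0, ..., p_(j-1) to the recursion for p_(j+s). *)
Let tail s j := \sum_(k < j) pencil_coef t (s + (j - k)) * p k.

Let pE n : p n.+1 = tail 0 n.+1. Proof. exact: prec. Qed.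

Let tailS s j : tail s j.+1 = pencil_coef t s.+1 * p j + tail s.+1 j.
Proof.
rewrite /tail big_ord_recr /= subSnn addn1 addrC; congr (_ + _).
by apply: eq_bigr => k _; rewrite subSn ?addnS // ltnW.
Qed.

Let size_tail s j : (size (tail s j) <= j.+1)%N.
Proof.
apply: (leq_trans (size_sum _ _ _)); apply/bigmax_leqP => k _.
apply: (leq_trans (size_polyMleq _ _)); rewrite (p_monic k).2 addnS /=.
apply: (@leq_trans (2 + k)); last by rewrite add2n ltnS.
rewrite leq_add2r (leq_trans (size_polyD _ _)) // geq_max size_polyN.
rewrite (leq_trans (size_polyC_leq1 _)) // andbT.
by rewrite mul_polyC (leq_trans (size_scale_leq _ _)) // size_polyX.
Qed.

Lemma sheffer_p1 : p 1%N = 'X - (t * B 1%N)%:P.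
Proof. by rewrite prec big_ord1 p0 mulr1 /pencil_coef u1 mul1r. Qed.

Lemma sheffer_p2 : p 2%N = ('X - al%:P) * p 1%N - (ka * t)%:P * p 0%N.
Proof.
rewrite {1}prec !big_ord_recl big_ord0 /= p0 sheffer_p1 /pencil_coef u1 /al /ka.
apply: poly_fun_inj => x; rewrite /bump /= !hornerE /=; ring.
Qed.

Let defect j := p j.+3 - ('X - al%:P) * p j.+2 + (ka * t + d)%:P * p j.+1.

(** Unfolding p_(j+3), p_(j+2) and p_(j+1) in turn, the choice of [al], [ka] and [d] cancels the
    multiples of x in front of p_(j+2), p_(j+1) and p_j; what remains has degree at most j. *)
Let defectE j : defect j =
  (- (t * (B 3%N - u 2%N * B 2%N + d * B 1%N)))%:P * p j +
  d%:P * tail 1 j - (u 2%N)%:P * tail 2 j + tail 3 j.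
Proof.
have e1 : p j.+1 = pencil_coef t 1 * p j + tail 1 j.
  by rewrite pE tailS.
have e2 : p j.+2 = pencil_coef t 1 * p j.+1 + (pencil_coef t 2 * p j + tail 2 j).
  by rewrite {1}pE !tailS.
have e3 : p j.+3 = pencil_coef t 1 * p j.+2 +
    (pencil_coef t 2 * p j.+1 + (pencil_coef t 3 * p j + tail 3 j)).
  by rewrite {1}pE !tailS.
rewrite /defect e3 e2 e1 /pencil_coef u1 /al /ka /d.
apply: poly_fun_inj => x; rewrite !hornerE /=; ring.
Qed.

Let size_defect j : (size (defect j) <= j.+1)%N.
Proof.
have sC (c : R) (q : {poly R}) : (size q <= j.+1)%N -> (size (c%:P * q)%R <= j.+1)%N.
  by move=> sq; rewrite mul_polyC (leq_trans (size_scale_leq _ _)).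
have sD (q r : {poly R}) : (size q <= j.+1)%N -> (size r <= j.+1)%N -> (size (q + r)%R <= j.+1)%N.
  by move=> sq sr; rewrite (leq_trans (size_polyD _ _)) // geq_max sq.
rewrite defectE.
apply: (sD _ _ (sD _ _ (sD _ _ (sC _ _ _) (sC _ _ (size_tail _ _))) _) (size_tail _ _)).
  by rewrite (p_monic j).2.
by rewrite size_polyN sC.
Qed.

(* The defect of the three-term recurrence has degree at most j, but is
   orthogonal to all polynomials of degree at most j. *)
Lemma sheffer_rec j : (forall i, (i <= j)%N -> h i != 0) ->
  p j.+3 = ('X - al%:P) * p j.+2 - (ka * t + d)%:P * p j.+1.
Proof.
move=> hn; suff : defect j = 0.
  by move=> e; apply/eqP; rewrite -subr_eq0 -e /defect; apply/eqP; ring.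
apply: (momf_low_eq0 p_monic p_orth (N := j.+1)) => // i ij.
have E : defect j * p i = p j.+3 * p i - p j.+2 * (('X - al%:P) * p i) +
    (ka * t + d)%:P * (p j.+1 * p i) by rewrite /defect; ring.
have ne k : (j < k)%N -> momf m (p k * p i) = 0.
  by move=> jk; apply: p_orth => e; move: ij; rewrite -e ltnS leqNgt jk.
rewrite E momfD momfB momfCM !ne //; last by rewrite ltnW.
rewrite (momf_low p_monic p_orth (N := j.+2)) ?subr0 ?mulr0 ?addr0 //.
rewrite (leq_trans (size_polyMleq _ _)) // size_XsubC (p_monic i).2.
by rewrite add2n.
Qed.

Lemma sheffer_h0 : h 0%N = 1.
Proof. by rewrite /h p0 mulr1 momf1. Qed.

Lemma sheffer_h1 : h 1%N = ka * t.
Proof. by rewrite /h (norm_rec p_monic p_orth sheffer_p2) -/(h 0%N) sheffer_h0 mulr1. Qed.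

(** The recurrence for p_3 uses only [h 0 = 1], so this holds even at times where later norms
    vanish. *)
Lemma sheffer_h2 : h 2%N = (ka * t + d) * (ka * t).
Proof.
have e : p 3%N = ('X - al%:P) * p 2%N - (ka * t + d)%:P * p 1%N.
  by apply: sheffer_rec => -[|//] _; rewrite sheffer_h0 oner_neq0.
by rewrite /h (norm_rec p_monic p_orth e) -/(h 1%N) sheffer_h1.
Qed.

(** Recurrence and norms advance together: nonzero norms up to n give the recurrence for p_(n+3),
    and with it the norm of p_(n+2). *)
Lemma sheffer_meixP_at : ka * t != 0 -> ka * t + d != 0 ->
  forall n, p n = meixP (B 1%N) ka (- u 2%N) d n t.
Proof.
move=> k0 b0.
have hn n : forall i, (i <= n)%N -> h i != 0.
  elim: n => [|n IH] i; first by case: i => // _; rewrite sheffer_h0 oner_neq0.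
  rewrite leq_eqVlt => /orP[/eqP ->|]; last by rewrite ltnS; exact: IH.
  case: n => [|n] in IH *; first by rewrite sheffer_h1.
  have e := sheffer_rec (fun i (il : (i <= n)%N) => IH i (leqW il)).
  by rewrite /h (norm_rec p_monic p_orth e) mulf_neq0 // IH.
apply: jacP_uniq => [//||[|n] /=].
- by rewrite sheffer_p1 /= [B 1%N * t]mulrC.
- by rewrite sheffer_p2 /al [B 1%N * t]mulrC.
- by rewrite (sheffer_rec (hn n)) /al [B 1%N * t]mulrC.
Qed.

End FixedTime.

Lemma sheffer_meixP (P : nat -> R -> {poly R}) (M : R -> nat -> R) :
  (forall t, 0 <= t -> forall x,
     (fun n => (P n t).[x]) = sinv (1 + t%:S * B - x%:S * u) :> fps R) ->
  (forall t, 0 <= t -> M t 0%N = 1) ->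
  (forall t, 0 <= t -> forall n, P n t \is monic /\ size (P n t) = n.+1) ->
  (forall t, 0 <= t -> forall n k, n <> k -> momf (M t) (P n t * P k t) = 0) ->
  (forall t, 0 <= t -> forall q, 0 <= momf (M t) (q * q)) ->
  M 1 2%N - M 1 1%N ^+ 2 != 0 ->
  exists m k c d : R, [/\ 0 < k, 0 <= d &
    forall t, 0 <= t -> forall n, P n t = meixP m k c d n t].
Proof.
move=> hP M0 hm ho hpos var.
pose k := B 2%N - u 2%N * B 1%N; pose d := u 2%N ^+ 2 - u 3%N.
have rec t (t0 : 0 <= t) := pencil_inv_rec (hP t t0).
have h1 t (t0 : 0 <= t) : 0 <= k * t.
  have [p0 pr] := rec t t0.
  by rewrite -(sheffer_h1 p0 pr (hm t t0) (ho t t0) (M0 t t0)) hpos.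
have h2 t (t0 : 0 <= t) : 0 <= (k * t + d) * (k * t).
  have [p0 pr] := rec t t0.
  by rewrite -(sheffer_h2 p0 pr (hm t t0) (ho t t0) (M0 t t0)) hpos.
have k0 : 0 < k.
  have := h1 1 ler01; rewrite mulr1 le0r => /orP[/eqP k0|//].
  have [p0 pr] := rec 1 ler01.
  have pk n : momf (M 1) (P n.+1 1) = 0.
    by rewrite -[P _ _]mulr1 -p0 ho ?ler01.
  have e1 : P 1%N 1 = _ := sheffer_p1 (p := fun n => P n 1) p0 pr.
  have e2 : P 2%N 1 = _ := sheffer_p2 (p := fun n => P n 1) p0 pr.
  case/negP: var; apply/eqP; rewrite -[RHS](mul0r 1) -k0.
  apply: (@meixP_var _ _ (B 1%N) k (- u 2%N) d); first exact: (M0 1 ler01).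
    by rewrite -[RHS](pk 0%N) e1 /meixP jacP1 /= mulr1 mul1r.
  by rewrite -[RHS](pk 1%N) e2 e1 p0 /meixP jacPSS jacP1 jacP0 /= !mulr1 !mul1r.
have d0 : 0 <= d.
  rewrite leNgt; apply/negP => dn.
  (* At this time k t = - d / 2, and the norm of P_2 would be - d^2 / 4 < 0. *)
  have t0 : 0 < - d / (2 * k) by rewrite divr_gt0 ?oppr_gt0 // mulr_gt0.
  have := h2 _ (ltW t0).
  have -> : k * (- d / (2 * k)) = - d / 2 by field; rewrite gt_eqF.
  nra.
have P1 : forall n, P n 1 = meixP (B 1%N) k (- u 2%N) d n 1.
  have [p0 pr] := rec 1 ler01.
  apply: (sheffer_meixP_at (p := fun n => P n 1) p0 pr (hm 1 ler01) (ho 1 ler01) (M0 1 ler01)).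
    by rewrite -/k mulr1 gt_eqF.
  by rewrite -/k -/d mulr1 gt_eqF // ltr_wpDr.
exists (B 1%N), k, (- u 2%N), d; split=> // t t0 n.
set N := meixN (- u 2%N) d; have N0 : N 0%N != 0 by rewrite /N meixN0 oner_neq0.
pose u' : fps R := X * sinv N; pose B' : fps R := ((B 1%N)%:S * X + k%:S * X ^+ 2) * sinv N.
have eu : N * u' = X by rewrite /u' mulrCA mul_sinv // mulr1.
have eB : N * B' = (B 1%N)%:S * X + k%:S * X ^+ 2 by rewrite /B' mulrCA mul_sinv // mulr1.
(* At t = 1 the generating functions agree, hence so do their reciprocals; x = 0 then identifies
   [B], and x = 1 identifies [u]. *)
have e x : 1 + 1%:S * B - x%:S * u = 1 + 1%:S * B' - x%:S * u'.
  have := meixP_den 1 x eu eB.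
  under [LHS]eq_fun do rewrite -P1.
  rewrite (hP 1 ler01 x); set f := _ - _; set g := _ - _ => fg.
  have f0 : f 0%N != 0.
    by rewrite /f fpsB fpsD !sconstM u0 B0 !mulr0 fps1 addr0 subr0 oner_neq0.
  have g0 : g 0%N != 0.
    rewrite /g fpsB fpsD !sconstM /u' /B' !fpsM0 fpsD !sconstM expr2 !sXM /sX /=.
    by rewrite !(mul0r, mulr0, addr0, subr0) fps1 oner_neq0.
  apply: (@fps_inv_uniq _ (sinv f)); first by rewrite mulrC mul_sinv.
  by rewrite fg mulrC mul_sinv.
have eB' : B = B'.
  have := e 0; rewrite -[0%:S]/(0 : fps R) -[1%:S]/(1 : fps R) !mul0r !subr0 !mul1r.
  exact: addrI.
have eu' : u = u'.
  by have := e 1; rewrite -[1%:S]/(1 : fps R) eB' !mul1r => /addrI /oppr_inj.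
apply: poly_fun_inj => x.
have e1 : (P n t).[x] = sinv (1 + t%:S * B - x%:S * u) n.
  exact: (congr1 (fun f : fps R => f n) (hP t t0 x)).
have e2 : (meixP (B 1%N) k (- u 2%N) d n t).[x] = sinv (1 + t%:S * B' - x%:S * u') n.
  exact: (congr1 (fun f : fps R => f n) (meixP_den t x eu eB)).
by rewrite e1 e2 -eB' -eu'.
Qed.

(** An affine map multiplies c by lam and k, d by lam^2, and rescaling time adjusts k; [b] absorbs
    the remaining drift m. The case is decided by d > 0, then by whether c = 0. *)
Lemma meixP_listed (m k c d : R) : 0 < k -> 0 <= d ->
  exists cs : mcase R, case_ok cs /\ exists lam b s : R, [/\ lam != 0, 0 < s &
    forall n t, meixP m k c d n t =
      lam ^+ n *: (listedP cs n (s * t) \Po (lam^-1 *: ('X - (b * t)%:P)))].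
Proof.
move=> k0 d0.
have conv (cs : mcase R) (lam b s : R) : lam != 0 ->
    lam * (mcase_par cs).1.1 * s + b = m -> lam * (mcase_par cs).1.2 = c ->
    lam ^+ 2 * s = k -> lam ^+ 2 * (mcase_par cs).2 = d ->
    forall n t, meixP m k c d n t =
      lam ^+ n *: (listedP cs n (s * t) \Po (lam^-1 *: ('X - (b * t)%:P))).
  move=> lam0 em ec ek ed n t; rewrite listedPE /meixP jacP_affine // -em -ec -ek -ed.
  by congr (jac_pair _ _ _).1; apply/funext => i; case: ifP => _; ring.
have [d_gt0|] := ltP 0 d.
  pose r := Num.sqrt d; have r0 : 0 < r by rewrite sqrtr_gt0.
  have r2 : r ^+ 2 = d by rewrite sqr_sqrtr.
  (* lam^2 = d normalises d to 1; the sign of c is given to lam so that a = c / (2 lam) is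
     nonnegative. *)
  pose lam := if 0 <= c then r else - r.
  have lam2 : lam ^+ 2 = d by rewrite /lam; case: ifP; rewrite ?sqrrN.
  have lam0 : lam != 0 by rewrite -sqrf_eq0 lam2 gt_eqF.
  exists (MFamily (c / (2 * lam))); split.
    rewrite /= /lam; case: ifP => c0; first by rewrite divr_ge0 // mulr_ge0 // ltW.
    rewrite mulrN invrN mulrN -mulNr divr_ge0 ?mulr_ge0 ?(ltW r0) //.
    by rewrite oppr_ge0 ltW // ltNge c0.
  exists lam, (m - lam * (c / (2 * lam)) * (k / d)), (k / d); split=> //.
    by rewrite divr_gt0.
  apply: conv => //=; first by ring.
  - by field.
  - by rewrite lam2 mulrC divfK // gt_eqF.
  - by rewrite mulr1.
move=> dle; have d00 : d = 0 by apply/eqP; rewrite eq_le dle d0.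
have [c0|c0] := eqVneq c 0.
  exists MSemicircle; split=> //; exists 1, m, k; split; rewrite ?oner_neq0 //.
  apply: conv; rewrite ?oner_neq0 //= ?c0 ?d00; ring.
(* lam = c normalises c to 1; it may be negative, which reflects the free Poisson law. *)
exists MPoisson; split=> //; exists c, (m - c * (k / c ^+ 2)), (k / c ^+ 2); split=> //.
  by rewrite divr_gt0 // exprn_even_gt0.
by apply: conv => //=; rewrite ?d00; field.
Qed.

End ShefferRecursion.

(** * Affine images and identification of the measures *)

Section Transport.
Variable R : realType.
Notation mu := (@lebesgue_measure R).

Lemma monic_OPS_momf (P : probability R R) (p : nat -> {poly R}) : all_moments P ->
  monic_OPS P p -> forall n k, n <> k -> momf (moment P) (p n * p k) = 0.
Proof.
move=> hP [_ ho] n k nk; have := ho n k nk.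
under eq_integral do rewrite -hornerM.
by rewrite (prob_poly _ hP).2 => -[].
Qed.

Lemma momf_sqr_ge0 (P : probability R R) (q : {poly R}) : all_moments P ->
  0 <= momf (moment P) (q * q).
Proof.
move=> hP; rewrite -lee_fin -(prob_poly _ hP).2.
by apply: integral_ge0 => x _; rewrite lee_fin hornerM -expr2 sqr_ge0.
Qed.

Section AffineImage.
Variables (P : probability R R) (a b : R).
Let psi (x : R) : R := a * (x - b).
Let mpsi : measurable_fun setT psi.
Proof.
by apply: measurable_funM => //; apply: measurable_funB.
Qed.
HB.instance Definition _ := isMeasurableFun.Build _ _ _ _ psi mpsi.

Definition affine_image : probability R R := distribution P psi.

Lemma affine_imageE (A : set R) : affine_image A = P (psi @^-1` A).
Proof. by []. Qed.

Let psiE (q : {poly R}) x : q.[psi x] = (q \Po (a *: ('X - b%:P))).[x].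
Proof. by rewrite horner_comp !hornerE. Qed.

Lemma affine_image_momf (q : {poly R}) : all_moments P ->
  all_moments affine_image /\
  momf (moment affine_image) q = momf (moment P) (q \Po (a *: ('X - b%:P))).
Proof.
move=> hP.
have push (r : {poly R}) : affine_image.-integrable setT (EFin \o horner r) /\
    (\int[affine_image]_x (r.[x])%:E = (momf (moment P) (r \Po (a *: ('X - b%:P))))%:E)%E.
  have mE : measurable_fun setT (EFin \o horner r).
    by apply/measurable_EFinP; exact: measurable_horner.
  have i1 : P.-integrable setT ((EFin \o horner r) \o psi).
    have [+ _] := prob_poly (r \Po (a *: ('X - b%:P))) hP.
    by under eq_fun do rewrite -psiE.
  split.
    by apply: (integrable_pushforward mpsi mE) => //; rewrite preimage_setT; exact: i1.
  rewrite -(prob_poly _ hP).2; under [RHS]eq_integral do rewrite -psiE.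
  have := integral_pushforward mpsi mE _ measurableT.
  by rewrite preimage_setT; apply; exact: i1.
have h : all_moments affine_image.
  move=> n; have -> : (fun x : R => (x ^+ n)%:E) = EFin \o horner 'X^n.
    by apply/funext => x; rewrite /= hornerXn.
  exact: (push _).1.
split=> //; have := (push q).2.
by rewrite (prob_poly _ h).2 => -[].
Qed.

End AffineImage.

Lemma even_exp_le (x C : R) n : `|x| <= C -> x ^+ (2 * n) <= C ^+ (2 * n).
Proof.
move=> xC; rewrite (le_trans (ler_norm _)) // normrX lerXn2r ?nnegrE //.
exact: le_trans xC.
Qed.

Lemma dmom_even_bound (f : R -> R) (C : R) : density f -> (forall x, 0 <= f x) ->
  (forall x, C < `|x| -> f x = 0) -> forall n,
  dmom f (2 * n) <= C ^+ (2 * n) * (\int[mu]_x f x)%R.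
Proof.
move=> df f0 fC n; have [fi _] := df; rewrite /dmom -RintegralZl //.
apply: le_Rintegral => //.
- have [+ _] := density_poly 'X^(2 * n) df.
  by under eq_fun do rewrite /= hornerXn.
- have [+ _] := density_scale (C ^+ (2 * n)) df; exact.
- move=> x _; have [xC|Cx] := leP `|x| C; last by rewrite fC // !mulr0.
  by rewrite ler_wpM2r // even_exp_le.
Qed.

Lemma pd_prob_even_bound (d : pdens R) : exists2 C, 0 < C &
  forall n, moment (pd_prob d) (2 * n) <= C ^+ (2 * n).
Proof.
have df := pd_density d; have [_ [C0 fC0]] := df.
(* C covers the support of the density and the atom; the summand 1 makes it positive. *)
pose C := 1 + `|C0| + `|pd_x d|.
have Cp : 0 < C by rewrite /C -addrA ltr_pwDl // addr_ge0.
exists C => // n; rewrite (pd_prob_moments d).2.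
have fC x : C < `|x| -> pd_f d x = 0.
  move=> Cx; apply: fC0; apply: le_lt_trans Cx; rewrite (le_trans (ler_norm _)) // /C.
  by rewrite addrAC lerDr addr_ge0.
apply: (@le_trans _ _ (C ^+ (2 * n) * ((\int[mu]_x pd_f d x)%R + pd_w d))); last first.
  by rewrite pd_mass mulr1.
rewrite mulrDr lerD ?dmom_even_bound ?pd_ge0 //; first by move=> x; exact: pd_ge0.
by rewrite mulrC ler_wpM2r ?pd_w0 // even_exp_le // /C lerDr addr_ge0.
Qed.

(** The law of lam^-1 (x - b) under [P] annihilates the same listed polynomials as the listed
    measure, so their moments agree; the bound on the even moments of the latter gives
    determinacy. *)
Lemma listed_measure_uniq (c : mcase R) (P : probability R R) (lam b t : R) :
  case_ok c -> 0 < t -> lam != 0 -> all_moments P ->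
  (forall n, momf (moment P) (listedP c n.+1 t \Po (lam^-1 *: ('X - b%:P))) = 0) ->
  forall A, measurable A -> P A = listedMu c t ((fun y => lam * y + b) @^-1` A).
Proof.
move=> ok t0 lam0 hP h A mA; pose P' := affine_image P lam^-1 b.
have aff q := affine_image_momf lam^-1 b q hP.
have [C C0 hC] := pd_prob_even_bound (listed_pdens ok t0).
have E : moment (pd_prob (listed_pdens ok t0)) =1 moment P'.
  have hm : moment (pd_prob (listed_pdens ok t0)) = listed_mom c t.
    by apply/funext => n; rewrite (pd_prob_moments _).2.
  apply: (momf_monic_inj (P := fun n => listedP c n t)).
  - by move=> n; rewrite listedPE; exact: jacP_monic.
  - by rewrite !moment0.
  - move=> n; rewrite (aff _).2 h hm; exact: (lspec_orth (listed_specP ok t0)).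
have mB : measurable ((fun y : R => lam * y + b) @^-1` A).
  rewrite -[X in measurable X]setTI.
  by apply: (measurable_funD (measurable_funM _ _) _ measurableT) => //.
have := moment_determinacy C0 (pd_prob_moments _).1 (aff 0).1 E hC mB.
rewrite pd_probE affine_imageE -/(listedMu c t _) => e.
rewrite [RHS]e; congr (P _); apply/seteqP; split=> x /=.
  by rewrite mulVKf // subrK.
by rewrite mulVKf // subrK.
Qed.

Lemma free_Meixner_listed (M : R -> probability R R) (P : nat -> R -> {poly R}) :
  free_Meixner M P -> nontrivial M ->
  exists c : mcase R, case_ok c /\
  exists lam b s : R, [/\ lam != 0, 0 < s,
    (forall t, 0 <= t -> forall n : nat,
        P n t = lam ^+ n *: (listedP c n (s * t) \Po (lam^-1 *: ('X - (b * t)%:P)))) &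
    (forall t, 0 < t -> forall A : set R, measurable A ->
        M t A = listedMu c (s * t) ((fun y => lam * y + b * t) @^-1` A))].
Proof.
move=> [f [[hint _ hR] hO [u [v [pu pv hS]]]]] nt.
have hM t : 0 <= t -> all_moments (M t) := hint t.
have orth t t0 := monic_OPS_momf (hM t t0) (hO t t0).
have mon t t0 : forall n, P n t \is monic /\ size (P n t) = n.+1 := (hO t t0).1.
have P0 t (t0 : 0 <= t) : P 0%N t = 1.
  have [m0 s0] := mon t t0 0%N; have := monicP m0; rewrite lead_coefE s0 /= => e.
  by have := size1_polyC (eq_leq s0); rewrite e.
have orth0 t (t0 : 0 <= t) n : momf (moment (M t)) (P n.+1 t) = 0.
  by rewrite -[P _ _]mulr1 -(P0 t t0) orth.
(* As u and v do not depend on t, one time suffices; t = 0 is taken. *)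
have uv : u = v.
  apply: (sheffer_of_Rtransform (m := moment (M 0)) (f := f) (t := 0) (P := fun n => P n 0) pu pv).
  - by move=> n x; rewrite -hS.
  - by rewrite -cauchy_serE; exact: hR.
  - by rewrite P0 // momf1 moment0.
  - by move=> n; exact: orth0.
subst v; have [u0 u1] := pu.
pose B : fps R := (u : fps R) * (scomp f u : fps R).
have B0 : B 0%N = 0 by rewrite /B fpsM0 u0 mul0r.
have den t : 0 <= t -> forall x, (fun n => (P n t).[x]) =
    sinv (1 + (sconst t : fps R) * B - (sconst x : fps R) * (u : fps R)) :> fps R.
  move=> t0 x; rewrite -[LHS]/(genser P t x) hS // sheffer_den_diag // !sscaleE.
  congr sinv; rewrite -[smul u _]/B.
  rewrite -[sadd _ (sadd _ _)]/((1 : fps R) + ((sconst t : fps R) * B + (sconst (- x) : fps R) * u)).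
  rewrite addrA; congr (_ + _); apply/funext => n.
  by rewrite fpsN !sconstM mulNr.
have [m [k [c [d [k0 d0 hP]]]]] := sheffer_meixP u0 u1 B0 den
  (fun t _ => moment0 (M t)) mon orth (fun t t0 q => momf_sqr_ge0 q (hM t t0)) nt.
have [cs [ok [lam [b [s [lam0 s0 e]]]]]] := meixP_listed m c k0 d0.
exists cs; split=> //; exists lam, b, s; split=> // [t t0 n|t t0 A mA].
  by rewrite hP // e.
apply: listed_measure_uniq => //; first by rewrite mulr_gt0.
  exact: hM (ltW t0).
move=> n; have := orth0 t (ltW t0) n; rewrite hP ?(ltW t0) // e momfZ => /eqP.
by rewrite mulf_eq0 expf_eq0 /= (negbTE lam0) => /eqP.
Qed.

End Transport.

Theorem theorem3p3 (R : realType) :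
  (* (1) every system of the list is a non-trivial free Meixner system,
         with the stated generating function, measures and
         Chebyshev representation *)
  (forall c : mcase R, case_ok c ->
    let u := listed_u c in
    let Rm := listed_R c in
    exists mu : R -> probability R R,
      free_semigroup mu Rm /\
          nontrivial mu /\
          (forall t, 0 <= t -> monic_OPS (mu t) (fun n => listedP c n t)) /\
          P01 u /\
          (forall t, 0 <= t -> forall x : R,
              genser (listedP c) t x = sinv (sheffer_den Rm t u u x) /\
              genser (listedP c) t x =
                sinv (sadd (sconst 1)
                        (sadd (sscale t (smul u (scomp Rm u))) (sscale (- x) u)))) /\
          (forall t, 0 < t -> forall A : set R, measurable A ->
              mu t A = listedMu c t A) /\
          (forall t, 0 <= t -> cheb_relation c t))
  /\
  (* (2) every non-trivial free Meixner system is, up to an affine change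
         x |-> lam x + b t of x and a rescaling t |-> s t (s > 0), one of
         the list *)
  (forall (mu : R -> probability R R) (P : nat -> R -> {poly R}),
    free_Meixner mu P -> nontrivial mu ->
    exists c : mcase R, case_ok c /\
    exists lam b s : R, [/\ lam != 0, 0 < s,
      (forall t, 0 <= t -> forall n : nat,
          P n t = lam ^+ n *: ((listedP c n (s * t))
                                 \Po (lam^-1 *: ('X - (b * t)%:P)))) &
      (forall t, 0 < t -> forall A : set R, measurable A ->
          mu t A = listedMu c (s * t) ((fun y => lam * y + b * t) @^-1` A))]).
Proof.
split; last exact: free_Meixner_listed.
move=> c ok; have [h1 h2 h3] := listed_system ok; have [pu _] := listed_uE c.
exists (listed_prob ok); split; [|split; [|split; [|split; [|split; [|split]]]]] => //.
- by move=> t t0 x; rewrite sheffer_den_diag // listed_genser.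
- by move=> t t0 A mA; exact: listed_probE.
- by move=> t; exact: listed_cheb_relation.
Qed.
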